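(* Let $\Phi=\begin{pmatrix}\Phi_{11}&\Phi_{12}\\ \Phi_{21}&\Phi_{22}\end{pmatrix}$ be a bounded block matrix function on $\mathbb T$ ($\Phi_{11}$ of size $m_1\times n_1$, $\Phi_{22}$ of size $m_2\times n_2$) such that $\|\Gamma_\Phi\|_{\rm e}<\|\Gamma_\Phi\|=t_0$, let $V,W$ be the unitary-valued matrix functions and $u_0$ the unimodular function associated with $\Phi$ as in the context, and let $Q_0$ be an optimal solution of the four block problem for $\Phi$. Suppose that $\Phi^{(1)}_{11}$ (of size $(m_1-1)\times(n_1-1)$), $\Phi^{(1)}_{12},\Phi^{(1)}_{21},\Phi^{(1)}_{22}$ satisfy $$\begin{pmatrix}\Phi_{11}-Q_0&\Phi_{12}\\ \Phi_{21}&\Phi_{22}\end{pmatrix}=W^*\begin{pmatrix}t_0u_0&0&0\\ 0&\Phi^{(1)}_{11}&\Phi^{(1)}_{12}\\ 0&\Phi^{(1)}_{21}&\Phi^{(1)}_{22}\end{pmatrix}V^*.$$ Let $Q$ be a matrix function of size $m_1\times n_1$ on $\mathbb T$. Then $Q$ is an optimal solution of the four block problem for $\Phi$ if and only if there exists $Q_1\in H^\infty(M_{m_1-1,n_1-1})$ such that $$\begin{pmatrix}\Phi_{11}-Q&\Phi_{12}\\ \Phi_{21}&\Phi_{22}\end{pmatrix}=W^*\begin{pmatrix}t_0u_0&0&0\\ 0&\Phi^{(1)}_{11}-Q_1&\Phi^{(1)}_{12}\\ 0&\Phi^{(1)}_{21}&\Phi^{(1)}_{22}\end{pmatrix}V^*$$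 and $$\left\|\begin{pmatrix}\Phi^{(1)}_{11}-Q_1&\Phi^{(1)}_{12}\\ \Phi^{(1)}_{21}&\Phi^{(1)}_{22}\end{pmatrix}\right\|_\infty\le t_0.$$
   Context: $\mathbb T$ is the unit circle, $z$ the identity function on $\mathbb T$; $H^2_-=L^2\ominus H^2$; $M_{k,l}$ is the space of $k\times l$ matrices; $\|F\|_\infty=\operatorname{ess\,sup}_{\zeta\in\mathbb T}\|F(\zeta)\|$; $\|T\|_{\rm e}$ is the essential norm (distance to the compact operators). Put $m=m_1+m_2$, $n=n_1+n_2$. Blocks with zero rows or columns are treated as empty. $\Gamma_\Phi:H^2(\mathbb C^{n_1})\oplus L^2(\mathbb C^{n_2})\to H^2_-(\mathbb C^{m_1})\oplus L^2(\mathbb C^{m_2})$ is $\Gamma_\Phi f=\mathbb P^-\Phi f$, with $\mathbb P^-$ the orthogonal projection of $L^2(\mathbb C^{m_1})\oplus L^2(\mathbb C^{m_2})$ onto $H^2_-(\mathbb C^{m_1})\oplus L^2(\mathbb C^{m_2})$. An optimal solution of the four block problem for $\Phi$ is a $Q\in H^\infty(M_{m_1,n_1})$ minimizing $\left\|\begin{pmatrix}\Phi_{11}-Q&\Phi_{12}\\ \Phi_{21}&\Phi_{22}\end{pmatrix}\right\|_\infty$ over $H^\infty(M_{m_1,n_1})$; the minimum equals $\|\Gamma_\Phi\|$. Inner/outer: $\Theta\in H^\infty$ is inner if $\Theta(\zeta)$ is isometric a.e. on $\mathbb T$; $F\in H^\infty(M_{k,l})$ is outer if $FH^2(\mathbb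 C^l)$ is dense in $H^2(\mathbb C^k)$, and co-outer if the transpose $F^t$ is outer. Construction of $V,W,u_0$ (when $\|\Gamma_\Phi\|_{\rm e}<\|\Gamma_\Phi\|=t_0$): fix a maximizing vector $f=f_1\oplus f_2$ of $\Gamma_\Phi$ ($f\ne0$, $\|\Gamma_\Phi f\|=\|\Gamma_\Phi\|\,\|f\|$; it exists), $f_1\in H^2(\mathbb C^{n_1})$, $f_2\in L^2(\mathbb C^{n_2})$, and put $g=g_1\oplus g_2=t_0^{-1}\Gamma_\Phi f$. Then $f_1\neq0$, $g_1\ne0$ and $\|g(\zeta)\|=\|f(\zeta)\|$ a.e. Let $h\in H^2$ be scalar outer with $|h(\zeta)|=\|f(\zeta)\|$ a.e.; let $\vartheta$ be a greatest common inner divisor of the entries of $f_1$ and $\tau$ one of the entries of $\bar z\bar g_1$ (bar = entrywise conjugation). Put $v=v_1\oplus v_2=\bar\vartheta f/h$, $w=w_1\oplus w_2=\bar z\bar\tau\bar g/h$, so $v_1\in H^\infty(\mathbb C^{n_1})$, $w_1\in H^\infty(\mathbb C^{m_1})$, and $u_0=\bar z\bar\vartheta\bar\tau\bar h/h$. Let $v_{(i)}$, $w_{(i)}$ be the inner parts of $v_1,w_1$ ($v_1=v_{(o)}v_{(i)}$ with $v_{(o)}$ scalar outer and $v_{(i)}$ an inner column; similarly $w_1$). Choose inner co-outer $V_c\in H^\infty(M_{n_1,n_1-1})$, $W_c\in H^\infty(M_{m_1,m_1-1})$ such that $(v_{(i)}\ \ \overline{V_c})$ and $(w_{(i)}\ \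 \overline{W_c})$ are unitary-valued. Finally $V$ ($n\times n$) and $W$ ($m\times m$) are unitary-valued measurable functions of the form $$V=\begin{pmatrix}v_1&\overline{V_c}&\star\\ v_2&0&\star\end{pmatrix},\qquad W^t=\begin{pmatrix}w_1&\overline{W_c}&\star\\ w_2&0&\star\end{pmatrix},$$ where the $\star$'s form an arbitrary measurable unitary completion. *)

(* Defs.v *)
From HB Require Import structures.
From mathcomp Require Import all_boot all_order all_algebra.
From mathcomp Require Import complex.
From mathcomp Require Import all_classical all_reals all_analysis ess_sup_inf.

Set Implicit Arguments.
Unset Strict Implicit.
Unset Printing Implicit Defensive.

Import Order.TTheory GRing.Theory Num.Theory.
Import numFieldNormedType.Exports.
Import ComplexField.Normc.

Local Open Scope classical_set_scope.
Local Open Scope ring_scope.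
Local Open Scope complex_scope.
Local Open Scope sesquilinear_scope.

Definition circle (R : realType) : Type := {z : R[i] | normc z == 1}.

Section circle_structure.
Context {R : realType}.

HB.instance Definition _ := gen_eqMixin (circle R).
HB.instance Definition _ := gen_choiceMixin (circle R).

Lemma normc_expi (t : R) : normc (cos (2 * pi * t) +i* sin (2 * pi * t)) == 1.
Proof. by rewrite /normc cos2Dsin2 sqrtr1. Qed.

(* t |-> exp(2 pi i t) *)
Definition expi (t : R) : circle R := exist (fun z : R[i] => normc z == 1) _ (normc_expi t).

HB.instance Definition _ := isPointed.Build (circle R) (expi 0).

(* The final sigma-algebra of [expi]; it is the Borel sigma-algebra, because
   [expi] is Borel and injective on [0, 1[ with image the whole circle. *)
Definition circle_measurable : set (set (circle R)) :=
  [set A | measurable (expi @^-1` A)].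

Lemma circle_measurable0 : circle_measurable set0.
Proof. by rewrite /circle_measurable /= preimage_set0. Qed.

Lemma circle_measurableC A : circle_measurable A -> circle_measurable (~` A).
Proof. by rewrite /circle_measurable /= preimage_setC; exact: measurableC. Qed.

Lemma circle_measurable_bigcup (F : (set (circle R))^nat) :
  (forall i, circle_measurable (F i)) -> circle_measurable (\bigcup_i F i).
Proof.
by move=> mF; rewrite /circle_measurable /= preimage_bigcup; exact: bigcupT_measurable.
Qed.

HB.instance Definition _ := @isMeasurable.Build default_measure_display
  (circle R) circle_measurable circle_measurable0 circle_measurableC
  circle_measurable_bigcup.

(* Normalized arc length: the law of [expi U], U uniform on [0, 1]. *)
Definition arc_length : set (circle R) -> \bar R :=
  pushforward (uniform_prob (@ltr01 R)) expi.

Lemma measurable_expi : measurable_fun [set: R] expi.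
Proof. by move=> _ A mA; rewrite setTI. Qed.

Lemma arc_length0 : arc_length set0 = 0%E.
Proof. by rewrite /arc_length /pushforward preimage_set0 measure0. Qed.

Lemma arc_length_ge0 A : (0 <= arc_length A)%E.
Proof. exact: (measure_ge0 (uniform_prob (@ltr01 R))). Qed.

Lemma arc_length_sigma_additive : semi_sigma_additive arc_length.
Proof.
move=> F mF tF mUF; rewrite /arc_length /pushforward preimage_bigcup.
apply: measure_semi_sigma_additive => //.
apply/trivIsetP => /= i j _ _ ij; rewrite -preimage_setI.
by move/trivIsetP : tF => /(_ _ _ _ _ ij) ->//; rewrite preimage_set0.
Qed.

HB.instance Definition _ := isMeasure.Build _ _ _ arc_length
  arc_length0 arc_length_ge0 arc_length_sigma_additive.

End circle_structure.

Section function_spaces.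
Context {R : realType}.
Local Notation C := R[i].
Local Notation T := (circle R).
Local Notation mu := (@arc_length R).

Definition cintegral (f : T -> C) : C :=
  (\int[mu]_z complex.Re (f z)) +i* (\int[mu]_z complex.Im (f z)).

Definition vnorm k (x : 'cV[C]_k) : R :=
  Num.sqrt (\sum_(i < k) normc (x i 0) ^+ 2).

Definition mxnorm k l (A : 'M[C]_(k, l)) : R :=
  sup [set vnorm (A *m x) | x in [set x : 'cV[C]_l | vnorm x <= 1]].

Definition measurable_mx k l (F : T -> 'M[C]_(k, l)) : Prop :=
  forall i j, measurable_fun [set: T] (fun z => complex.Re (F z i j)) /\
              measurable_fun [set: T] (fun z => complex.Im (F z i j)).

Definition Linf_norm k l (F : T -> 'M[C]_(k, l)) : \bar R :=
  ess_sup mu (fun z => (mxnorm (F z))%:E).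

Definition Linf k l : set (T -> 'M[C]_(k, l)) :=
  [set F | measurable_mx F /\ (Linf_norm F < +oo)%E].

Definition L2 k : set (T -> 'cV[C]_k) :=
  [set f | measurable_mx f /\ (\int[mu]_z (vnorm (f z) ^+ 2)%:E < +oo)%E].

Definition L2norm k (f : T -> 'cV[C]_k) : R :=
  Num.sqrt (\int[mu]_z (vnorm (f z) ^+ 2)).

Definition L2inner k (f g : T -> 'cV[C]_k) : C :=
  cintegral (fun z => ((g z) ^t* *m f z) 0 0).

Definition fourier (f : T -> C) (j : int) : C :=
  cintegral (fun z => f z * val z ^ (- j)).

Definition analytic_mx k l (F : T -> 'M[C]_(k, l)) : Prop :=
  forall r s (j : int), j < 0 -> fourier (fun z => F z r s) j = 0.

Definition H2 k : set (T -> 'cV[C]_k) :=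
  [set f | L2 f /\ analytic_mx f].

Definition Hinf k l : set (T -> 'M[C]_(k, l)) :=
  [set F | Linf F /\ analytic_mx F].

(* L^2 (-) H^2 *)
Definition H2minus k : set (T -> 'cV[C]_k) :=
  [set f | L2 f /\ forall g, H2 g -> L2inner f g = 0].

(* Scalar functions are 1 x 1 matrix functions. *)
Definition scal (phi : T -> C) : T -> 'M[C]_1 := fun z => (phi z)%:M.

Definition inner k l (F : T -> 'M[C]_(k, l)) : Prop :=
  Hinf F /\ \forall z \ae mu, forall x : 'cV[C]_l, vnorm (F z *m x) = vnorm x.

Definition outer k l (F : T -> 'M[C]_(k, l)) : Prop :=
  Hinf F /\
  forall g : T -> 'cV[C]_k, H2 g -> forall e : R, 0 < e ->
  exists2 f : T -> 'cV[C]_l, H2 f & L2norm (fun z => F z *m f z - g z) < e.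

Definition co_outer k l (F : T -> 'M[C]_(k, l)) : Prop :=
  outer (fun z => (F z)^T).

(* For h in H^2 the set h H^2 need not lie in H^2, so outerness is density of
   the products of h with analytic polynomials. *)
Definition outer_H2 (h : T -> C) : Prop :=
  H2 (scal h) /\
  forall g : T -> 'cV[C]_1, H2 g -> forall e : R, 0 < e ->
  exists p : {poly C}, L2norm (fun z => scal h z *m (p.[val z])%:M - g z) < e.

Definition inner_divides_H2 (theta phi : T -> C) : Prop :=
  exists2 psi : T -> C, H2 (scal psi) &
    \forall z \ae mu, phi z = theta z * psi z.

Definition is_gcd_inner k (f : T -> 'cV[C]_k) (theta : T -> C) : Prop :=
  [/\ inner (scal theta),
      (forall i, inner_divides_H2 theta (fun z => f z i 0)) &
      forall eta : T -> C, inner (scal eta) ->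
        (forall i, inner_divides_H2 eta (fun z => f z i 0)) ->
        exists2 psi : T -> C, inner (scal psi) &
          \forall z \ae mu, theta z = eta z * psi z].

(* Operators act on representatives of L^2 classes, so the projection is
   determined by its argument only up to a null set. *)

Definition orth_proj k (E : set (T -> 'cV[C]_k)) (f : T -> 'cV[C]_k) :
    T -> 'cV[C]_k :=
  xget (fun=> 0) [set g | E g /\
    forall s, E s -> L2inner (fun z => f z - g z) s = 0].

Definition op_norm k l (D : set (T -> 'cV[C]_l))
    (A : (T -> 'cV[C]_l) -> T -> 'cV[C]_k) : \bar R :=
  ereal_sup [set (L2norm (A f))%:E | f in [set f | D f /\ L2norm f <= 1]].

Definition compact_op k l (D : set (T -> 'cV[C]_l)) (E : set (T -> 'cV[C]_k))
    (K : (T -> 'cV[C]_l) -> T -> 'cV[C]_k) : Prop :=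
  [/\ (forall f, D f -> E (K f)),
      (forall f g, D f -> D g -> (\forall z \ae mu, f z = g z) ->
        \forall z \ae mu, K f z = K g z),
      (forall (a : C) f g, D f -> D g -> \forall z \ae mu,
        K (fun w => a *: f w + g w) z = a *: K f z + K g z) &
      forall f_ : nat -> T -> 'cV[C]_l,
        (forall i, D (f_ i) /\ L2norm (f_ i) <= 1) ->
        exists (s : nat -> nat) (g : T -> 'cV[C]_k),
          [/\ {homo s : i j / (i < j)%N}, E g &
              (fun i => L2norm (fun z => K (f_ (s i)) z - g z)) @ \oo --> 0]].

Definition ess_norm k l (D : set (T -> 'cV[C]_l)) (E : set (T -> 'cV[C]_k))
    (A : (T -> 'cV[C]_l) -> T -> 'cV[C]_k) : \bar R :=
  ereal_inf [set op_norm D (fun f z => A f z - K f z) | K in compact_op D E].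

End function_spaces.

Section four_block.
Context {R : realType}.
Local Notation C := R[i].
Local Notation T := (circle R).
Local Notation mu := (@arc_length R).

(* H^2(C^n1) (+) L^2(C^n2) *)
Definition fb_dom n1 n2 : set (T -> 'cV[C]_(n1 + n2)) :=
  [set f | H2 (fun z => usubmx (f z)) /\ L2 (fun z => dsubmx (f z))].

(* H^2_-(C^m1) (+) L^2(C^m2) *)
Definition fb_cod m1 m2 : set (T -> 'cV[C]_(m1 + m2)) :=
  [set f | H2minus (fun z => usubmx (f z)) /\ L2 (fun z => dsubmx (f z))].

Definition Gamma m1 m2 n1 n2 (Phi : T -> 'M[C]_(m1 + m2, n1 + n2))
    (f : T -> 'cV[C]_(n1 + n2)) : T -> 'cV[C]_(m1 + m2) :=
  orth_proj (@fb_cod m1 m2) (fun z => Phi z *m f z).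

Definition Gamma_norm m1 m2 n1 n2 (Phi : T -> 'M[C]_(m1 + m2, n1 + n2)) :=
  op_norm (@fb_dom n1 n2) (Gamma Phi).

Definition Gamma_ess_norm m1 m2 n1 n2
    (Phi : T -> 'M[C]_(m1 + m2, n1 + n2)) :=
  ess_norm (@fb_dom n1 n2) (@fb_cod m1 m2) (Gamma Phi).

Definition fb_block m1 m2 n1 n2
    (F11 : T -> 'M[C]_(m1, n1)) (F12 : T -> 'M[C]_(m1, n2))
    (F21 : T -> 'M[C]_(m2, n1)) (F22 : T -> 'M[C]_(m2, n2)) :
    T -> 'M[C]_(m1 + m2, n1 + n2) :=
  fun z => block_mx (F11 z) (F12 z) (F21 z) (F22 z).

Definition fb_optimal m1 m2 n1 n2
    (Phi11 : T -> 'M[C]_(m1, n1)) (Phi12 : T -> 'M[C]_(m1, n2))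
    (Phi21 : T -> 'M[C]_(m2, n1)) (Phi22 : T -> 'M[C]_(m2, n2))
    (Q : T -> 'M[C]_(m1, n1)) : Prop :=
  Hinf Q /\
  forall Q', Hinf Q' ->
    (Linf_norm (fb_block (fun z => Phi11 z - Q z)%R Phi12 Phi21 Phi22) <=
     Linf_norm (fb_block (fun z => Phi11 z - Q' z)%R Phi12 Phi21 Phi22))%E.

Definition fb_maximizing m1 m2 n1 n2 (Phi : T -> 'M[C]_(m1 + m2, n1 + n2))
    (f : T -> 'cV[C]_(n1 + n2)) : Prop :=
  [/\ fb_dom f, L2norm f != 0 &
      (L2norm (Gamma Phi f))%:E = (Gamma_norm Phi * (L2norm f)%:E)%E].

(* Here m1 = p.+1 and n1 = q.+1.  The dimensions [p.+1 + m2] and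
   [(1 + p) + m2] are convertible, and likewise for q and n2. *)
Record fb_construction p m2 q n2
    (Phi : T -> 'M[C]_(p.+1 + m2, q.+1 + n2)) (t0 : R) := FBConstruction {
  fb_f : T -> 'cV[C]_(q.+1 + n2);
  fb_f_max : fb_maximizing Phi fb_f;
  fb_g : T -> 'cV[C]_(p.+1 + m2) := fun z => (t0^-1)%:C *: Gamma Phi fb_f z;
  fb_h : T -> C;
  fb_h_outer : outer_H2 fb_h;
  fb_h_mod : \forall z \ae mu, normc (fb_h z) = vnorm (fb_f z);
  fb_theta : T -> C;
  fb_theta_gcd : is_gcd_inner (fun z => usubmx (fb_f z)) fb_theta;
  fb_tau : T -> C;
  fb_tau_gcd : is_gcd_inner
    (fun z => (val z)^* *: map_mx Num.conj (usubmx (fb_g z))) fb_tau;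
  fb_v : T -> 'cV[C]_(q.+1 + n2) :=
    fun z => ((fb_theta z)^* / fb_h z) *: fb_f z;
  fb_w : T -> 'cV[C]_(p.+1 + m2) :=
    fun z => ((val z)^* * (fb_tau z)^* / fb_h z) *: map_mx Num.conj (fb_g z);
  fb_u0 : T -> C :=
    fun z => (val z)^* * (fb_theta z)^* * (fb_tau z)^* * (fb_h z)^* / fb_h z;
  fb_vo : T -> C;
  fb_vi : T -> 'cV[C]_q.+1;
  fb_vo_outer : outer (scal fb_vo);
  fb_vi_inner : inner fb_vi;
  fb_v1E : \forall z \ae mu, usubmx (fb_v z) = fb_vo z *: fb_vi z;
  fb_wo : T -> C;
  fb_wi : T -> 'cV[C]_p.+1;
  fb_wo_outer : outer (scal fb_wo);
  fb_wi_inner : inner fb_wi;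
  fb_w1E : \forall z \ae mu, usubmx (fb_w z) = fb_wo z *: fb_wi z;
  fb_Vc : T -> 'M[C]_(q.+1, q);
  fb_Vc_inner : inner fb_Vc;
  fb_Vc_co_outer : co_outer fb_Vc;
  fb_Vc_unitary : \forall z \ae mu,
    row_mx (fb_vi z) (map_mx Num.conj (fb_Vc z)) \is unitarymx;
  fb_Wc : T -> 'M[C]_(p.+1, p);
  fb_Wc_inner : inner fb_Wc;
  fb_Wc_co_outer : co_outer fb_Wc;
  fb_Wc_unitary : \forall z \ae mu,
    row_mx (fb_wi z) (map_mx Num.conj (fb_Wc z)) \is unitarymx;
  fb_V : T -> 'M[C]_(q.+1 + n2, q.+1 + n2);
  fb_V_measurable : measurable_mx fb_V;
  fb_V_unitary : \forall z \ae mu, fb_V z \is unitarymx;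
  fb_VE : \forall z \ae mu,
    lsubmx (fb_V z) =
    block_mx (usubmx (fb_v z)) (map_mx Num.conj (fb_Vc z))
             (dsubmx (fb_v z)) 0 :> 'M[C]_(q.+1 + n2, 1 + q);
  fb_W : T -> 'M[C]_(p.+1 + m2, p.+1 + m2);
  fb_W_measurable : measurable_mx fb_W;
  fb_W_unitary : \forall z \ae mu, fb_W z \is unitarymx;
  fb_WE : \forall z \ae mu,
    lsubmx ((fb_W z)^T) =
    block_mx (usubmx (fb_w z)) (map_mx Num.conj (fb_Wc z))
             (dsubmx (fb_w z)) 0 :> 'M[C]_(p.+1 + m2, 1 + p)
}.

(* W^* diag(t0 u0, Psi) V^* *)
Definition fb_factored p m2 q n2
    (Phi : T -> 'M[C]_(p.+1 + m2, q.+1 + n2)) (t0 : R)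
    (c : fb_construction Phi t0) (Psi : T -> 'M[C]_(p + m2, q + n2)) :
    T -> 'M[C]_(p.+1 + m2, q.+1 + n2) :=
  fun z => (fb_W c z) ^t* *m
    (block_mx (t0%:C * fb_u0 c z)%:M 0 0 (Psi z) :
      'M[C]_(1 + (p + m2), 1 + (q + n2))) *m (fb_V c z) ^t*.

End four_block.

(* Main.v *)
(* A function Q of H^infinity is optimal iff the error Phi - Q (with Q placed in
   the upper left corner) has norm at most t0 = ||Gamma_Phi||.  If it is, then
   equality in ||Gamma_Phi f|| = t0 ||f|| forces (Phi - Q) f = Gamma_Phi f and
   (Phi - Q)^* Gamma_Phi f = t0^2 f.  Two optimal Q, Q0 hence satisfy
   (Q - Q0) f_1 = 0 and (Q - Q0)^* g_1 = 0, so that Q - Q0 = Wc Q1 Vc^t with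
   Q1 = Wc^* (Q - Q0) conj(Vc), and Q1 is analytic because Vc and Wc are
   co-outer.  Since W^* diag(0, Q1, 0) V^* = diag(Wc Q1 Vc^t, 0), the two
   factorizations correspond, and the norms agree by unitarity of V and W.

   That the infimum of the error norms is t0 is obtained by choosing the Taylor
   coefficients of Q one at a time: the form
   t ||f||^2 + t ||g||^2 - 2 Re <(Phi - Q_k) f, g> is kept nonnegative for f with
   spectrum in [0, +oo[ and g with spectrum in ]-oo, k[, at the price of letting
   t grow by e 2^-k (Parrott's theorem without exact minimizers).  Testing the
   limit on f = p u, g = p v with p a polynomial and u, v constant yields an
   inequality integrated against |p|^2, hence an almost everywhere bound. *)

Require Import Defs.
From mathcomp Require Import all_boot all_order all_algebra.
From mathcomp Require Import complex ring lra.
From mathcomp Require Import all_classical all_reals all_analysis ess_sup_inf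
  measurable_realfun.

Set Implicit Arguments.
Unset Strict Implicit.
Unset Printing Implicit Defensive.

Import Order.TTheory GRing.Theory Num.Theory.
Import numFieldNormedType.Exports.
Import ComplexField.Normc.

Local Open Scope classical_set_scope.
Local Open Scope ring_scope.

Local Notation "R [i]" := (complex R) : type_scope.
Local Notation "x %:C" := (real_complex _ x) : ring_scope.
Local Notation "A ^t*" := (map_mx Num.conj A^T) : ring_scope.

(** * Hermitian forms and the one-step extension *)

Section complex_numbers.
Context {R : realType}.
Local Notation C := R[i].

(** Optimality is a minimization property, so the value of the minimum must be known before any
    parametrization. The bound from below is cheap, because an analytic [Q] does not contribute to
    the pairing with the codomain of the four block operator. The bound from above is an existence
    theorem, but only the infimum matters: functions with bound [t0 + e] for every [e > 0] suffice,
    so nothing has to be attained and no compactness is used. This makes an approximate form of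
    Parrott's step adequate; the forms are only semidefinite on infinite-dimensional subspaces,
    where minimizers may fail to exist. The induction on coefficients closes because multiplication
    by z commutes with [Phi]. One of the two positivity hypotheses of the step is the previous stage
    itself, the other is that stage multiplied by z, and the new coefficient governs exactly the one
    pairing that neither of them controls. Encoding the norm bound as positivity of a single
    Hermitian matrix function also disposes of the four block structure: the L^2 summands are simply
    coordinates on which no spectral condition is imposed. *)

Lemma complex_eqP (x y : C) : complex.Re x = complex.Re y ->
  complex.Im x = complex.Im y -> x = y.
Proof. by case: x y => ? ? [? ?] /= -> ->. Qed.

Lemma Re_add (x y : C) : complex.Re (x + y) = complex.Re x + complex.Re y.
Proof. by case: x; case: y. Qed.

Lemma Im_add (x y : C) : complex.Im (x + y) = complex.Im x + complex.Im y.
Proof. by case: x; case: y. Qed.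

Lemma Re_opp (x : C) : complex.Re (- x) = - complex.Re x.
Proof. by case: x. Qed.

Lemma Im_opp (x : C) : complex.Im (- x) = - complex.Im x.
Proof. by case: x. Qed.

Lemma Re_mul (x y : C) :
  complex.Re (x * y) = complex.Re x * complex.Re y - complex.Im x * complex.Im y.
Proof. by case: x; case: y. Qed.

Lemma Im_mul (x y : C) :
  complex.Im (x * y) = complex.Re x * complex.Im y + complex.Im x * complex.Re y.
Proof. by case: x; case: y. Qed.

Lemma Re_scale (r : R) (x : C) : complex.Re (r%:C * x) = r * complex.Re x.
Proof. by case: x => a b /=; rewrite mul0r subr0. Qed.

Lemma Re_conjC (x : C) : complex.Re x^* = complex.Re x.
Proof. by case: x. Qed.

Lemma Im_conjC (x : C) : complex.Im x^* = - complex.Im x.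
Proof. by case: x. Qed.

Lemma Re_sum (I : Type) (r : seq I) (P : pred I) (F : I -> C) :
  complex.Re (\sum_(i <- r | P i) F i) = \sum_(i <- r | P i) complex.Re (F i).
Proof. by apply: (big_morph _ Re_add). Qed.

Lemma normc_ge0 (x : C) : 0 <= normc x.
Proof. by case: x => a b; exact: sqrtr_ge0. Qed.

Lemma sqr_normcE (x : C) : normc x ^+ 2 = complex.Re x ^+ 2 + complex.Im x ^+ 2.
Proof. by case: x => a b /=; rewrite sqr_sqrtr// addr_ge0// sqr_ge0. Qed.

Lemma normr_Re_le (x : C) : `|complex.Re x| <= normc x.
Proof.
by rewrite -ler_sqr ?nnegrE ?normc_ge0// real_normK ?num_real// sqr_normcE lerDl sqr_ge0.
Qed.

Lemma normr_Im_le (x : C) : `|complex.Im x| <= normc x.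
Proof.
by rewrite -ler_sqr ?nnegrE ?normc_ge0// real_normK ?num_real// sqr_normcE lerDr sqr_ge0.
Qed.

Lemma mulcJ (x : C) : x * x^* = (normc x ^+ 2)%:C.
Proof.
by apply: complex_eqP; rewrite ?Re_mul ?Im_mul Re_conjC Im_conjC sqr_normcE/=; ring.
Qed.

Lemma conj_real (x : R) : (x%:C)^* = x%:C :> C.
Proof. exact: conjc_real. Qed.

End complex_numbers.

(** * Semidefinite Hermitian forms on linear subsets *)

Section hermitian_forms.
Context {R : realType} {V : lmodType R[i]}.
Local Notation C := R[i].
Implicit Types (D S : set V) (H : V -> V -> C).

Definition lin_closed D := D 0 /\ forall a x y, D x -> D y -> D (a *: x + y).

(** The laws are relative to [D] because the ambient module consists of all functions on the circle,
    while [L2inner] is well behaved on the subset [L2]. *)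
Definition hermitian_on D H :=
  (forall a x y z, D x -> D y -> D z -> H (a *: x + y) z = a * H x z + H y z) /\
  (forall x y, D x -> D y -> H y x = (H x y)^*).

Lemma lin_closedD D x y : lin_closed D -> D x -> D y -> D (x + y).
Proof. by case=> _ h Dx Dy; rewrite -[x]scale1r; exact: h. Qed.

Lemma lin_closedZ D a x : lin_closed D -> D x -> D (a *: x).
Proof. by case=> D0 h Dx; rewrite -[_ *: _]addr0; exact: h. Qed.

Lemma lin_closedB D x y : lin_closed D -> D x -> D y -> D (x - y).
Proof.
by move=> DD Dx Dy; apply: lin_closedD => //; rewrite -scaleN1r; apply: lin_closedZ.
Qed.

Lemma lin_closed_sum D (I : Type) (r : seq I) (P : pred I) (F : I -> V) :
  lin_closed D -> (forall i, D (F i)) -> D (\sum_(i <- r | P i) F i).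
Proof.
move=> DD DF; apply: (big_ind D) => //; first by case: DD.
by move=> x y; exact: lin_closedD.
Qed.

Section theory.
Variables (D : set V) (H : V -> V -> C).
Hypotheses (DD : lin_closed D) (HH : hermitian_on D H).

Let H_lin := HH.1.
Let H_sym := HH.2.

Lemma formDl x y z : D x -> D y -> D z -> H (x + y) z = H x z + H y z.
Proof. by move=> *; rewrite -[x in LHS]scale1r H_lin// mul1r. Qed.

Lemma form0l z : D z -> H 0 z = 0.
Proof.
move=> Dz; have D0 : D 0 by case: DD.
have /eqP := @formDl 0 0 z D0 D0 Dz.
by rewrite addr0 -subr_eq0 opprD addrA subrr sub0r oppr_eq0 => /eqP.
Qed.

Lemma formZl a x z : D x -> D z -> H (a *: x) z = a * H x z.
Proof.
move=> Dx Dz; have D0 : D 0 by case: DD.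
by rewrite -[a *: x]addr0 H_lin// form0l// addr0.
Qed.

Lemma formDr x y z : D x -> D y -> D z -> H z (x + y) = H z x + H z y.
Proof.
move=> Dx Dy Dz; have Dxy : D (x + y) by exact: lin_closedD.
by rewrite (H_sym Dxy Dz) formDl// rmorphD/= -!H_sym.
Qed.

Lemma formZr a x z : D x -> D z -> H z (a *: x) = a^* * H z x.
Proof.
move=> Dx Dz; have Dax : D (a *: x) by exact: lin_closedZ.
by rewrite (H_sym Dax Dz) formZl// rmorphM/= -H_sym.
Qed.

Lemma form_suml (I : Type) (r : seq I) (F : I -> V) z :
  (forall i, D (F i)) -> D z ->
  H (\sum_(i <- r) F i) z = \sum_(i <- r) H (F i) z.
Proof.
move=> DF Dz; elim: r => [|i r IH]; first by rewrite !big_nil form0l.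
by rewrite !big_cons formDl ?IH//; exact: lin_closed_sum.
Qed.

Lemma form_sumr (I : Type) (r : seq I) (F : I -> V) z :
  (forall i, D (F i)) -> D z ->
  H z (\sum_(i <- r) F i) = \sum_(i <- r) H z (F i).
Proof.
move=> DF Dz; rewrite (@H_sym (\sum_(i <- r) F i))//; last exact: lin_closed_sum.
by rewrite form_suml// rmorph_sum; apply: eq_bigr => i _ /=; rewrite -H_sym.
Qed.

Definition fsq x := complex.Re (H x x).

Lemma fsqD x y : D x -> D y -> fsq (x + y) = fsq x + fsq y + 2 * complex.Re (H x y).
Proof.
move=> Dx Dy; have Dxy := lin_closedD DD Dx Dy.
rewrite /fsq formDl// !formDr// !Re_add (H_sym Dx Dy) Re_conjC; ring.
Qed.

Lemma fsqZ a x : D x -> fsq (a *: x) = normc a ^+ 2 * fsq x.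
Proof.
move=> Dx; have Dax := lin_closedZ a DD Dx.
rewrite /fsq formZl// formZr// mulrA mulcJ Re_mul /= mul0r subr0//.
Qed.

Lemma form_Cauchy_Schwarz x y : (forall z, D z -> 0 <= fsq z) -> D x -> D y ->
  normc (H x y) <= Num.sqrt (fsq x) * Num.sqrt (fsq y).
Proof.
move=> H0 Dx Dy.
(* This is the form at [x + (r * H x y) *: y]; the factor [H x y] aligns the phases, so that a real
   parameter is enough. *)
have key (r : R) : 0 <= fsq x + r ^+ 2 * normc (H x y) ^+ 2 * fsq y
     + 2 * r * normc (H x y) ^+ 2.
  set a := r%:C * H x y.
  have -> : fsq x + r ^+ 2 * normc (H x y) ^+ 2 * fsq y
     + 2 * r * normc (H x y) ^+ 2 = fsq (x + a *: y).
    rewrite fsqD//; last exact: lin_closedZ.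
    rewrite fsqZ// formZr// /a rmorphM/= conj_real.
    have -> : r%:C * (H x y)^* * H x y = (r * normc (H x y) ^+ 2)%:C.
      rewrite -mulrA [_^* * _]mulrC mulcJ. by rewrite [RHS]rmorphM.
    by rewrite normcM /= exprMn expr0n/= addr0 sqr_sqrtr ?sqr_ge0// mulrA.
  by apply: H0; apply: lin_closedD => //; exact: lin_closedZ.
set n := normc (H x y) in key *.
have n0 : 0 <= n by exact: normc_ge0.
have fx := H0 _ Dx; have fy := H0 _ Dy.
rewrite -sqrtrM// -[leLHS]ger0_norm// -sqrtr_sqr ler_sqrt ?mulr_ge0//.
(* Semidefiniteness allows [fsq y = 0]. The expression is then affine in [r], and the value chosen
   below makes it negative unless [n = 0]. Otherwise [r = - 1 / fsq y] is its minimizer. *)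
have [fy0|fy0] := eqVneq (fsq y) 0.
  rewrite fy0 mulr0; apply/contraT; rewrite -ltNge => n20.
  have := key (- (fsq x + 1) / n ^+ 2).
  rewrite fy0 mulr0 addr0.
  have -> : 2 * (- (fsq x + 1) / n ^+ 2) * n ^+ 2 = - 2 * (fsq x + 1).
    have nn0 : n != 0 by rewrite -sqrf_eq0 gt_eqF.
    by field.
  lra.
have fygt : 0 < fsq y by rewrite lt_def fy0.
have := key (- (fsq y)^-1).
have -> : fsq x + (- (fsq y)^-1) ^+ 2 * n ^+ 2 * fsq y + 2 * - (fsq y)^-1 * n ^+ 2
   = fsq x - n ^+ 2 / fsq y by field.
by rewrite subr_ge0 ler_pdivrMr.
Qed.

(* The scaling of [s] by [k] is what lets finitely many cross terms be absorbed
   by a single copy of [fsq s]. *)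
Lemma almost_orthogonal (S : set V) u (del k : R) : lin_closed S -> S `<=` D ->
  D u -> (forall s, S s -> 0 <= fsq s) ->
  (forall s, S s -> fsq u <= fsq (u + s) + del) -> 0 <= del -> 0 < k ->
  forall (a : C) s, S s ->
  - (k * fsq s) - del * normc a ^+ 2 / k <= 2 * complex.Re (a * H u s).
Proof.
move=> SS SD Du S0 umin del0 k0 a s Ss.
have Ds := SD _ Ss.
have [->|a0] := eqVneq a 0.
  rewrite normc0 expr0n/= mulr0 !mul0r /= mulr0 subr0 oppr_le0 mulr_ge0//.
  - exact: ltW.
  - exact: S0.
have na0 : 0 < normc a.
  rewrite lt_def normc_ge0 andbT; apply: contra a0 => /eqP na0.
  by apply/eqP/eq0_normc.
(* With this multiplier [H u (b *: s)] has the real part of [a * H u s] times [k / |a|^2]; dividing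
   near-minimality at [b *: s] by that factor gives the claim. *)
set b := k%:C / a.
have := umin (b *: s) (lin_closedZ b SS Ss).
rewrite fsqD//; last exact: lin_closedZ.
rewrite fsqZ// -subr_ge0.
have -> : normc b = k / normc a.
  by rewrite /b normcM normcV /= expr0n/= addr0 sqrtr_sqr gtr0_norm.
have -> : complex.Re (H u (b *: s)) = k / normc a ^+ 2 * complex.Re (a * H u s).
  rewrite formZr// /b; have -> : (k%:C / a)^* = (k / normc a ^+ 2)%:C * a.
    rewrite rmorphM fmorphV/= conj_real [RHS]mulrC rmorphM fmorphV/= -mulcJ.
    by field; rewrite conjC_eq0 a0.
  by rewrite -[_ * a * _]mulrA Re_scale.
move: na0; set n := normc a; set X := complex.Re _; set f := fsq s => na0.
have -> : fsq u + (k / n) ^+ 2 * f + 2 * (k / n ^+ 2 * X) + del - fsq u =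
  (k / n ^+ 2) * (k * f + 2 * X + del * n ^+ 2 / k).
  by field; rewrite !gt_eqF.
rewrite pmulr_rge0; last by rewrite divr_gt0// exprn_gt0.
by move=> h; rewrite -subr_ge0; move: h; congr (0 <= _); ring.
Qed.

(* Parrott's one-step extension, up to an error [del]: perturbing the basis
   vectors [e i], [d j] by almost minimizing elements of [S] makes them almost
   orthogonal to [S], and the free matrix cancels their mutual inner products. *)
Lemma one_step_extension (I J : finType) (S : set V) (e : I -> V) (d : J -> V)
    (del : R) : lin_closed S -> S `<=` D ->
  (forall i, D (e i)) -> (forall j, D (d j)) ->
  (forall (a : I -> C) s, S s -> 0 <= fsq (\sum_i a i *: e i + s)) ->
  (forall (b : J -> C) s, S s -> 0 <= fsq (\sum_j b j *: d j + s)) ->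
  0 < del ->
  exists X : I -> J -> C, forall (a : I -> C) (b : J -> C) s, S s ->
   - del * (\sum_i normc (a i) ^+ 2 + \sum_j normc (b j) ^+ 2) <=
   fsq (\sum_i a i *: e i + \sum_j b j *: d j + s)
   + 2 * complex.Re (\sum_i \sum_j a i * (b j)^* * X i j).
Proof.
move=> SS SD De Dd He Hd del0.
have S0 s : S s -> 0 <= fsq s.
  move=> Ss; have := He (fun=> 0) s Ss.
  by rewrite big1 ?add0r// => i _; rewrite scale0r.
(* A point of the coset [u + S] within [eta] of the infimum of the form; the coset is invariant
   under [S], so the point is also nearly minimal among its own translates. *)
have approx (u : V) (eta : R) : (forall s, S s -> 0 <= fsq (u + s)) -> 0 < eta ->
    exists2 s0, S s0 & forall s, S s -> fsq (u + s0) <= fsq (u + s0 + s) + eta.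
  move=> u0 eta0.
  have hi : has_inf [set fsq (u + s) | s in S].
    split; first by exists (fsq (u + 0)); exists 0 => //; case: SS.
    by exists 0 => _ [s Ss <-]; exact: u0.
  have [_ [s0 Ss0 <-] s0lt] := inf_adherent eta0 hi.
  exists s0 => // s Ss.
  have : inf [set fsq (u + s) | s in S] <= fsq (u + s0 + s).
    apply: inf_lbound; first exact: hi.2.
    by exists (s0 + s); [exact: lin_closedD|rewrite addrA].
  by lra.
(* Each of the [#|I| + #|J|] cross terms with [S] consumes the fraction [1 / K] of [fsq s'],
   together at most one copy. The extra 1 keeps [K] positive when both index types are empty. In
   exchange, near-minimality is required up to [del / K]. *)
pose K : R := (#|I| + #|J| + 1)%:R.
have K0 : 0 < K by rewrite ltr0n addn1.
pose k := K^-1; have k0 : 0 < k by rewrite invr_gt0.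
have He1 i s : S s -> 0 <= fsq (e i + s).
  move=> Ss; have := He (fun j => (j == i)%:R) s Ss.
  rewrite (bigD1 i)//= eqxx scale1r big1 ?addr0// => j /negPf ->.
  by rewrite scale0r.
have Hd1 i s : S s -> 0 <= fsq (d i + s).
  move=> Ss; have := Hd (fun j => (j == i)%:R) s Ss.
  rewrite (bigD1 i)//= eqxx scale1r big1 ?addr0// => j /negPf ->.
  by rewrite scale0r.
have dk0 : 0 < del * k by rewrite mulr_gt0.
have /choice[se hse] (i : I) : exists s0, S s0 /\
    forall s, S s -> fsq (e i + s0) <= fsq (e i + s0 + s) + del * k.
  by have [s0 ? ?] := approx (e i) _ (He1 i) dk0; exists s0.
have /choice[sd hsd] (j : J) : exists s0, S s0 /\
    forall s, S s -> fsq (d j + s0) <= fsq (d j + s0 + s) + del * k.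
  by have [s0 ? ?] := approx (d j) _ (Hd1 j) dk0; exists s0.
pose e' i := e i + se i; pose d' j := d j + sd j.
have De' i : D (e' i) by apply: lin_closedD => //; exact: SD _ (hse i).1.
have Dd' i : D (d' i) by apply: lin_closedD => //; exact: SD _ (hsd i).1.
exists (fun i j => - H (e' i) (d' j)) => a b s Ss.
pose E := \sum_i a i *: e' i; pose F := \sum_j b j *: d' j.
have SE : S (\sum_i a i *: se i).
  by apply: lin_closed_sum => // i; apply: lin_closedZ => //; exact: (hse i).1.
have SF : S (\sum_i b i *: sd i).
  by apply: lin_closed_sum => // i; apply: lin_closedZ => //; exact: (hsd i).1.
(* Replacing [e], [d] by [e'], [d'] is compensated inside [S], so the same vector is decomposed as
   [E + F + s']. *)
pose s' := s - \sum_i a i *: se i - \sum_j b j *: sd j.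
have Ss' : S s' by apply: lin_closedB => //; exact: lin_closedB.
have EE : E = \sum_i a i *: e i + \sum_i a i *: se i.
  by rewrite -big_split; apply: eq_bigr => i _ /=; rewrite -scalerDr.
have FE : F = \sum_i b i *: d i + \sum_i b i *: sd i.
  by rewrite -big_split; apply: eq_bigr => i _ /=; rewrite -scalerDr.
have -> : \sum_i a i *: e i + \sum_j b j *: d j + s = E + F + s'.
  rewrite EE FE /s'.
  move: (\sum_i a i *: e i) (\sum_i a i *: se i) (\sum_i b i *: d i)
    (\sum_i b i *: sd i) => p q r t.
  by rewrite [p + q + _]addrACA -[s - q - t]addrA -opprD -[RHS]addrA [q + t + _]addrCA subrr addr0.
have DE : D E by apply: lin_closed_sum => // i; exact: lin_closedZ.
have DF : D F by apply: lin_closed_sum => // i; exact: lin_closedZ.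
have Ds' := SD _ Ss'.
have DEF := lin_closedD DD DE DF.
have E0 : 0 <= fsq E by rewrite EE He.
have F0 : 0 <= fsq F by rewrite FE Hd.
rewrite (fsqD DEF Ds') (fsqD DE DF) formDl//.
have -> : \sum_i \sum_j a i * (b j)^* * - H (e' i) (d' j) = - H E F.
  rewrite /E form_suml//; last by move=> i; exact: lin_closedZ.
  rewrite -sumrN; apply: eq_bigr => i _.
  rewrite formZl// /F form_sumr//; last by move=> j; exact: lin_closedZ.
  rewrite mulr_sumr -sumrN; apply: eq_bigr => j _.
  by rewrite formZr// mulrN mulrA.
have HEs : - (k * #|I|%:R * fsq s') - del * \sum_i normc (a i) ^+ 2 <=
    2 * complex.Re (H E s').
  rewrite /E form_suml//; last by move=> i; exact: lin_closedZ.
  rewrite Re_sum [leRHS]mulr_sumr.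
  have -> : - (k * #|I|%:R * fsq s') - del * \sum_i normc (a i) ^+ 2 =
     \sum_i (- (k * fsq s') - del * k * normc (a i) ^+ 2 / k).
    rewrite sumrB sumr_const -mulr_natr; congr (_ - _); first by ring.
    rewrite mulr_sumr; apply: eq_bigr => i _; field; exact: lt0r_neq0.
  apply: ler_sum => i _; rewrite formZl//.
  by apply: (almost_orthogonal SS SD) => //;
    [move=> t /(proj2 (hse i)) | exact: ltW].
have HFs : - (k * #|J|%:R * fsq s') - del * \sum_i normc (b i) ^+ 2 <=
    2 * complex.Re (H F s').
  rewrite /F form_suml//; last by move=> i; exact: lin_closedZ.
  rewrite Re_sum [leRHS]mulr_sumr.
  have -> : - (k * #|J|%:R * fsq s') - del * \sum_i normc (b i) ^+ 2 =
     \sum_i (- (k * fsq s') - del * k * normc (b i) ^+ 2 / k).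
    rewrite sumrB sumr_const -mulr_natr; congr (_ - _); first by ring.
    rewrite mulr_sumr; apply: eq_bigr => i _; field; exact: lt0r_neq0.
  apply: ler_sum => i _; rewrite formZl//.
  by apply: (almost_orthogonal SS SD) => //;
    [move=> t /(proj2 (hsd i)) | exact: ltW].
have kK : k * #|I|%:R * fsq s' + k * #|J|%:R * fsq s' <= fsq s'.
  rewrite -mulrDl -mulrDr -natrD -[leRHS]mul1r ler_wpM2r ?S0//.
  by rewrite mulrC ler_pdivrMr// mul1r ler_nat leq_addr.
rewrite Re_add Re_opp; lra.
Qed.

End theory.
End hermitian_forms.

(** * Integration on the circle *)

Section circle_integral.
Context {R : realType}.
Local Notation C := R[i].
Local Notation T := (circle R).
Local Notation mu := (@arc_length R).
Local Notation leb := (@lebesgue_measure R).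
Implicit Types f g : T -> R.

Definition rint f := mu.-integrable [set: T] (EFin \o f).

(* [measurable_expi] uses another display for the same sigma-algebra on [R]. *)
Lemma measurable_expiR :
  @measurable_fun _ _ (measurableTypeR R) T [set: R] (@expi R).
Proof. exact: measurable_expi. Qed.

Lemma ge0_integral_arc (f : T -> \bar R) : measurable_fun [set: T] f ->
  (forall z, 0 <= f z)%E ->
  (\int[mu]_z f z = \int[leb]_(t in `[0%R, 1%R]) f (expi t))%E.
Proof.
move=> mf f0.
have h := ge0_integral_pushforward measurable_expiR (uniform_prob (@ltr01 R))
  measurableT mf (fun z _ => f0 z).
transitivity (\int[uniform_prob (@ltr01 R)]_x (f \o expi) x)%E.
  rewrite -[RHS]h; apply: eq_measure_integral; first exact: measurable_expiR.
  by move=> ? A mA _.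
by rewrite integral_uniform//= subr0 invr1 mul1e.
Qed.

Lemma integral_arc (f : T -> \bar R) : measurable_fun [set: T] f ->
  (\int[mu]_z f z = \int[leb]_(t in `[0%R, 1%R]) f (expi t))%E.
Proof.
move=> mf; rewrite integralE.
have Ep : (fun t => f (expi t))^\+%E = (fun t => f^\+%E (expi t)) := funepos_comp f expi.
have En : (fun t => f (expi t))^\-%E = (fun t => f^\-%E (expi t)) := funeneg_comp f expi.
rewrite [RHS]integralE Ep En (ge0_integral_arc (measurable_funepos mf))//.
by rewrite (ge0_integral_arc (measurable_funeneg mf)).
Qed.

Lemma arc_length_setT : mu [set: T] = 1%E.
Proof.
rewrite /arc_length /pushforward preimage_setT.
exact: (probability_setT (uniform_prob (@ltr01 R))).
Qed.

Lemma rint_arc f : rint f -> leb.-integrable `[0%R, 1%R] (EFin \o (f \o expi)).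
Proof.
move=> /integrableP[mf foo]; apply/integrableP; split.
  by apply: measurable_funTS; apply: (measurableT_comp mf); exact: measurable_expiR.
move: foo; rewrite ge0_integral_arc//.
exact: measurableT_comp.
Qed.

Lemma Rintegral_arc f : measurable_fun [set: T] f ->
  \int[mu]_z f z = \int[leb]_(t in `[0, 1]) f (expi t).
Proof. by move=> mf; rewrite /Rintegral integral_arc//; exact/measurable_EFinP. Qed.

Lemma arc_ae (P : T -> Prop) : measurable [set z | P z] ->
  {ae leb, forall t, t \in `[0%R, 1%R] -> P (expi t)} -> {ae mu, forall z, P z}.
Proof.
move=> mP [N [mN N0 PN]]; exists (~` [set z | P z]); split => //.
  exact: measurableC.
have mE : measurable (@expi R @^-1` (~` [set z | P z])).
  by rewrite -[_ @^-1` _]setTI; apply: measurable_expiR => //; exact: measurableC.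
rewrite /arc_length /pushforward /= /uniform_prob integral_uniform_pdf.
apply: null_set_integral => //.
- exact: measurableI.
- apply/measurable_EFinP/measurable_funTS; exact: measurable_uniform_pdf.
- apply: (@subset_measure0 _ _ _ leb _ N) => //; first exact: measurableI.
  by move=> t [Pt t01]; apply: PN => /= /(_ t01).
Qed.

Lemma measurable_rint f : rint f -> measurable_fun [set: T] f.
Proof. by case/integrableP => /measurable_EFinP. Qed.

Lemma bounded_rint f M : measurable_fun [set: T] f -> (forall z, `|f z| <= M) -> rint f.
Proof.
move=> mf fM; apply: measurable_bounded_integrable => //.
  by apply: le_lt_trans (ltry 1%R); rewrite -arc_length_setT.
by exists M; split; [exact: num_real|] => y My z _ /=; rewrite (le_trans (fM z))// ltW.
Qed.

Lemma rint_le f g : measurable_fun [set: T] f -> rint g ->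
  (forall z, `|f z| <= g z) -> rint f.
Proof.
move=> mf ig fg; apply: le_integrable ig => //; first exact/measurable_EFinP.
by move=> z _ /=; rewrite lee_fin (le_trans (fg z))// ler_norm.
Qed.

Lemma rintD f g : rint f -> rint g -> rint (fun z => f z + g z).
Proof. by move=> fi gi; exact: (integrableD measurableT fi gi). Qed.

Lemma rintN f : rint f -> rint (fun z => - f z).
Proof. by move=> fi; exact: (integrableN fi). Qed.

Lemma rintB f g : rint f -> rint g -> rint (fun z => f z - g z).
Proof. by move=> fi gi; apply: rintD => //; exact: rintN. Qed.

Lemma rintZ r f : rint f -> rint (fun z => r * f z).
Proof. by move=> fi; exact: (integrableZl measurableT r fi). Qed.

Lemma rint_cst r : rint (fun=> r).
Proof. by apply: (@bounded_rint _ `|r|) => // z. Qed.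

Lemma Rintegral_arc_cst r : \int[mu]_z r = r.
Proof. by rewrite Rintegral_cst//= arc_length_setT /= mulr1. Qed.

Lemma rint_sum (I : Type) (s : seq I) (F : I -> T -> R) :
  (forall i, rint (F i)) -> rint (fun z => \sum_(i <- s) F i z).
Proof.
move=> Fi; elim: s => [|i s IH].
  by under [X in rint X]eq_fun do rewrite big_nil; exact: rint_cst.
by under [X in rint X]eq_fun do rewrite big_cons; exact: rintD.
Qed.

Lemma Rintegral_sum (I : Type) (s : seq I) (F : I -> T -> R) :
  (forall i, rint (F i)) ->
  \int[mu]_z (\sum_(i <- s) F i z) = \sum_(i <- s) \int[mu]_z F i z.
Proof.
move=> Fi; elim: s => [|i s IH].
  under eq_Rintegral do rewrite big_nil.
  by rewrite big_nil Rintegral_cst// mul0r.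
under eq_Rintegral do rewrite big_cons.
by rewrite big_cons RintegralD ?IH//; [exact: Fi|exact: rint_sum].
Qed.

Lemma Rintegral_ae_ge0 f : rint f -> {ae mu, forall z, 0 <= f z} ->
  0 <= \int[mu]_z f z.
Proof.
move=> fi f0.
have mf := measurable_rint fi.
rewrite (_ : \int[mu]_z f z = \int[mu]_z `|f z|); first by apply: Rintegral_ge0.
rewrite /Rintegral; congr fine; apply: ae_eq_integral => //.
- exact/measurable_EFinP.
- by apply/measurable_EFinP; exact: measurableT_comp.
- by apply: filterS f0 => z f0 _; rewrite ger0_norm.
Qed.

Lemma eq_Rintegral_ae f g : measurable_fun [set: T] f -> measurable_fun [set: T] g ->
  {ae mu, forall z, f z = g z} -> \int[mu]_z f z = \int[mu]_z g z.
Proof.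
move=> mf mg fg; rewrite /Rintegral; congr fine; apply: ae_eq_integral => //.
- exact/measurable_EFinP.
- exact/measurable_EFinP.
- by apply: filterS fg => z -> _.
Qed.

Lemma Rintegral_eq0_ae f : rint f -> (forall z, 0 <= f z) -> \int[mu]_z f z = 0 ->
  {ae mu, forall z, f z = 0}.
Proof.
move=> fi f0 f00; have mf := measurable_rint fi.
have : (\int[mu]_z `|(f z)%:E| = 0)%E.
  under eq_integral do rewrite gee0_abs ?lee_fin//.
  by rewrite -[LHS]fineK ?integrable_fin_num// -/(Rintegral _ _ _) f00.
move/ae_eq_integral_abs => /(_ measurableT) h.
have : ae_eq mu setT (EFin \o f) (cst 0%E) by apply: h => //; exact/measurable_EFinP.
by apply: filterS => z /(_ Logic.I) [].
Qed.

Lemma eq_rint_ae f g : measurable_fun [set: T] g ->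
  {ae mu, forall z, f z = g z} -> rint f -> rint g.
Proof.
move=> mg fg fi; have mf := measurable_rint fi.
apply/integrableP; split; first exact/measurable_EFinP.
case/integrableP : fi => _; rewrite (ae_eq_integral (EFin \o (fun z => `|g z|)))//.
- by apply/measurable_EFinP; exact: measurableT_comp.
- by apply/measurable_EFinP; exact: measurableT_comp.
- by apply: filterS fg => z /= -> _.
Qed.

End circle_integral.

(** * Measurable complex functions and the integrals of the characters *)

Section circle_characters.
Context {R : realType}.
Local Notation C := R[i].
Local Notation T := (circle R).
Local Notation mu := (@arc_length R).
Local Notation leb := (@lebesgue_measure R).

Definition cmeas (f : T -> C) := measurable_fun [set: T] (fun z => complex.Re (f z)) /\
  measurable_fun [set: T] (fun z => complex.Im (f z)).

Lemma cmeas_cst (a : C) : cmeas (fun=> a).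
Proof. by split; exact: measurable_cst. Qed.

Lemma cmeasD f g : cmeas f -> cmeas g -> cmeas (fun z => f z + g z).
Proof.
move=> [rf jf] [rg jg]; split.
  by under eq_fun do rewrite Re_add; exact: measurable_funD.
by under eq_fun do rewrite Im_add; exact: measurable_funD.
Qed.

Lemma cmeasM f g : cmeas f -> cmeas g -> cmeas (fun z => f z * g z).
Proof.
move=> [rf jf] [rg jg]; split.
  under eq_fun do rewrite Re_mul.
  by apply: measurable_funB; exact: measurable_funM.
under eq_fun do rewrite Im_mul.
by apply: measurable_funD; exact: measurable_funM.
Qed.

Lemma cmeasJ f : cmeas f -> cmeas (fun z => (f z)^*).
Proof.
move=> [rf jf]; split.
  by under eq_fun do rewrite Re_conjC.
by under eq_fun do rewrite Im_conjC; exact: measurableT_comp.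
Qed.

Lemma cmeasN f : cmeas f -> cmeas (fun z => - f z).
Proof.
move=> mf; under [X in cmeas X]eq_fun do rewrite -mulN1r.
by apply: cmeasM => //; exact: cmeas_cst.
Qed.

Lemma cmeasB f g : cmeas f -> cmeas g -> cmeas (fun z => f z - g z).
Proof. by move=> mf mg; apply: cmeasD => //; exact: cmeasN. Qed.

Lemma cmeas_sum (I : Type) (s : seq I) (P : pred I) (F : I -> T -> C) :
  (forall i, cmeas (F i)) -> cmeas (fun z => \sum_(i <- s | P i) F i z).
Proof.
move=> mF; elim: s => [|i s IH].
  by under [X in cmeas X]eq_fun do rewrite big_nil; exact: cmeas_cst.
under [X in cmeas X]eq_fun do rewrite big_cons.
by case: (P i) => //; exact: cmeasD.
Qed.

Lemma cmeasX f n : cmeas f -> cmeas (fun z => f z ^+ n).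
Proof.
move=> mf; elim: n => [|n IH].
  by under [X in cmeas X]eq_fun do rewrite expr0; exact: cmeas_cst.
by under [X in cmeas X]eq_fun do rewrite exprS; exact: cmeasM.
Qed.

(** The sigma-algebra of the circle is the final one for [expi], so measurability is tested after
    composition. *)
Lemma arc_measurable_fun (f : T -> R) :
  @measurable_fun _ _ (measurableTypeR R) R [set: R] (f \o (@expi R)) ->
  measurable_fun [set: T] f.
Proof.
move=> mf _ A mA; rewrite setTI; have := mf measurableT A mA.
by rewrite setTI.
Qed.

Lemma cmeas_val : cmeas (fun z : T => val z).
Proof.
split; apply: arc_measurable_fun; apply: continuous_measurable_fun => t.
  apply: (@continuous_comp _ _ _ (fun t => 2 * pi * t) (@cos R)).
    exact: mulrl_continuous.
  exact: continuous_cos.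
apply: (@continuous_comp _ _ _ (fun t => 2 * pi * t) (@sin R)).
  exact: mulrl_continuous.
exact: continuous_sin.
Qed.

Lemma normc_val (z : T) : normc (val z) = 1.
Proof. by case: z => z /= /eqP. Qed.

Lemma valJ (z : T) : (val z)^* = (val z)^-1.
Proof.
have z0 : val z != 0.
  by apply/eqP => z0; have := normc_val z; rewrite z0 normc0 => /eqP; rewrite eq_sym oner_eq0.
apply: (mulfI z0); rewrite mulfV//.
by have := mulcJ (val z); rewrite normc_val expr1n.
Qed.

Lemma val_neq0 (z : T) : val z != 0.
Proof.
by apply/eqP => z0; have := normc_val z; rewrite z0 normc0 => /eqP; rewrite eq_sym oner_eq0.
Qed.

Lemma val_expzJ (z : T) (j : int) : (val z ^ j)^* = val z ^ (- j).
Proof. by rewrite rmorphXz/= ?unitfE ?val_neq0// valJ exprz_inv. Qed.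

Lemma cmeas_expz (j : int) : cmeas (fun z : T => val z ^ j).
Proof.
case: j => n; first by apply: cmeasX; exact: cmeas_val.
rewrite [X in cmeas X](_ : _ = fun z : T => ((val z)^*) ^+ n.+1).
  by apply: cmeasX; apply: cmeasJ; exact: cmeas_val.
by apply/funext => z; rewrite NegzE -exprnN -exprVn valJ.
Qed.

Lemma normc_expz (z : T) (j : int) : normc (val z ^ j) = 1.
Proof.
have H n : normc (val z ^+ n) = 1.
  elim: n => [|n IH]; first by rewrite expr0 normc1.
  by rewrite exprS normcM normc_val IH mulr1.
case: j => n; first exact: H.
by rewrite NegzE -exprnN normcV H invr1.
Qed.

Lemma val_expiE (t : R) : val (expi t) = Complex (cos (2 * pi * t)) (sin (2 * pi * t)).
Proof. by []. Qed.

Lemma val_expiX (t : R) n : val (expi t) ^+ n = val (expi (n%:R * t)).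
Proof.
elim: n => [|n IH].
  by rewrite expr0 mul0r /= mulr0 cos0 sin0.
rewrite exprS IH !val_expiE -[n.+1%:R]natr1.
have -> : 2 * pi * ((n%:R + 1) * t) = 2 * pi * t + 2 * pi * (n%:R * t) by ring.
rewrite cosD sinD; apply: complex_eqP; rewrite ?Re_mul ?Im_mul/=; ring.
Qed.

Let a_ (n : nat) : R := 2 * pi * n%:R.

Let a_neq0 n : (0 < n)%N -> a_ n != 0.
Proof.
by move=> n0; rewrite /a_ !mulf_neq0 ?pnatr_eq0 -?lt0n// gt_eqF// pi_gt0.
Qed.

Let cos_a n : cos (a_ n) = 1.
Proof.
rewrite /a_; have -> : 2 * pi * n%:R = 0 + (pi *+ 2) *+ n :> R.
  by rewrite add0r -[RHS]mulr_natr -[pi *+ 2]mulr_natl.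
by rewrite (periodicn (@cosD2pi R)) cos0.
Qed.

Let sin_a n : sin (a_ n) = 0.
Proof.
rewrite /a_; have -> : 2 * pi * n%:R = 0 + (pi *+ 2) *+ n :> R.
  by rewrite add0r -[RHS]mulr_natr -[pi *+ 2]mulr_natl.
by rewrite (periodicn (@sinD2pi R)) sin0.
Qed.

Let FTC (f F : R -> R) : (forall x, is_derive x (1 : R) F (f x)) -> continuous f ->
  \int[leb]_(t in `[0, 1]) f t = F 1 - F 0.
Proof.
move=> dF cf; have cF : continuous F.
  move=> x; apply/differentiable_continuous/derivable1_diffP.
  exact: (@ex_derive _ _ _ _ _ _ _ (dF x)).
rewrite /Rintegral (@continuous_FTC2 _ f F 0 1)//=.
- by apply: continuous_subspaceT.
- split => [x _||].
  + exact: (@ex_derive _ _ _ _ _ _ _ (dF x)).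
  + by apply: cvg_at_right_filter; exact: cF.
  + by apply: cvg_at_left_filter; exact: cF.
- by move=> x _; rewrite derive1E; exact: (@derive_val _ _ _ _ _ _ _ (dF x)).
Qed.

Lemma cintegral_expn n : (0 < n)%N -> cintegral (fun z : T => val z ^+ n) = 0.
Proof.
move=> n0; have [mR mI] := cmeasX n cmeas_val.
have an := a_neq0 n0.
have E t : val (@expi R t) ^+ n = Complex (cos (a_ n * t)) (sin (a_ n * t)).
  by rewrite val_expiX val_expiE /a_ [2 * pi * (_ * _)]mulrA.
have cl : continuous (fun t : R => a_ n * t) by exact: mulrl_continuous.
rewrite /cintegral !Rintegral_arc//.
have -> : \int[leb]_(t in `[0, 1]) complex.Re (val (@expi R t) ^+ n) = 0.
  under eq_Rintegral do rewrite E /=.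
  transitivity ((a_ n)^-1 * sin (a_ n * 1) - (a_ n)^-1 * sin (a_ n * 0)).
    apply: (@FTC _ (fun t => (a_ n)^-1 * sin (a_ n * t))) => [x|x].
      apply: is_derive_eq.
      by rewrite /GRing.scale/= mulr1; field.
    apply: (@continuous_comp _ _ _ (fun t => a_ n * t) (@cos R)); first exact: cl.
    exact: continuous_cos.
  by rewrite mulr1 mulr0 sin_a sin0 subrr.
have -> : \int[leb]_(t in `[0, 1]) complex.Im (val (@expi R t) ^+ n) = 0.
  under eq_Rintegral do rewrite E /=.
  transitivity (- (a_ n)^-1 * cos (a_ n * 1) - - (a_ n)^-1 * cos (a_ n * 0)).
    apply: (@FTC _ (fun t => - (a_ n)^-1 * cos (a_ n * t))) => [x|x].
      apply: is_derive_eq.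
      by rewrite /GRing.scale/= mulr1; field.
    apply: (@continuous_comp _ _ _ (fun t => a_ n * t) (@sin R)); first exact: cl.
    exact: continuous_sin.
  by rewrite mulr1 mulr0 cos_a cos0 subrr.
by [].
Qed.

Lemma cintegral_expz (j : int) : cintegral (fun z : T => val z ^ j) = (j == 0)%:R.
Proof.
case: j => [[|n]|n].
- rewrite /cintegral eqxx; under eq_Rintegral do rewrite expr0z/=.
  under [X in Complex _ X]eq_Rintegral do rewrite expr0z/=.
  by rewrite !Rintegral_cst// /= mul1r mul0r arc_length_setT.
- by rewrite -[X in cintegral X]/(fun z : T => val z ^+ n.+1) cintegral_expn.
- have E (z : T) : val z ^ (Negz n) = (val z ^+ n.+1)^*.
    by rewrite NegzE -exprnN -exprVn -valJ rmorphXn.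
  have := @cintegral_expn n.+1 erefl; rewrite /cintegral => -[hR hI].
  have [mR mI] := cmeasX n.+1 cmeas_val.
  have iI : rint (fun z : T => complex.Im (val z ^+ n.+1)).
    apply: (@bounded_rint _ _ 1) => // z.
    by rewrite (le_trans (normr_Im_le _))// (normc_expz z n.+1).
  under eq_Rintegral do rewrite E Re_conjC.
  under [X in Complex _ X]eq_Rintegral do rewrite E Im_conjC -mulN1r.
  by rewrite hR RintegralZl// hI mulr0.
Qed.

End circle_characters.

(** * Nonnegativity tested on intervals, and approximate indicators of arcs *)

Section interval_test.
Context {R : realType}.
Local Notation leb := (@lebesgue_measure R).
Implicit Types (k : R -> R).

(** Lebesgue differentiation: the hypothesis makes the primitive of [k] nondecreasing on the unit
    interval, and almost everywhere [k] is its derivative. *)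
Lemma ae_ge0_of_itv k : leb.-integrable `[0%R, 1%R] (EFin \o k) ->
  (forall a b, 0 <= a -> a < b -> b <= 1 -> 0 <= \int[leb]_(t in `]a, b[) k t) ->
  {ae leb, forall t, t \in `]0%R, 1%R[ -> 0 <= k t}.
Proof.
move=> ik k0; pose f := k \_ `[0, 1].
have intf : leb.-integrable setT (EFin \o f).
  by move: (ik); rewrite integrable_mkcond//= (restrict_EFin k).
pose F x := \int[leb]_(t in [set` Interval (BLeft 0) (BRight x)]) f t.
have iitv (i : interval R) : leb.-integrable [set` i] (EFin \o f).
  exact: integrableS intf.
have := @FTC1 R f (BLeft 0) (fun y => iitv _)
  (open_integrable_locally openT intf).
apply: filterS; first exact: (ae_filter_ringOfSetsType leb).
move=> x Fx; rewrite in_itv/= => /andP[x0 x1].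
have fxE : f x = k x by rewrite /f patchE mem_set//= in_itv/= !ltW.
have [dF <-] : derivable F x (1 : R) /\ (F : R -> R)^`()%classic x = k x.
  by rewrite -fxE; apply: Fx; rewrite lte_fin.
have Fmono u v : 0 <= u -> u < v -> v <= 1 -> F u <= F v.
  move=> u0 uv v1; rewrite -subr_ge0 /F Rintegral_itvB//; last first.
  - by rewrite bnd_simp ltW.
  rewrite -Rintegral_itv_bndo_bndc//.
  have -> : \int[leb]_(t in `]u, v[) f t = \int[leb]_(t in `]u, v[) k t; last exact: k0.
  apply: eq_Rintegral => y; rewrite inE/= in_itv/= => /andP[uy yv].
  by rewrite /f patchE mem_set//= in_itv/= (le_trans u0 (ltW uy)) (le_trans (ltW yv) v1).
rewrite derive1E; apply: limr_ge.
  exact: dF.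
near=> h.
have hh : `|h| < x by near: h; apply: dnbhs0_lt.
have hh1 : `|h| < 1 - x by near: h; apply: dnbhs0_lt; rewrite subr_gt0.
have h0 : h != 0 by near: h; exact: nbhs_dnbhs_neq.
rewrite /GRing.scale/= mulr1.
move: hh hh1; rewrite !ltr_norml => /andP[xh _] /andP[_ hx1].
have [hp|hn|/eqP] := ltrgtP 0 h; last by rewrite eq_sym (negPf h0).
  apply: mulr_ge0; first by rewrite invr_ge0 ltW.
  by rewrite subr_ge0; apply: Fmono; lra.
rewrite -mulrNN -invrN opprB; apply: mulr_ge0; first by rewrite invr_ge0 oppr_ge0 ltW.
by rewrite subr_ge0; apply: Fmono; lra.
Unshelve. all: by end_near. Qed.

Lemma Bernoulli_ineq (x : R) n : -1 <= x -> 1 + n%:R * x <= (1 + x) ^+ n.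
Proof.
move=> x1; elim: n => [|n IH]; first by rewrite mul0r addr0 expr0.
rewrite exprS -natr1.
have h : 0 <= 1 + x by lra.
have := ler_wpM2l h IH; apply: le_trans.
have : 0 <= n%:R * x ^+ 2 by rewrite mulr_ge0// sqr_ge0.
rewrite expr2; nra.
Qed.

(* Brosowski and Deutsch: these polynomials approximate the indicator of
   [y < 1/2] on the unit interval. *)
Definition threshold (n : nat) (y : R) := (1 - y ^+ n) ^+ (2 ^ n).

Lemma threshold01 n y : 0 <= y <= 1 -> 0 <= threshold n y <= 1.
Proof.
case/andP => y0 y1; have yn0 : 0 <= y ^+ n by exact: exprn_ge0.
have yn1 : y ^+ n <= 1 by exact: exprn_ile1.
by rewrite /threshold exprn_ge0 ?exprn_ile1//; lra.
Qed.

(** Bernoulli's inequality bounds [threshold n y] below by [1 - (2 * y) ^+ n]. *)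
Lemma threshold_cvg1 y : 0 <= y < 1/2 -> threshold^~ y @ \oo --> (1 : R).
Proof.
move=> /andP[y0 y2].
apply: (@squeeze_cvgr _ _ _ _ (fun n => 1 - (2 * y) ^+ n) (cst 1)).
- apply: nearW => n; apply/andP; split; last first.
    by have /andP[] : 0 <= threshold n y <= 1 by apply: threshold01; lra.
  have yn1 : y ^+ n <= 1 by apply: exprn_ile1; lra.
  have := @Bernoulli_ineq (- y ^+ n) (2 ^ n)%N; rewrite lerN2 => /(_ yn1).
  by rewrite /threshold exprMn natrX mulrN.
- rewrite -[X in _ --> X]subr0; apply: cvgB; first exact: cvg_cst.
  by apply: cvg_expr; rewrite ger0_norm; lra.
- exact: cvg_cst.
Qed.

(** The product of [threshold n y] with [(1 + y ^+ n) ^+ (2 ^ n)] is at most 1, and by Bernoulli the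
    second factor is at least [(2 * y) ^+ n], which tends to infinity. *)
Lemma threshold_cvg0 y : 1/2 < y <= 1 -> threshold^~ y @ \oo --> (0 : R).
Proof.
move=> /andP[y2 y1].
apply: (@squeeze_cvgr _ _ _ _ (cst 0) (fun n => ((2 * y)^-1) ^+ n)).
- apply: nearW => n.
  have /andP[q0 q1] : 0 <= threshold n y <= 1 by apply: threshold01; lra.
  rewrite q0/= exprVn.
  have y0 : 0 < y by lra.
  rewrite -[leRHS]mul1r ler_pdivlMr; last by rewrite exprn_gt0; lra.
  have yn0 : 0 <= y ^+ n by rewrite exprn_ge0; lra.
  have yn1 : y ^+ n <= 1 by apply: exprn_ile1; lra.
  have h1 : (2 * y) ^+ n <= (1 + y ^+ n) ^+ (2 ^ n).
    apply: (le_trans _ (@Bernoulli_ineq (y ^+ n) (2 ^ n)%N _)); last by lra.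
    by rewrite exprMn natrX lerDr.
  apply: (le_trans (ler_wpM2l q0 h1)).
  rewrite /threshold -exprMn exprn_ile1//; nra.
- exact: cvg_cst.
- apply: cvg_expr; rewrite ger0_norm; last by rewrite invr_ge0; lra.
  by rewrite invf_lt1; lra.
Qed.

Lemma ae_neq (a : R) : {ae leb, forall t, t != a}.
Proof.
exists [set a]; split; [exact: measurable_set1|exact: lebesgue_measure_set1|].
by move=> t /= /negP; rewrite negbK => /eqP.
Qed.

(** Inside an arc the cosine centred at its midpoint exceeds its value at the endpoints; with the
    companion statement for the outside, a trigonometric polynomial of degree one separates the arc
    from its complement. *)
Lemma cos_lt_arc (a b t : R) : 0 <= a -> a < b -> b <= 1 -> a < t < b ->
  cos (2 * pi * ((b - a) / 2)) < cos (2 * pi * (t - (a + b) / 2)).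
Proof.
move=> a0 ab b1 /andP[at_ tb].
have pi0 : 0 < pi :> R := pi_gt0 R.
set u := t - _; have uw : `|u| < (b - a) / 2 by rewrite ltr_norml /u; lra.
have -> : cos (2 * pi * u) = cos (2 * pi * `|u|).
  by rewrite -cos_norm normrM [`|2 * pi|]ger0_norm//; lra.
have u0 : 0 <= `|u| := normr_ge0 u.
by rewrite ltr_cos; [nra|rewrite in_itv/=; nra|rewrite in_itv/=; nra].
Qed.

Lemma cos_gt_arc (a b t : R) : 0 <= a -> a < b -> b <= 1 -> 0 < t < 1 ->
  (t < a) || (b < t) ->
  cos (2 * pi * (t - (a + b) / 2)) < cos (2 * pi * ((b - a) / 2)).
Proof.
move=> a0 ab b1 /andP[t0 t1] tab.
have pi0 : 0 < pi :> R := pi_gt0 R.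
set u := t - _; have uw : (b - a) / 2 < `|u|.
  by rewrite lter_normr /u; case/orP : tab => tab; apply/orP; [right|left]; lra.
have uw1 : `|u| < 1 - (b - a) / 2 by rewrite ltr_norml /u; lra.
have -> : cos (2 * pi * u) = cos (2 * pi * `|u|).
  by rewrite -cos_norm normrM [`|2 * pi|]ger0_norm//; lra.
have u0 : 0 <= `|u| := normr_ge0 u.
(* Beyond half a turn the cosine grows again; replacing [|u|] by [1 - |u|] returns to the range
   where it decreases. *)
have [u12|u12] := leP `|u| (1/2).
  by rewrite ltr_cos; [nra|rewrite in_itv/=; nra|rewrite in_itv/=; nra].
have -> : cos (2 * pi * `|u|) = cos (2 * pi * (1 - `|u|)).
  rewrite -[LHS]cosN -(@cosD2pi R); congr cos.
  by rewrite -mulr_natl; ring.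
by rewrite ltr_cos; [nra|rewrite in_itv/=; nra|rewrite in_itv/=; nra].
Qed.

End interval_test.

(** * Nonnegativity tested against squared moduli of polynomials *)

Section polynomial_test.
Context {R : realType}.
Local Notation C := R[i].
Local Notation T := (circle R).
Local Notation mu := (@arc_length R).
Local Notation leb := (@lebesgue_measure R).

Lemma cmeas_poly (p : {poly C}) : cmeas (fun z : T => p.[val z]).
Proof.
under [X in cmeas X]eq_fun do rewrite horner_coef.
apply: cmeas_sum => i; apply: cmeasM; first exact: cmeas_cst.
by apply: cmeasX; exact: cmeas_val.
Qed.

Lemma measurable_sqr_normc (f : T -> C) : cmeas f ->
  measurable_fun [set: T] (fun z => normc (f z) ^+ 2).
Proof.
move=> [mR mI]; under eq_fun do rewrite sqr_normcE.
by apply: measurable_funD; exact: measurable_funX.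
Qed.

(** The function [y] is a real trigonometric polynomial of degree one, so [z * y] is a polynomial in
    z. Hence [z ^+ n - (z * y) ^+ n] is one too, and its modulus on the circle is [1 - y ^+ n];
    raising it to the power [2 ^ n] realizes [threshold] as the modulus of an analytic
    polynomial. *)
Lemma arc_indicator (a b : R) : 0 <= a -> a < b -> b <= 1 ->
  exists y : R -> R, [/\ (forall t, 0 <= y t <= 1),
   (forall t, 0 < t < 1 -> a < t < b -> y t < 1/2),
   (forall t, 0 < t < 1 -> (t < a) || (b < t) -> 1/2 < y t) &
   forall n, exists p : {poly C}, forall t,
     normc p.[val (@expi R t)] ^+ 2 = threshold n (y t) ^+ 2].
Proof.
move=> a0 ab b1.
pose s := (a + b) / 2; pose cc := cos (2 * pi * ((b - a) / 2)).
pose y t := 1/2 - (cos (2 * pi * (t - s)) - cc) / 4.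
have y01 t : 0 <= y t <= 1.
  have := cos_le1 (2 * pi * (t - s)); have := cos_geN1 (2 * pi * (t - s)).
  have := cos_le1 (2 * pi * ((b - a) / 2)); have := cos_geN1 (2 * pi * ((b - a) / 2)).
  rewrite /y -/cc; lra.
exists y; split => //.
- move=> t t01 tab; have := cos_lt_arc a0 ab b1 tab; rewrite /y -/cc -/s; lra.
- move=> t t01 tab; have := cos_gt_arc a0 ab b1 t01 tab; rewrite /y -/cc -/s; lra.
move=> n; pose al := val (@expi R s).
(* The cosine of [2 * pi * (t - s)] is half of [z * al^* + z^* * al]. With the factor 1/4 in [y]
   this gives 1/8, and multiplication by z removes the conjugate. *)
pose Y : {poly C} := (1/2 + cc/4)%:C *: 'X - (8%:R^-1)%:C *: (al^* *: 'X^2 + al%:P).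
have YE t : Y.[val (@expi R t)] = val (@expi R t) * (y t)%:C.
  rewrite /Y !(hornerD, hornerN, hornerZ, hornerX, hornerXn, hornerC) /y.
  set z := val (@expi R t).
  have zz : z * z^* = 1 by rewrite mulcJ /z normc_val expr1n.
  have cE : (cos (2 * pi * (t - s)))%:C = (z * al^* + z^* * al) / 2.
    rewrite mulrBr cosB.
    have -> : z * al^* + z^* * al = 2 *
      (cos (2 * pi * t) * cos (2 * pi * s) + sin (2 * pi * t) * sin (2 * pi * s))%:C.
      rewrite /z /al !val_expiE; apply: complex_eqP;
        rewrite ?(Re_add, Im_add, Re_mul, Im_mul, Re_conjC, Im_conjC)/=; ring.
    by rewrite [RHS]mulrAC divff ?mul1r// pnatr_eq0.
  have -> : (1 / 2 - (cos (2 * pi * (t - s)) - cc) / 4)%:C =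
      1 / 2 - ((z * al^* + z^* * al) / 2 - cc%:C) / 4.
    by rewrite !(rmorphB, rmorphM, fmorphV, rmorph1, rmorph_nat) -cE.
  have -> : (1 / 2 + cc / 4)%:C = 1 / 2 + cc%:C / 4 :> C.
    by rewrite !(rmorphD, rmorphM, fmorphV, rmorph1, rmorph_nat).
  have -> : (8%:R^-1)%:C = 8%:R^-1 :> C by rewrite fmorphV rmorph_nat.
  have alg (x xc a' ac c : C) : x * xc = 1 ->
      (1 / 2 + c / 4) * x - 8%:R^-1 * (ac * x ^+ 2 + a') =
      x * (1 / 2 - ((x * ac + xc * a') / 2 - c) / 4).
    move=> h; have -> : 8%:R^-1 * (ac * x ^+ 2 + a') =
      8%:R^-1 * (ac * x ^+ 2 + x * xc * a') by rewrite h mul1r.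
    by field.
  exact: alg.
exists (('X^n - Y ^+ n) ^+ (2 ^ n)) => t.
rewrite horner_exp hornerD hornerN !horner_exp hornerX YE.
rewrite [(_ * (y t)%:C) ^+ n]exprMn -[X in X - _]mulr1 -mulrBr exprMn normcM.
have -> : 1 - (y t)%:C ^+ n = (1 - y t ^+ n)%:C.
  by rewrite -rmorphXn rmorphB rmorph1.
rewrite -rmorphXn.
have -> : normc ((val (@expi R t) ^+ n) ^+ (2 ^ n)) = 1.
  by rewrite -exprM (normc_expz _ (n * 2 ^ n)%N).
by rewrite mul1r /threshold /= expr0n/= addr0 sqr_sqrtr// sqr_ge0.
Qed.

(** The polynomials of [arc_indicator] have squared moduli that are bounded by 1 and converge almost
    everywhere to the indicator of an arc. By dominated convergence the integral of [k] over every
    arc is nonnegative, which reduces to the test on intervals. *)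
Lemma ae_ge0_of_poly (k : T -> R) : rint k ->
  (forall p : {poly C}, 0 <= \int[mu]_z (normc p.[val z] ^+ 2 * k z)) ->
  {ae mu, forall z, 0 <= k z}.
Proof.
move=> ik kp; have mk := measurable_rint ik.
have ike := rint_arc ik.
suff : {ae leb, forall t : R, t \in `]0, 1[ -> 0 <= k (expi t)}.
  move=> h; apply: arc_ae.
    rewrite [X in measurable X](_ : _ = k @^-1` `[0, +oo[); last first.
      by apply/seteqP; split => z /=; rewrite in_itv/= andbT.
    by rewrite -[X in measurable X]setTI; exact: mk.
  have e0 := ae_neq (0 : R); have e1 := ae_neq (1 : R); move: h e0 e1; apply: filterS3.
    exact: (ae_filter_ringOfSetsType leb).
  move=> t h t0 t1; rewrite in_itv/= => /andP[t0' t1'].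
  by apply: h; rewrite in_itv/= !lt_neqAle eq_sym t0 t0' t1 t1'.
apply: ae_ge0_of_itv => // a b a0 ab b1.
have [y [y01 yin yout yp]] := arc_indicator a0 ab b1.
have /choice[p pE] := yp.
pose f_ n (t : measurableTypeR R) := (threshold n (y t) ^+ 2 * k (expi t))%:E.
pose f : measurableTypeR R -> \bar R := (EFin \o (k \o @expi R)) \_ `]a, b[.
have fE n t : f_ n t = (normc (p n).[val (@expi R t)] ^+ 2 * k (expi t))%:E.
  by rewrite /f_ -pE.
have mfn n : @measurable_fun _ _ (measurableTypeR R) _ `[0%R, 1%R] (f_ n).
  rewrite (_ : f_ n = EFin \o ((fun z => normc (p n).[val z] ^+ 2 * k z) \o @expi R)); last first.
    by apply/funext => t; rewrite fE.
  apply/measurable_EFinP/measurable_funTS.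
  apply: (measurableT_comp _ measurable_expiR).
  by apply: measurable_funM => //; apply: measurable_sqr_normc; exact: cmeas_poly.
have abs01 : `]a, b[ `<=` `[0, 1].
  move=> t /=; rewrite !in_itv/= => /andP[at_ tb].
  by rewrite (le_trans a0 (ltW at_)) (le_trans (ltW tb) b1).
have mf : @measurable_fun _ _ (measurableTypeR R) _ `[0%R, 1%R] f.
  apply: measurable_funTS; apply/(measurable_restrictT _ _).1 => //.
  apply/measurable_EFinP; apply: measurable_funTS; exact: (measurableT_comp mk measurable_expiR).
have cvgf : {ae leb, forall t, `[0, 1]%classic t -> f_^~ t @ \oo --> f t}.
  have aeF := ae_filter_ringOfSetsType leb.
  (* At [a] and [b] one has [y = 1/2], where [threshold] tends neither to 0 nor to 1; the position
     of [y] relative to 1/2 is known only for [0 < t < 1]. *)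
  apply: filterS2 (filterI (ae_neq 0) (ae_neq 1)) (filterI (ae_neq a) (ae_neq b)) => t.
  move=> [t0 t1] [ta tb]; rewrite /= in_itv/= => /andP[t0' t1'].
  have t01 : 0 < t < 1 by rewrite !lt_neqAle eq_sym t0 t0' t1 t1'.
  have /andP[y0 y1] := y01 t.
  have [tin|tin] := boolP (a < t < b).
    rewrite /f patchE mem_set//=; apply: cvg_EFin; first by apply: nearW.
    rewrite /comp /f_ /= -[X in _ --> X]mul1r.
    apply: cvgMl; rewrite -(expr1n _ 2%N).
    have h : threshold^~ (y t) @ \oo --> (1 : R) by apply: threshold_cvg1; rewrite y0 yin.
    exact: (cvgM h h).
  rewrite /f patchE memNset//=; last by rewrite in_itv/=; exact/negP.
  rewrite (_ : point = (0 * k (expi t))%:E); last by rewrite mul0r.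
  apply: cvg_EFin; first by apply: nearW.
  rewrite /comp /f_ /=.
  apply: cvgMl.
  rewrite -[X in _ --> X](expr0n _ 2%N).
  suff y21 : 1 / 2 < y t <= 1 by have h := threshold_cvg0 y21; exact: (cvgM h h).
  rewrite y1 andbT yout//.
  move: tin; rewrite negb_and -!leNgt => /orP[h|h]; apply/orP; [left|right].
    by rewrite lt_neqAle ta.
  by rewrite lt_neqAle eq_sym tb.
have dom : {ae leb, forall t n, `[0, 1]%classic t ->
    (`|f_ n t| <= (EFin \o (fun t => `|k (expi t)|)%R) t)%E}.
  apply: (@aeW _ _ _ leb) => t n _ /=; rewrite lee_fin normrM.
  have /andP[q0 q1] := threshold01 n (y01 t).
  by rewrite ger0_norm ?sqr_ge0// ler_piMl// exprn_ile1.
have iabs : leb.-integrable `[0, 1] (EFin \o (fun t => `|k (expi t)|)).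
  exact: integrable_norm ike.
have DC := @dominated_convergence _ _ R leb _ (measurable_itv `[0%R, 1%R]) f_ f (EFin \o (fun t => `|k (expi t)|)).
have [_ _ cvgI] := DC mfn mf cvgf iabs dom.
have I0 n : (0 <= \int[leb]_(t in `[0%R, 1%R]) f_ n t)%E.
  have := kp (p n); rewrite Rintegral_arc; last first.
    by apply: measurable_funM => //; apply: measurable_sqr_normc; exact: cmeas_poly.
  rewrite /Rintegral; under [X in fine X]eq_integral do rewrite -fE.
  have fin : (\int[leb]_(t in `[0%R, 1%R]) f_ n t)%E \is a fin_num.
    apply: integrable_fin_num => //.
    apply: (le_integrable _ (mfn n) _ iabs) => // t _ /=; rewrite lee_fin normrM.
    have /andP[q0 q1] := threshold01 n (y01 t).
    by rewrite normr_id ger0_norm ?sqr_ge0// ler_piMl// exprn_ile1.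
  by rewrite -{2}(fineK fin) lee_fin.
have : (0 <= \int[leb]_(t in `[0%R, 1%R]) f t)%E.
  rewrite -(cvg_lim _ cvgI)//; apply: lime_ge; first by apply/cvg_ex; eexists; exact: cvgI.
  by apply: nearW => n; exact: I0.
rewrite /f -integral_mkcondr setIidr// => h.
by rewrite /Rintegral fine_ge0.
Qed.

End polynomial_test.

(** * The inner product of column vectors *)

Section vectors.
Context {R : realType}.
Local Notation C := R[i].

Definition ip k (x y : 'cV[C]_k) : C := (y^t* *m x) 0 0.

Lemma ipE k (x y : 'cV[C]_k) : ip x y = \sum_i x i 0 * (y i 0)^*.
Proof. by rewrite /ip mxE; apply: eq_bigr => i _; rewrite !mxE mulrC. Qed.

Lemma ip_hermitian k : hermitian_on [set: 'cV[C]_k] (@ip k).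
Proof.
split => [a x y z _ _ _|x y _ _].
  rewrite !ipE mulr_sumr -big_split; apply: eq_bigr => i _ /=.
  by rewrite !mxE; ring.
rewrite !ipE rmorph_sum; apply: eq_bigr => i _.
by rewrite rmorphM/= conjCK mulrC.
Qed.

Lemma lin_closedT (V : lmodType C) : lin_closed [set: V].
Proof. by []. Qed.

Lemma vnorm_ge0 k (x : 'cV[C]_k) : 0 <= vnorm x.
Proof. exact: sqrtr_ge0. Qed.

Lemma sqr_vnorm k (x : 'cV[C]_k) : vnorm x ^+ 2 = \sum_i normc (x i 0) ^+ 2.
Proof. by rewrite sqr_sqrtr// sumr_ge0// => i _; exact: sqr_ge0. Qed.

Lemma ip_self k (x : 'cV[C]_k) : ip x x = (vnorm x ^+ 2)%:C.
Proof.
rewrite ipE sqr_vnorm rmorph_sum; apply: eq_bigr => i _.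
by rewrite mulcJ.
Qed.

Lemma vnormE k (x : 'cV[C]_k) : vnorm x = Num.sqrt (fsq (@ip k) x).
Proof. by rewrite /fsq ip_self/= sqrtr_sqr ger0_norm ?vnorm_ge0. Qed.

Lemma normc_ip_le k (x y : 'cV[C]_k) : normc (ip x y) <= vnorm x * vnorm y.
Proof.
rewrite !vnormE; apply: (form_Cauchy_Schwarz (lin_closedT _) (@ip_hermitian k)) => //.
by move=> z _; rewrite /fsq ip_self/= sqr_ge0.
Qed.

Lemma vnorm_eq0 k (x : 'cV[C]_k) : vnorm x = 0 -> x = 0.
Proof.
move=> x0; have := sqr_vnorm x; rewrite x0 expr0n/= => /esym/eqP.
rewrite psumr_eq0; last by move=> i _; exact: sqr_ge0.
move=> /allP h; apply/matrixP => i j; rewrite ord1 mxE.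
have := h i; rewrite mem_index_enum => /(_ isT).
by rewrite sqrf_eq0 => /eqP /eq0_normc.
Qed.

Lemma vnorm0 k : vnorm (0 : 'cV[C]_k) = 0.
Proof.
by rewrite /vnorm big1 ?sqrtr0// => i _; rewrite mxE normc0 expr0n.
Qed.

Lemma vnormZ k (a : C) (x : 'cV[C]_k) : vnorm (a *: x) = normc a * vnorm x.
Proof.
rewrite !vnormE (fsqZ (lin_closedT _) (@ip_hermitian k))//.
by rewrite sqrtrM ?sqr_ge0// sqrtr_sqr ger0_norm ?normc_ge0.
Qed.

Lemma sqr_vnormD_le k (x y : 'cV[C]_k) :
  vnorm (x + y) ^+ 2 <= 2 * vnorm x ^+ 2 + 2 * vnorm y ^+ 2.
Proof.
have E (z : 'cV[C]_k) : vnorm z ^+ 2 = fsq (@ip k) z by rewrite /fsq ip_self.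
rewrite !E (fsqD (lin_closedT _) (@ip_hermitian k))// -!E.
have := normr_Re_le (ip x y); have := normc_ip_le x y.
have := ler_norm (complex.Re (ip x y)); have := sqr_ge0 (vnorm x - vnorm y).
nra.
Qed.

Lemma normc_entry_le k (x : 'cV[C]_k) i : normc (x i 0) <= vnorm x.
Proof.
rewrite -ler_sqr ?nnegrE ?normc_ge0 ?vnorm_ge0// sqr_vnorm (bigD1 i)//= lerDl.
by apply: sumr_ge0 => j _; exact: sqr_ge0.
Qed.

Lemma adjmxK k l (A : 'M[C]_(k, l)) : A^t*^t* = A.
Proof. by apply/matrixP => i j; rewrite !mxE conjCK. Qed.

Lemma adjmxM k l m (A : 'M[C]_(k, l)) (B : 'M[C]_(l, m)) :
  (A *m B)^t* = B^t* *m A^t*.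
Proof. by rewrite trmx_mul map_mxM. Qed.

Lemma ip_mulmx k l (A : 'M[C]_(k, l)) (x : 'cV[C]_l) (y : 'cV[C]_k) :
  ip (A *m x) y = ip x (A^t* *m y).
Proof. by rewrite /ip adjmxM adjmxK mulmxA. Qed.

Lemma vnorm_delta k (i : 'I_k) : vnorm (delta_mx i 0 : 'cV[C]_k) = 1.
Proof.
rewrite /vnorm (bigD1 i)//= mxE !eqxx normc1 expr1n big1 ?addr0 ?sqrtr1// => j ji.
by rewrite mxE (negPf ji) normc0 expr0n.
Qed.

Lemma cV_sum_delta k (x : 'cV[C]_k) : x = \sum_i x i 0 *: delta_mx i 0.
Proof.
by rewrite {1}(matrix_sum_delta x); apply: eq_bigr => i _; rewrite big_ord1.
Qed.

End vectors.

(** * Vector-valued L2 *)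

Section L2_theory.
Context {R : realType}.
Local Notation C := R[i].
Local Notation T := (circle R).
Local Notation mu := (@arc_length R).

Lemma measurable_mxP k l (F : T -> 'M[C]_(k, l)) :
  measurable_mx F <-> forall i j, cmeas (fun z => F z i j).
Proof. by []. Qed.

Lemma measurable_mxM k l m (F : T -> 'M[C]_(k, l)) (G : T -> 'M[C]_(l, m)) :
  measurable_mx F -> measurable_mx G -> measurable_mx (fun z => F z *m G z).
Proof.
move=> mF mG; apply/measurable_mxP => i j.
under [X in cmeas X]eq_fun do rewrite mxE.
by apply: cmeas_sum => r; apply: cmeasM; [exact: mF|exact: mG].
Qed.

Lemma measurable_mxD k l (F G : T -> 'M[C]_(k, l)) :
  measurable_mx F -> measurable_mx G -> measurable_mx (fun z => F z + G z).
Proof.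
move=> mF mG; apply/measurable_mxP => i j.
under [X in cmeas X]eq_fun do rewrite mxE.
by apply: cmeasD; [exact: mF|exact: mG].
Qed.

Lemma measurable_mxZ k l (a : T -> C) (F : T -> 'M[C]_(k, l)) :
  cmeas a -> measurable_mx F -> measurable_mx (fun z => a z *: F z).
Proof.
move=> ma mF; apply/measurable_mxP => i j.
under [X in cmeas X]eq_fun do rewrite mxE.
by apply: cmeasM => //; exact: mF.
Qed.

Lemma measurable_mxB k l (F G : T -> 'M[C]_(k, l)) :
  measurable_mx F -> measurable_mx G -> measurable_mx (fun z => F z - G z).
Proof.
move=> mF mG; apply/measurable_mxP => i j.
under [X in cmeas X]eq_fun do rewrite mxE mxE.
by apply: cmeasB; [exact: mF|exact: mG].
Qed.

Lemma measurable_mx_cst k l (A : 'M[C]_(k, l)) : measurable_mx (fun _ : T => A).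
Proof. by apply/measurable_mxP => i j; exact: cmeas_cst. Qed.

Lemma measurable_mx_adj k l (F : T -> 'M[C]_(k, l)) :
  measurable_mx F -> measurable_mx (fun z => (F z)^t*).
Proof.
move=> mF; apply/measurable_mxP => i j.
under [X in cmeas X]eq_fun do rewrite mxE mxE.
by apply: cmeasJ; exact: mF.
Qed.

Lemma measurable_mxT k l (F : T -> 'M[C]_(k, l)) :
  measurable_mx F -> measurable_mx (fun z => (F z)^T).
Proof.
move=> mF; apply/measurable_mxP => i j.
by under [X in cmeas X]eq_fun do rewrite mxE; exact: mF.
Qed.

Lemma measurable_mxJ k l (F : T -> 'M[C]_(k, l)) :
  measurable_mx F -> measurable_mx (fun z => map_mx Num.conj (F z)).
Proof.
move=> mF; apply/measurable_mxP => i j.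
by under [X in cmeas X]eq_fun do rewrite mxE; apply: cmeasJ; exact: mF.
Qed.

Lemma measurable_sqr_vnorm k (f : T -> 'cV[C]_k) : measurable_mx f ->
  measurable_fun [set: T] (fun z => vnorm (f z) ^+ 2).
Proof.
move=> mf; under eq_fun do rewrite sqr_vnorm.
by apply: measurable_sum => i; exact: measurable_sqr_normc.
Qed.

Lemma L2P k (f : T -> 'cV[C]_k) :
  L2 f <-> measurable_mx f /\ rint (fun z => vnorm (f z) ^+ 2).
Proof.
split => -[mf]; last first.
  move=> /integrableP[_]; split => //; apply: le_lt_trans b.
  apply: ge0_le_integral => //.
  - by move=> z _; rewrite lee_fin sqr_ge0.
  - by apply/measurable_EFinP; exact: measurable_sqr_vnorm.
  - by apply: measurableT_comp => //; apply/measurable_EFinP; exact: measurable_sqr_vnorm.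
  - by move=> z _ /=; rewrite ger0_norm ?sqr_ge0.
move=> foo; split => //; apply/integrableP; split.
  by apply/measurable_EFinP; exact: measurable_sqr_vnorm.
by under eq_integral do rewrite /= ger0_norm ?sqr_ge0//.
Qed.

Lemma L2_meas k (f : T -> 'cV[C]_k) : L2 f -> measurable_mx f.
Proof. by case. Qed.

Lemma L2_rint k (f : T -> 'cV[C]_k) : L2 f -> rint (fun z => vnorm (f z) ^+ 2).
Proof. by move/L2P => []. Qed.

Lemma L2_bounded k (f : T -> 'cV[C]_k) (M : R) : measurable_mx f ->
  (forall z, vnorm (f z) <= M) -> L2 f.
Proof.
move=> mf fM; apply/L2P; split => //; apply: (@bounded_rint _ _ (M ^+ 2)).
  exact: measurable_sqr_vnorm.
move=> z; rewrite ger0_norm ?sqr_ge0// ler_sqr ?nnegrE ?vnorm_ge0//.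
exact: le_trans (vnorm_ge0 _) (fM z).
Qed.

Lemma L2_lin_closed k : lin_closed (@L2 R k).
Proof.
split.
  apply: (@L2_bounded _ _ 0) => [|z]; first exact: measurable_mx_cst.
  by rewrite vnorm0.
move=> a f g /L2P[mf fi] /L2P[mg gi]; apply/L2P.
have mh : measurable_mx (a *: f + g).
  by apply: measurable_mxD => //; apply: (measurable_mxZ (cmeas_cst a)).
split => //.
apply: (@rint_le _ _ (fun z => 2 * normc a ^+ 2 * vnorm (f z) ^+ 2 + 2 * vnorm (g z) ^+ 2)).
- exact: measurable_sqr_vnorm.
- by apply: rintD; exact: rintZ.
- move=> z; rewrite ger0_norm ?sqr_ge0// (le_trans (sqr_vnormD_le _ _))//.
  by rewrite vnormZ exprMn mulrA.
Qed.

Lemma cmeas_ip k (f g : T -> 'cV[C]_k) : measurable_mx f -> measurable_mx g ->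
  cmeas (fun z => ip (f z) (g z)).
Proof.
move=> mf mg; under [X in cmeas X]eq_fun do rewrite ipE.
by apply: cmeas_sum => i; apply: cmeasM; [exact: mf|apply: cmeasJ; exact: mg].
Qed.

Definition cint (f : T -> C) :=
  rint (fun z => complex.Re (f z)) /\ rint (fun z => complex.Im (f z)).

Lemma cint_le (f : T -> C) (g : T -> R) : cmeas f -> rint g ->
  (forall z, normc (f z) <= g z) -> cint f.
Proof.
move=> [mR mI] gi fg; split; apply: (rint_le _ gi) => // z.
  exact: le_trans (normr_Re_le _) (fg z).
exact: le_trans (normr_Im_le _) (fg z).
Qed.

Lemma cintegralD f g : cint f -> cint g ->
  cintegral (fun z => f z + g z) = cintegral f + cintegral g.
Proof.
move=> [rf jf] [rg jg]; apply: complex_eqP; rewrite ?Re_add ?Im_add /cintegral /=.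
  by under eq_Rintegral do rewrite Re_add; rewrite RintegralD.
by under eq_Rintegral do rewrite Im_add; rewrite RintegralD.
Qed.

Lemma cintD f g : cint f -> cint g -> cint (fun z => f z + g z).
Proof.
move=> [rf jf] [rg jg]; split.
  by under [X in rint X]eq_fun do rewrite Re_add; exact: rintD.
by under [X in rint X]eq_fun do rewrite Im_add; exact: rintD.
Qed.

Lemma cintZ a f : cint f -> cint (fun z => a * f z).
Proof.
move=> [rf jf]; split.
  under [X in rint X]eq_fun do rewrite Re_mul.
  by apply: rintB; exact: rintZ.
under [X in rint X]eq_fun do rewrite Im_mul.
by apply: rintD; exact: rintZ.
Qed.

Lemma cintegralZ a f : cint f -> cintegral (fun z => a * f z) = a * cintegral f.
Proof.
move=> [rf jf]; apply: complex_eqP; rewrite ?Re_mul ?Im_mul /cintegral /=.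
  under eq_Rintegral do rewrite Re_mul.
  by rewrite RintegralB ?RintegralZl//; exact: rintZ.
under eq_Rintegral do rewrite Im_mul.
by rewrite RintegralD ?RintegralZl//; exact: rintZ.
Qed.

Lemma cintegralJ f : cint f -> cintegral (fun z => (f z)^*) = (cintegral f)^*.
Proof.
move=> [rf jf]; apply: complex_eqP; rewrite ?Re_conjC ?Im_conjC /cintegral /=.
  by under eq_Rintegral do rewrite Re_conjC.
under eq_Rintegral do rewrite Im_conjC -mulN1r.
by rewrite RintegralZl// mulN1r.
Qed.

Lemma cint_ip k (f g : T -> 'cV[C]_k) : L2 f -> L2 g ->
  cint (fun z => ip (f z) (g z)).
Proof.
move=> /L2P[mf fi] /L2P[mg gi].
apply: (@cint_le _ (fun z => vnorm (f z) ^+ 2 + vnorm (g z) ^+ 2)).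
- exact: cmeas_ip.
- exact: rintD.
- move=> z; apply: (le_trans (normc_ip_le _ _)).
  have := sqr_ge0 (vnorm (f z) - vnorm (g z)).
  have := vnorm_ge0 (f z); have := vnorm_ge0 (g z); nra.
Qed.

Lemma L2innerE k (f g : T -> 'cV[C]_k) : L2inner f g = cintegral (fun z => ip (f z) (g z)).
Proof. by []. Qed.

Lemma L2inner_hermitian k : hermitian_on (@L2 R k) (@L2inner R k).
Proof.
split => [a f g h Lf Lg Lh|f g Lf Lg].
  rewrite !L2innerE.
  have -> : (fun z => ip ((a *: f + g) z) (h z)) =
      (fun z => a * ip (f z) (h z) + ip (g z) (h z)).
    by apply/funext => z; rewrite (@ip_hermitian _ _).1.
  by rewrite cintegralD ?cintegralZ//; [exact: cint_ip|exact/cintZ/cint_ip|exact: cint_ip].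
rewrite !L2innerE -cintegralJ; last exact: cint_ip.
by congr cintegral; apply/funext => z; rewrite -(@ip_hermitian _ _).2.
Qed.

Lemma fsq_L2inner k (f : T -> 'cV[C]_k) :
  fsq (@L2inner R k) f = \int[mu]_z (vnorm (f z) ^+ 2).
Proof.
rewrite /fsq L2innerE /cintegral /=; apply: eq_Rintegral => z _.
by rewrite ip_self.
Qed.

Lemma L2norm_ge0 k (f : T -> 'cV[C]_k) : 0 <= L2norm f.
Proof. exact: sqrtr_ge0. Qed.

Lemma sqr_L2norm k (f : T -> 'cV[C]_k) : L2norm f ^+ 2 = \int[mu]_z (vnorm (f z) ^+ 2).
Proof. by rewrite sqr_sqrtr// Rintegral_ge0// => z _; exact: sqr_ge0. Qed.

Lemma fsq_L2norm k (f : T -> 'cV[C]_k) : fsq (@L2inner R k) f = L2norm f ^+ 2.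
Proof. by rewrite fsq_L2inner sqr_L2norm. Qed.

Lemma L2_Cauchy_Schwarz k (f g : T -> 'cV[C]_k) : L2 f -> L2 g ->
  normc (L2inner f g) <= L2norm f * L2norm g.
Proof.
move=> Lf Lg.
have := form_Cauchy_Schwarz (L2_lin_closed k) (@L2inner_hermitian k).
rewrite /L2norm -!fsq_L2inner; apply => // h Lh.
by rewrite fsq_L2norm sqr_ge0.
Qed.

Lemma L2normZ k a (f : T -> 'cV[C]_k) : L2 f -> L2norm (a *: f) = normc a * L2norm f.
Proof.
move=> Lf; rewrite {1}/L2norm -fsq_L2inner (fsqZ (L2_lin_closed k) (@L2inner_hermitian k))//.
by rewrite sqrtrM ?sqr_ge0// sqrtr_sqr ger0_norm ?normc_ge0// fsq_L2inner.
Qed.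

Lemma L2norm0 k : L2norm (0 : T -> 'cV[C]_k) = 0.
Proof.
rewrite /L2norm; under eq_Rintegral do rewrite vnorm0 expr0n/=.
by rewrite Rintegral_cst// mul0r sqrtr0.
Qed.

Lemma L2_ae k (f g : T -> 'cV[C]_k) : measurable_mx g ->
  {ae mu, forall z, f z = g z} -> L2 f -> L2 g.
Proof.
move=> mg fg /L2P[mf fi]; apply/L2P; split => //.
apply: eq_rint_ae fi; first exact: measurable_sqr_vnorm.
by apply: filterS fg => z ->.
Qed.

Lemma L2norm_eq0 k (f : T -> 'cV[C]_k) : L2 f -> L2norm f = 0 ->
  {ae mu, forall z, f z = 0}.
Proof.
move=> Lf f0; have := sqr_L2norm f; rewrite f0 expr0n/= => /esym h.
have := Rintegral_eq0_ae (L2_rint Lf) (fun z => sqr_ge0 _) h.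
by apply: filterS => z /eqP; rewrite sqrf_eq0 => /eqP/vnorm_eq0.
Qed.

Lemma cintegral_ae (f g : T -> C) : cmeas f -> cmeas g ->
  {ae mu, forall z, f z = g z} -> cintegral f = cintegral g.
Proof.
move=> [rf jf] [rg jg] fg; rewrite /cintegral; congr Complex.
  by apply: eq_Rintegral_ae => //; apply: filterS fg => z ->.
by apply: eq_Rintegral_ae => //; apply: filterS fg => z ->.
Qed.

Lemma L2inner_ael k (f f' g : T -> 'cV[C]_k) : measurable_mx f -> measurable_mx f' ->
  measurable_mx g -> {ae mu, forall z, f z = f' z} -> L2inner f g = L2inner f' g.
Proof.
move=> mf mf' mg ff'; rewrite !L2innerE; apply: cintegral_ae.
- exact: cmeas_ip.
- exact: cmeas_ip.
- by apply: filterS ff' => z ->.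
Qed.

Lemma L2_shift k (j : int) (f : T -> 'cV[C]_k) : L2 f -> L2 (fun z => val z ^ j *: f z).
Proof.
move=> /L2P[mf fi]; apply/L2P; split; first exact: (measurable_mxZ (cmeas_expz j)).
by under [X in rint X]eq_fun do rewrite vnormZ normc_expz mul1r.
Qed.

Lemma ip_shift k (j : int) (z : T) (x y : 'cV[C]_k) :
  ip (val z ^ j *: x) (val z ^ j *: y) = ip x y.
Proof.
rewrite !ipE; apply: eq_bigr => i _; rewrite !mxE rmorphM/= mulrACA mulcJ.
by rewrite normc_expz expr1n mul1r.
Qed.

Lemma L2norm_shift k (j : int) (f : T -> 'cV[C]_k) :
  L2norm (fun z => val z ^ j *: f z) = L2norm f.
Proof.
by rewrite /L2norm; under eq_Rintegral do rewrite vnormZ normc_expz mul1r.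
Qed.

(** Quantifying over all vectors inside the almost everywhere clause makes products, sums and
    adjoints pointwise matters and avoids handling the supremum in [mxnorm]. *)
Definition ae_bound k l (F : T -> 'M[C]_(k, l)) (M : R) :=
  {ae mu, forall z, forall x, vnorm (F z *m x) <= M * vnorm x}.

Lemma L2_mulmx k l (F : T -> 'M[C]_(k, l)) M (f : T -> 'cV[C]_l) :
  measurable_mx F -> ae_bound F M -> L2 f -> L2 (fun z => F z *m f z).
Proof.
move=> mF FM /L2P[mf fi]; have mFf := measurable_mxM mF mf.
apply/L2P; split => //.
(* Domination in [rint_le] is required at every point, whereas the bound on [F] holds almost
   everywhere; the minimum is dominated everywhere and differs from the integrand only on a null
   set. *)
have mm : measurable_fun [set: T] (fun z => Num.min (vnorm (F z *m f z) ^+ 2) (M ^+ 2 * vnorm (f z) ^+ 2)).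
  apply: measurable_minr; first exact: measurable_sqr_vnorm.
  by apply: measurable_funM => //; exact: measurable_sqr_vnorm.
apply: (eq_rint_ae (f := fun z => Num.min (vnorm (F z *m f z) ^+ 2) (M ^+ 2 * vnorm (f z) ^+ 2))).
- exact: measurable_sqr_vnorm.
- apply: filterS FM => z FM; apply: min_l.
  have := FM (f z) => h; rewrite -exprMn ler_sqr// ?nnegrE ?vnorm_ge0//.
  exact: le_trans (vnorm_ge0 _) h.
- apply: (rint_le mm (rintZ (M ^+ 2) fi)) => z.
  rewrite ger0_norm; first by rewrite ge_min lexx orbT.
  by rewrite le_min sqr_ge0 mulr_ge0// sqr_ge0.
Qed.

Lemma L2norm_mulmx_le k l (F : T -> 'M[C]_(k, l)) M (f : T -> 'cV[C]_l) : 0 <= M ->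
  measurable_mx F -> ae_bound F M -> L2 f ->
  L2norm (fun z => F z *m f z) <= M * L2norm f.
Proof.
move=> M0 mF FM Lf; have LFf := L2_mulmx mF FM Lf.
rewrite -ler_sqr ?nnegrE ?mulr_ge0 ?L2norm_ge0// exprMn !sqr_L2norm -subr_ge0.
have i1 := L2_rint Lf; have i2 := L2_rint LFf.
rewrite -RintegralZl// -RintegralB//; last exact: rintZ.
apply: Rintegral_ae_ge0; first by apply: rintB => //; exact: rintZ.
apply: filterS FM => z FM; rewrite subr_ge0 -exprMn ler_sqr ?nnegrE ?vnorm_ge0//.
by rewrite mulr_ge0// vnorm_ge0.
Qed.

Lemma L2inner_mulmx k l (F : T -> 'M[C]_(k, l)) (f : T -> 'cV[C]_l) (g : T -> 'cV[C]_k) :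
  L2inner (fun z => F z *m f z) g = L2inner f (fun z => (F z)^t* *m g z).
Proof. by rewrite !L2innerE; congr cintegral; apply/funext => z; exact: ip_mulmx. Qed.

End L2_theory.

(** * Completeness of L2 *)

Section Riesz_Fischer.
Context {R : realType}.
Local Notation C := R[i].
Local Notation T := (circle R).
Local Notation mu := (@arc_length R).

Lemma cvgn_bounded_variation (a : nat -> R) (M : R) :
  (forall n, \sum_(0 <= k < n) `|a k.+1 - a k| <= M) -> cvgn a.
Proof.
move=> aM; have : cvgn (series (telescope a)).
  apply: normed_cvg.
  rewrite (_ : [normed series (telescope a)] = fun n => \sum_(0 <= k < n) `|a k.+1 - a k|).
    apply: nondecreasing_is_cvgn; last by exists M => _ [k _ <-]; exact: aM.
    by apply/nondecreasing_seqP => k; rewrite big_nat_recr//= lerDl.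
  by apply/funext => n; rewrite /= seriesEnat.
rewrite telescopeK => /cvg_ex[l hl]; apply/cvg_ex; exists (l + a 0%N).
have h : (fun k => (a k - a 0%N) + a 0%N) @ \oo --> l + a 0%N.
  by apply: cvgD; [exact: hl|exact: cvg_cst].
by move: h; rewrite (_ : (fun k => _) = a)//; apply/funext => k; rewrite subrK.
Qed.

Lemma rint_sqr_B (u v : T -> R) : measurable_fun [set: T] u -> measurable_fun [set: T] v ->
  rint (fun z => u z ^+ 2) -> rint (fun z => v z ^+ 2) ->
  rint (fun z => (u z - v z) ^+ 2).
Proof.
move=> mu_ mv iu iv.
apply: (@rint_le _ _ (fun z => 2 * u z ^+ 2 + 2 * v z ^+ 2)).
- by apply: measurable_funX; exact: measurable_funB.
- by apply: rintD; exact: rintZ.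
- by move=> z; rewrite ger0_norm ?sqr_ge0//; have := sqr_ge0 (u z + v z); nra.
Qed.

Section complete.
Variable u : nat -> T -> R.
Hypothesis mu_ : forall n, measurable_fun [set: T] (u n).
Hypothesis iu : forall n, rint (fun z => u n z ^+ 2).
Hypothesis uC : forall e : R, 0 < e -> exists N, forall m n, (N <= m)%N -> (N <= n)%N ->
  \int[mu]_z ((u m z - u n z) ^+ 2) <= e.

(* A subsequence with summable increments converges almost everywhere. *)
Let fast_subseq : exists s : nat -> nat, (forall k, (k <= s k)%N) /\
  forall k, \int[mu]_z ((u (s k.+1) z - u (s k) z) ^+ 2) <= (2^-1 ^+ k) ^+ 2.
Proof.
have h (k : nat) : exists N, forall m n, (N <= m)%N -> (N <= n)%N ->
    \int[mu]_z ((u m z - u n z) ^+ 2) <= (2^-1 ^+ k) ^+ 2.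
  by apply: uC; rewrite exprn_gt0// exprn_gt0// invr_gt0.
have {h} [N hN] := choice h.
pose s k := (\sum_(j < k.+1) (N j).+1)%N.
have sN k : (N k <= s k)%N by rewrite /s big_ord_recr/= (leq_trans (leqnSn _))// leq_addl.
exists s; split => [k|k]; last first.
  apply: hN => //; apply: (leq_trans (sN k)).
  by rewrite /s [X in (_ <= X)%N]big_ord_recr/= leq_addr.
elim: k => // k IH; rewrite /s big_ord_recr/= -/(s k).
by rewrite -addn1 leq_add.
Qed.

Lemma L2_complete_real : exists v : T -> R, [/\ measurable_fun [set: T] v,
  rint (fun z => v z ^+ 2) &
  forall e : R, 0 < e -> exists N, forall n, (N <= n)%N ->
    \int[mu]_z ((u n z - v z) ^+ 2) <= e].
Proof.
have [s [sk sfast]] := fast_subseq.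
pose D k z := `|u (s k.+1) z - u (s k) z|.
have mD k : measurable_fun [set: T] (D k).
  by apply: measurableT_comp => //; exact: measurable_funB.
have iD2 k : rint (fun z => (u (s k.+1) z - u (s k) z) ^+ 2) by exact: rint_sqr_B.
have iD k : rint (D k).
  apply: (@rint_le _ _ (fun z => (u (s k.+1) z - u (s k) z) ^+ 2 + 1)) => //.
    by apply: rintD => //; exact: rint_cst.
  move=> z; rewrite /D normr_id; set x := u _ _ - _.
  rewrite -(@real_normK _ x) ?num_real//; have := sqr_ge0 (`|x| - 1); have := normr_ge0 x; nra.
(* Integrating [|x| <= x^2 / (2p) + p / 2] with [p = 2^-k] turns the quadratic estimate [p^2] into
   the summable bound [p] for the integral of [|x|]. *)
have ID k : \int[mu]_z D k z <= 2^-1 ^+ k.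
  have p0 : 0 < 2^-1 ^+ k :> R by rewrite exprn_gt0// invr_gt0.
  apply: (@le_trans _ _ (\int[mu]_z (2^-1 * (2^-1 ^+ k)^-1 * (u (s k.+1) z - u (s k) z) ^+ 2 + 2^-1 * 2^-1 ^+ k))).
    apply: le_Rintegral => //; first exact: iD.
      by apply: rintD; [exact: rintZ|exact: rint_cst].
    move=> z _; rewrite /D; set x := u _ _ - _; set p := 2^-1 ^+ k in p0 *.
    rewrite -(@real_normK _ x) ?num_real// -subr_ge0.
    have -> : 2^-1 * p^-1 * `|x| ^+ 2 + 2^-1 * p - `|x| = 2^-1 * p^-1 * (`|x| - p) ^+ 2.
      by field; rewrite gt_eqF.
    apply: mulr_ge0; last exact: sqr_ge0.
    by rewrite mulr_ge0 ?invr_ge0// ltW.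
  rewrite RintegralD//; [|exact: rintZ|exact: rint_cst].
  rewrite [X in _ + X <= _]Rintegral_arc_cst.
  rewrite (@RintegralZl _ _ _ mu setT _ (2^-1 * (2^-1 ^+ k)^-1) measurableT (iD2 k)).
  have pE : (2^-1 ^+ k : R) = 2^-1 * (2^-1 ^+ k)^-1 * (2^-1 ^+ k) ^+ 2 + 2^-1 * 2^-1 ^+ k.
    by set p := 2^-1 ^+ k in p0 *; field; rewrite gt_eqF.
  rewrite [leRHS]pE lerD2r; apply: ler_wpM2l; last exact: sfast.
  by apply: mulr_ge0; rewrite invr_ge0// (ltW p0).
pose h z := (\sum_(0 <= k <oo) (D k z)%:E)%E.
have mDE k : measurable_fun [set: T] (fun z => (D k z)%:E) by exact/measurable_EFinP.
have D0 k z : (0 <= (D k z)%:E)%E by rewrite lee_fin normr_ge0.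
have mh : measurable_fun [set: T] h by apply: ge0_emeasurable_sum.
have Ih : (\int[mu]_z h z < +oo)%E.
  rewrite integral_nneseries//.
  apply: (@le_lt_trans _ _ (\sum_(0 <= k <oo) (2 / (2 ^ (k + 0.+1))%:R)%:E)%E).
    apply: lee_nneseries => k _; first by move=> _; exact: integral_ge0.
    have -> : (2 / (2 ^ (k + 0.+1))%:R)%:E = (2^-1 ^+ k)%:E :> \bar R.
      by congr EFin; rewrite addn1 natrX exprS exprVn invfM mulrA divff// mul1r.
    by rewrite -(fineK (integrable_fin_num measurableT (iD k))) lee_fin; exact: ID.
  by rewrite (cvg_lim _ (@cvg_geometric_eseries_half _ 2 0))//= ltry.
have ih : mu.-integrable [set: T] h.
  apply/integrableP; split => //.
  by under eq_integral do rewrite gee0_abs ?nneseries_ge0//.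
pose E := [set z | (h z < +oo)%E].
have mE : measurable E.
  by have := emeasurable_fun_infty_o measurableT mh +oo%E; rewrite setTI.
have aeE : {ae mu, forall z, E z}.
  have := integrable_ae measurableT ih; apply: filterS => z /(_ Logic.I).
  by rewrite ge0_fin_numE// nneseries_ge0.
(* Cutting off to the set where the increments are summable makes the sequence converge at every
   point, so its limit is measurable. *)
pose w k z := u (s k) z * \1_E z.
have mw k : measurable_fun [set: T] (w k).
  by apply: measurable_funM => //; exact: measurable_indic.
have wcvg z : cvgn (fun k => w k z).
  have [Ez|Ez] := pselect (E z); last first.
    rewrite (_ : (fun k => w k z) = cst 0); first exact: is_cvg_cst.
    by apply/funext => k; rewrite /w indicE memNset// mulr0.
  rewrite (_ : (fun k => w k z) = (fun k => u (s k) z)); last first.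
    by apply/funext => k; rewrite /w indicE mem_set// mulr1.
  apply: (@cvgn_bounded_variation _ (fine (h z))) => n.
  rewrite -lee_fin fineK; last by rewrite ge0_fin_numE// nneseries_ge0.
  by rewrite -sumEFin; apply: nneseries_lim_ge.
pose v z := limn (fun k => w k z).
have mv : measurable_fun [set: T] v by apply: (measurable_fun_cvg mw) => z _; exact: wcvg.
(* Fatou's lemma along the subsequence; the shift by [N] keeps all its indices in the range of the
   Cauchy estimate. *)
have key e : 0 < e -> exists N, forall n, (N <= n)%N ->
    (\int[mu]_z ((u n z - v z) ^+ 2)%:E <= e%:E)%E.
  move=> e0; have [N hN] := uC e0; exists N => n Nn.
  have mf k : measurable_fun [set: T] (fun z => ((u n z - w (k + N)%N z) ^+ 2)%:E).
    by apply/measurable_EFinP/measurable_funX; exact: measurable_funB.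
  have := fatou mu measurableT mf (fun k z _ => sqr_ge0 _).
  have -> : (\int[mu]_z limn_einf (fun k => ((u n z - w (k + N)%N z) ^+ 2)%:E) =
      \int[mu]_z ((u n z - v z) ^+ 2)%:E)%E.
    apply: eq_integral => z _; apply: (cvg_limn_einf_sup _).1.
    apply: cvg_EFin; first exact: nearW.
    have cw : (fun k => w (k + N)%N z) @ \oo --> v z.
      by rewrite (@cvg_shiftn _ _ (fun k => w k z)); exact: wcvg.
    have c1 : (fun k => u n z - w (k + N)%N z) @ \oo --> u n z - v z.
      by apply: cvgB => //; exact: cvg_cst.
    exact: (cvgM c1 c1).
  move=> le1; apply: (le_trans le1).
  rewrite limn_einf_lim; apply: lime_le; first exact: is_cvg_einfs.
  apply: nearW => k; apply: (@le_trans _ _ (\int[mu]_z ((u n z - w (k + N)%N z) ^+ 2)%:E)%E).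
    by apply: ereal_inf_lbound; exists k => /=.
  have -> : (\int[mu]_z ((u n z - w (k + N)%N z) ^+ 2)%:E =
     \int[mu]_z ((u n z - u (s (k + N)%N) z) ^+ 2)%:E)%E.
    apply: ae_eq_integral => //.
      by apply/measurable_EFinP/measurable_funX; exact: measurable_funB.
    by apply: filterS aeE => z Ez _; rewrite /w indicE mem_set// mulr1.
  rewrite -[leLHS]fineK; last by apply: integrable_fin_num => //; exact: rint_sqr_B.
  rewrite lee_fin; apply: hN => //.
  by apply: leq_trans (sk _); rewrite leq_addl.
have mB n : measurable_fun [set: T] (fun z => (u n z - v z) ^+ 2).
  by apply: measurable_funX; exact: measurable_funB.
exists v; split => //.
  have [N hN] := key 1 ltr01.
  have i1 : rint (fun z => (u N z - v z) ^+ 2).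
    apply/integrableP; split; first exact/measurable_EFinP.
    under eq_integral do rewrite /= ger0_norm ?sqr_ge0//.
    by apply: (le_lt_trans (hN N _)) => //; rewrite ltry.
  apply: (@rint_le _ _ (fun z => 2 * (u N z - v z) ^+ 2 + 2 * u N z ^+ 2)).
  - exact: measurable_funX.
  - by apply: rintD; exact: rintZ.
  - by move=> z; rewrite ger0_norm ?sqr_ge0//; have := sqr_ge0 (2 * u N z - v z); nra.
move=> e e0; have [N hN] := key e e0; exists N => n Nn.
rewrite /Rintegral -lee_fin fineK; first exact: hN.
rewrite ge0_fin_numE; first by apply: (le_lt_trans (hN n Nn)); rewrite ltry.
by apply: integral_ge0 => z _; rewrite lee_fin sqr_ge0.
Qed.

End complete.

Lemma L2_complete k (F : nat -> T -> 'cV[C]_k) : (forall n, L2 (F n)) ->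
  (forall e : R, 0 < e -> exists N, forall m n, (N <= m)%N -> (N <= n)%N ->
    L2norm (F m - F n) <= e) ->
  exists2 G, L2 G & forall e : R, 0 < e -> exists N, forall n, (N <= n)%N ->
    L2norm (F n - G) <= e.
Proof.
move=> LF FC.
have mF n i := L2_meas (LF n) i (0 : 'I_1).
have comp (P : C -> R) : (forall x, `|P x| <= normc x) -> (forall x y, P (x - y) = P x - P y) ->
   (forall n i, measurable_fun [set: T] (fun z => P (F n z i 0))) ->
   exists v : 'I_k -> T -> R, forall i, [/\ measurable_fun [set: T] (v i),
     rint (fun z => v i z ^+ 2) &
     forall e : R, 0 < e -> exists N, forall n, (N <= n)%N ->
       \int[mu]_z ((P (F n z i 0) - v i z) ^+ 2) <= e].
  move=> Ple PB mP.
  have Ple2 (f : T -> 'cV[C]_k) z i : P (f z i 0) ^+ 2 <= vnorm (f z) ^+ 2.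
    rewrite -(@real_normK _ (P _)) ?num_real// ler_sqr ?nnegrE ?vnorm_ge0//.
    exact: le_trans (Ple _) (normc_entry_le _ _).
  have iP n i : rint (fun z => P (F n z i 0) ^+ 2).
    apply: (rint_le _ (L2_rint (LF n))); first exact: measurable_funX.
    by move=> z; rewrite ger0_norm ?sqr_ge0.
  suff H i : exists v : T -> R, [/\ measurable_fun [set: T] v,
      rint (fun z => v z ^+ 2) &
      forall e : R, 0 < e -> exists N, forall n, (N <= n)%N ->
        \int[mu]_z ((P (F n z i 0) - v z) ^+ 2) <= e].
    by have [v hv] := choice H; exists v.
  apply: (@L2_complete_real (fun n z => P (F n z i 0))) => // e e0.
  have [|N hN] := FC (Num.sqrt e); first by rewrite sqrtr_gt0.
  exists N => m n Nm Nn; have := hN m n Nm Nn.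
  have LB : L2 (F m - F n) by apply: lin_closedB (L2_lin_closed k) _ _.
  move=> h2; have {h2} : L2norm (F m - F n) ^+ 2 <= e.
    by rewrite -(sqr_sqrtr (ltW e0)) ler_sqr ?nnegrE ?L2norm_ge0 ?sqrtr_ge0.
  rewrite sqr_L2norm; apply: le_trans; apply: le_Rintegral => //.
  - exact: rint_sqr_B.
  - exact: L2_rint.
  - by move=> z _; rewrite -PB (le_trans _ (Ple2 (F m - F n) z i))// !mxE.
have ReB (x y : C) : complex.Re (x - y) = complex.Re x - complex.Re y.
  by rewrite Re_add Re_opp.
have ImB (x y : C) : complex.Im (x - y) = complex.Im x - complex.Im y.
  by rewrite Im_add Im_opp.
have [a ha] := comp _ (@normr_Re_le R) ReB (fun n i => (mF n i).1).
have [b hb] := comp _ (@normr_Im_le R) ImB (fun n i => (mF n i).2).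
pose G z := \col_i Complex (a i z) (b i z).
have mG : measurable_mx G.
  move=> i j; split; under eq_fun do rewrite mxE /=; first by have [] := ha i.
  by have [] := hb i.
have nE (f : T -> 'cV[C]_k) z : vnorm (f z) ^+ 2 = \sum_i (complex.Re (f z i 0) ^+ 2 + complex.Im (f z i 0) ^+ 2).
  by rewrite sqr_vnorm; apply: eq_bigr => i _; rewrite sqr_normcE.
have LG : L2 G.
  apply/L2P; split => //; under [X in rint X]eq_fun do rewrite nE.
  apply: rint_sum => i; under [X in rint X]eq_fun do rewrite mxE /=.
  by have [_ ? _] := ha i; have [_ ? _] := hb i; exact: rintD.
exists G => // e e0.
(* There are [2 * k] real coordinates, each contributing at most [d]; the successor keeps the
   denominator nonzero when [k = 0]. *)
pose d : R := e ^+ 2 / (2 * k.+1%:R).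
have d0 : 0 < d by rewrite divr_gt0 ?exprn_gt0// mulr_gt0.
have [Na hNa] := choice (fun i => (let: And3 _ _ h := ha i in h) d d0).
have [Nb hNb] := choice (fun i => (let: And3 _ _ h := hb i in h) d d0).
exists (\max_i maxn (Na i) (Nb i))%N => n Nn.
have Nan i : (Na i <= n)%N.
  by apply: leq_trans Nn; apply: leq_trans (leq_bigmax i); exact: leq_maxl.
have Nbn i : (Nb i <= n)%N.
  by apply: leq_trans Nn; apply: leq_trans (leq_bigmax i); exact: leq_maxr.
rewrite -ler_sqr ?nnegrE ?L2norm_ge0 ?(ltW e0)// sqr_L2norm.
have iA i : rint (fun z => (complex.Re (F n z i 0) - a i z) ^+ 2).
  have [? ? _] := ha i; apply: rint_sqr_B => //; first exact: (mF n i).1.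
  apply: (rint_le _ (L2_rint (LF n))); first by apply: measurable_funX; exact: (mF n i).1.
  move=> z; rewrite ger0_norm ?sqr_ge0// nE (bigD1 i)//= -addrA lerDl.
  by rewrite addr_ge0 ?sqr_ge0// sumr_ge0// => j _; rewrite addr_ge0 ?sqr_ge0.
have iB i : rint (fun z => (complex.Im (F n z i 0) - b i z) ^+ 2).
  have [? ? _] := hb i; apply: rint_sqr_B => //; first exact: (mF n i).2.
  apply: (rint_le _ (L2_rint (LF n))); first by apply: measurable_funX; exact: (mF n i).2.
  move=> z; rewrite ger0_norm ?sqr_ge0// nE (bigD1 i)//= -addrA addrCA lerDl.
  by rewrite addr_ge0 ?sqr_ge0// sumr_ge0// => j _; rewrite addr_ge0 ?sqr_ge0.
have -> : \int[mu]_z (vnorm ((F n - G) z) ^+ 2) =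
   \sum_i (\int[mu]_z ((complex.Re (F n z i 0) - a i z) ^+ 2) +
           \int[mu]_z ((complex.Im (F n z i 0) - b i z) ^+ 2)).
  transitivity (\int[mu]_z (\sum_i ((complex.Re (F n z i 0) - a i z) ^+ 2 +
      (complex.Im (F n z i 0) - b i z) ^+ 2))).
    apply: eq_Rintegral => z _; rewrite nE; apply: eq_bigr => i _.
    by rewrite !mxE Re_add Im_add Re_opp Im_opp.
  rewrite Rintegral_sum; last by move=> i; exact: rintD.
  by apply: eq_bigr => i _; rewrite RintegralD//; [exact: iA|exact: iB].
apply: (@le_trans _ _ (\sum_(i < k) (d + d))).
  by apply: ler_sum => i _; apply: lerD; [exact: hNa|exact: hNb].
rewrite sumr_const card_ord -mulr_natr /d.
have -> : (e ^+ 2 / (2 * k.+1%:R) + e ^+ 2 / (2 * k.+1%:R)) * k%:R = e ^+ 2 * (k%:R / k.+1%:R).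
  by field; rewrite nat1r pnatr_eq0.
rewrite ler_piMr ?sqr_ge0// ler_pdivrMr ?ltr0n// mul1r ler_nat.
exact: leqnSn.
Qed.

End Riesz_Fischer.

(** * Essentially bounded matrix functions *)

Section matrix_norm.
Context {R : realType}.
Local Notation C := R[i].
Local Notation T := (circle R).
Local Notation mu := (@arc_length R).

Lemma vnormD k (x y : 'cV[C]_k) : vnorm (x + y) <= vnorm x + vnorm y.
Proof.
have E (z : 'cV[C]_k) : vnorm z ^+ 2 = fsq (@ip R k) z by rewrite /fsq ip_self.
rewrite -ler_sqr ?nnegrE ?addr_ge0 ?vnorm_ge0// E.
rewrite (fsqD (lin_closedT _) (@ip_hermitian R k))// -!E.
have := normr_Re_le (ip x y); have := normc_ip_le x y.
have := ler_norm (complex.Re (ip x y)).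
rewrite sqrrD -[_ *+ 2]mulr_natl => *; lra.
Qed.

Lemma vnorm_sum (I : Type) (r : seq I) k (F : I -> 'cV[C]_k) :
  vnorm (\sum_(i <- r) F i) <= \sum_(i <- r) vnorm (F i).
Proof.
elim: r => [|i r IH]; first by rewrite !big_nil vnorm0.
by rewrite !big_cons (le_trans (vnormD _ _))// lerD2l.
Qed.

Lemma mx_bounded k l (A : 'M[C]_(k, l)) :
  exists M, forall x : 'cV[C]_l, vnorm (A *m x) <= M * vnorm x.
Proof.
exists (\sum_j vnorm (A *m delta_mx j 0)) => x.
rewrite {1}(cV_sum_delta x) mulmx_sumr (le_trans (vnorm_sum _ _))// mulr_suml.
apply: ler_sum => j _; rewrite -scalemxAr vnormZ mulrC.
by rewrite ler_wpM2l ?vnorm_ge0// normc_entry_le.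
Qed.

Lemma mxnorm_has_sup k l (A : 'M[C]_(k, l)) :
  has_sup [set vnorm (A *m x) | x in [set x : 'cV[C]_l | vnorm x <= 1]].
Proof.
split; first by exists (vnorm (A *m 0)); exists 0 => //=; rewrite vnorm0.
have [M hM] := mx_bounded A; exists `|M| => _ [x /= x1 <-].
apply: (le_trans (hM x)); apply: (@le_trans _ _ (`|M| * vnorm x)).
  by rewrite ler_wpM2r ?vnorm_ge0// ler_norm.
by rewrite ler_piMr.
Qed.

Lemma vnorm_mulmx_le k l (A : 'M[C]_(k, l)) x : vnorm (A *m x) <= mxnorm A * vnorm x.
Proof.
have [x0|x0] := eqVneq (vnorm x) 0.
  by rewrite (vnorm_eq0 x0) mulmx0 !vnorm0 mulr0.
have xp : 0 < vnorm x by rewrite lt_def x0 vnorm_ge0.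
pose y := (vnorm x)^-1%:C *: x.
have nc (r : R) : 0 <= r -> normc (r%:C : C) = r.
  by move=> r0; rewrite /= expr0n/= addr0 sqrtr_sqr ger0_norm.
have y1 : vnorm y <= 1.
  by rewrite /y vnormZ nc ?invr_ge0 ?vnorm_ge0// mulVf.
have [_ ub] := mxnorm_has_sup A.
have : vnorm (A *m y) <= mxnorm A by apply: ub_le_sup => //; exists y.
rewrite /y -scalemxAr vnormZ nc ?invr_ge0 ?vnorm_ge0//.
by rewrite mulrC ler_pdivrMr.
Qed.

Lemma mxnorm_le k l (A : 'M[C]_(k, l)) t : 0 <= t ->
  (forall x, vnorm (A *m x) <= t * vnorm x) -> mxnorm A <= t.
Proof.
move=> t0 h; have [ne _] := mxnorm_has_sup A.
apply: ge_sup => // _ [x /= x1 <-].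
by rewrite (le_trans (h x))// ler_piMr.
Qed.

Lemma Linf_norm_leP k l (F : T -> 'M[C]_(k, l)) t : 0 <= t ->
  (Linf_norm F <= t%:E)%E <-> ae_bound F t.
Proof.
move=> t0; split.
  move/ess_supP; apply: filterS => z; rewrite lee_fin => h x.
  by rewrite (le_trans (vnorm_mulmx_le _ _))// ler_wpM2r ?vnorm_ge0.
move=> h; apply/ess_supP; apply: filterS h => z h; rewrite lee_fin.
exact: mxnorm_le.
Qed.

Lemma LinfP k l (F : T -> 'M[C]_(k, l)) :
  Linf F <-> measurable_mx F /\ exists2 M, 0 <= M & ae_bound F M.
Proof.
split => [[mF]|[mF [M M0 FM]]]; last first.
  split => //; have /(Linf_norm_leP _ M0) h := FM.
  by apply: (le_lt_trans h); rewrite ltry.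
move=> Foo; split => //.
have [M FM] : exists M : R, (Linf_norm F <= M%:E)%E.
  case: (Linf_norm F) Foo => [r _||_]//; first by exists r.
  by exists 0; rewrite leNye.
exists `|M| => //; apply/Linf_norm_leP => //; apply: (le_trans FM).
by rewrite lee_fin ler_norm.
Qed.

Lemma ae_bound_eq k l (F G : T -> 'M[C]_(k, l)) M :
  {ae mu, forall z, F z = G z} -> ae_bound F M -> ae_bound G M.
Proof. by move=> FG FM; apply: filterS2 FG FM => z ->. Qed.

Lemma ae_bound_mul k l m (F : T -> 'M[C]_(k, l)) (G : T -> 'M[C]_(l, m)) M N : 0 <= M ->
  ae_bound F M -> ae_bound G N -> ae_bound (fun z => F z *m G z) (M * N).
Proof.
move=> M0 FM GN; apply: filterS2 FM GN => z FM GN x.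
by rewrite -mulmxA (le_trans (FM _))// -mulrA ler_wpM2l.
Qed.

Lemma ae_boundD k l (F G : T -> 'M[C]_(k, l)) M N :
  ae_bound F M -> ae_bound G N -> ae_bound (fun z => F z + G z) (M + N).
Proof.
move=> FM GN; apply: filterS2 FM GN => z FM GN x.
by rewrite mulmxDl mulrDl (le_trans (vnormD _ _))// lerD.
Qed.

(** For [w] the image of [y] under the adjoint, the pairing of [A *m w] with [y] equals
    [vnorm w ^+ 2]. *)
Lemma adj_bound k l (A : 'M[C]_(k, l)) M : 0 <= M ->
  (forall x, vnorm (A *m x) <= M * vnorm x) ->
  forall y, vnorm (A^t* *m y) <= M * vnorm y.
Proof.
move=> M0 AM y; set w := A^t* *m y.
have [w0|w0] := eqVneq (vnorm w) 0; first by rewrite w0 mulr_ge0// vnorm_ge0.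
have wp : 0 < vnorm w by rewrite lt_def w0 vnorm_ge0.
have h : vnorm w ^+ 2 <= vnorm (A *m w) * vnorm y.
  apply: le_trans (normc_ip_le _ _); rewrite ip_mulmx -/w ip_self.
  by rewrite /= expr0n/= addr0 sqrtr_sqr ger0_norm// sqr_ge0.
rewrite -(ler_pM2l wp) -expr2 (le_trans h)// mulrCA mulrA.
by rewrite ler_wpM2r ?vnorm_ge0// AM.
Qed.

Lemma ae_bound_adj k l (F : T -> 'M[C]_(k, l)) M : 0 <= M ->
  ae_bound F M -> ae_bound (fun z => (F z)^t*) M.
Proof. by move=> M0; apply: filterS => z h; exact: adj_bound. Qed.

Lemma vnorm_conj k (x : 'cV[C]_k) : vnorm (map_mx Num.conj x) = vnorm x.
Proof.
congr Num.sqrt; apply: eq_bigr => i _; rewrite mxE !sqr_normcE Re_conjC Im_conjC.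
by rewrite sqrrN.
Qed.

Lemma conjmxK k l (A : 'M[C]_(k, l)) : map_mx Num.conj (map_mx Num.conj A) = A.
Proof. by apply/matrixP => i j; rewrite !mxE conjCK. Qed.

Lemma ae_bound_conj k l (F : T -> 'M[C]_(k, l)) M :
  ae_bound F M -> ae_bound (fun z => map_mx Num.conj (F z)) M.
Proof.
apply: filterS => z h x; rewrite -{1}[x]conjmxK -map_mxM vnorm_conj.
by rewrite (le_trans (h _))// vnorm_conj.
Qed.

Lemma ae_boundT k l (F : T -> 'M[C]_(k, l)) M : 0 <= M ->
  ae_bound F M -> ae_bound (fun z => (F z)^T) M.
Proof.
move=> M0 /(ae_bound_adj M0)/ae_bound_conj; apply: ae_bound_eq.
by apply: aeW => z; apply/matrixP => i j; rewrite !mxE conjCK.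
Qed.

End matrix_norm.

(** * Fourier coefficients and Hardy spaces *)

Section Fourier.
Context {R : realType}.
Local Notation C := R[i].
Local Notation T := (circle R).
Local Notation mu := (@arc_length R).

Definition zb k (j : int) (x : 'cV[C]_k) : T -> 'cV[C]_k := fun z => val z ^ j *: x.

Definition fc k (f : T -> 'cV[C]_k) (j : int) : 'cV[C]_k :=
  \col_i fourier (fun z => f z i 0) j.

Lemma L2_cst k (x : 'cV[C]_k) : L2 (fun _ : T => x).
Proof. by apply: (@L2_bounded _ _ _ (vnorm x)) => //; exact: measurable_mx_cst. Qed.

Lemma L2_zb k j (x : 'cV[C]_k) : L2 (zb j x).
Proof. exact: (L2_shift j (L2_cst x)). Qed.

Lemma fcE k (f : T -> 'cV[C]_k) j i : fc f j i 0 = L2inner f (zb j (delta_mx i 0)).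
Proof.
rewrite mxE L2innerE /fourier; congr cintegral; apply/funext => z.
rewrite ipE (bigD1 i)//= big1 ?addr0; last first.
  by move=> r /negPf ri; rewrite !mxE ri mulr0 rmorph0 mulr0.
by rewrite !mxE !eqxx mulr1 val_expzJ.
Qed.

Lemma sqr_L2normB k (f g : T -> 'cV[C]_k) : L2 f -> L2 g ->
  L2norm (f - g) ^+ 2 = L2norm f ^+ 2 + L2norm g ^+ 2 - 2 * complex.Re (L2inner f g).
Proof.
move=> Lf Lg; have LDk := @L2_lin_closed R k; have Hk := @L2inner_hermitian R k.
rewrite -scaleN1r -!fsq_L2norm (fsqD LDk Hk)//; last exact: lin_closedZ LDk Lg.
rewrite (fsqZ LDk Hk)// (formZr LDk Hk)// normcN normc1 expr1n mul1r.
by rewrite rmorphN rmorph1 mulN1r Re_opp mulrN.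
Qed.

Lemma zb_sum k j (x : 'cV[C]_k) : zb j x = \sum_i x i 0 *: zb j (delta_mx i 0).
Proof.
apply/funext => z; rewrite /zb fct_sumE {1}(cV_sum_delta x) scaler_sumr.
by apply: eq_bigr => i _; rewrite scalerA mulrC -scalerA.
Qed.

Lemma fc_ip k (f : T -> 'cV[C]_k) j x : L2 f -> L2inner f (zb j x) = ip (fc f j) x.
Proof.
move=> Lf; rewrite zb_sum (form_sumr (L2_lin_closed k) (@L2inner_hermitian R k))//; last first.
  by move=> i; apply: lin_closedZ (L2_lin_closed k) _; exact: L2_zb.
rewrite ipE; apply: eq_bigr => i _.
rewrite (formZr (L2_lin_closed k) (@L2inner_hermitian R k))//; last exact: L2_zb.
by rewrite fcE mulrC.
Qed.

Lemma fc_lin k a (f g : T -> 'cV[C]_k) j : L2 f -> L2 g ->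
  fc (a *: f + g) j = a *: fc f j + fc g j.
Proof.
move=> Lf Lg; apply/matrixP => i r; rewrite ord1 fcE.
rewrite (@L2inner_hermitian R k).1//; last exact: L2_zb.
by rewrite [RHS]mxE [X in _ = X + _]mxE !fcE.
Qed.

Lemma fcD k (f g : T -> 'cV[C]_k) j : L2 f -> L2 g -> fc (f + g) j = fc f j + fc g j.
Proof. by move=> Lf Lg; rewrite -[f in LHS]scale1r fc_lin// scale1r. Qed.

Lemma fcB k (f g : T -> 'cV[C]_k) j : L2 f -> L2 g -> fc (f - g) j = fc f j - fc g j.
Proof.
by move=> Lf Lg; rewrite addrC -scaleN1r fc_lin// scaleN1r addrC.
Qed.

Lemma fc_shift k (f : T -> 'cV[C]_k) i j : fc (fun z => val z ^ i *: f z) j = fc f (j - i).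
Proof.
apply/matrixP => r s; rewrite !mxE; congr cintegral; apply/funext => z.
by rewrite mxE mulrAC mulrC -expfzDr ?val_neq0// opprB.
Qed.

Lemma L2inner_zb k i j (x y : 'cV[C]_k) : L2inner (zb i x) (zb j y) = (i == j)%:R * ip x y.
Proof.
rewrite L2innerE.
have -> : (fun z => ip (zb i x z) (zb j y z)) = (fun z : T => ip x y * val z ^ (i - j)).
  apply/funext => z; rewrite !ipE mulr_suml; apply: eq_bigr => r _.
  rewrite !mxE rmorphM/= val_expzJ expfzDr ?val_neq0//; ring.
rewrite cintegralZ; first by rewrite cintegral_expz subr_eq0 mulrC.
apply: (@cint_le _ _ (cst 1)); [exact: cmeas_expz|exact: rint_cst|].
by move=> z; rewrite normc_expz.
Qed.

Lemma ip_eq k (x y : 'cV[C]_k) : (forall w, ip x w = ip y w) -> x = y.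
Proof.
move=> h; apply/matrixP => i j; rewrite ord1.
have E (u : 'cV[C]_k) : ip u (delta_mx i 0) = u i 0.
  rewrite ipE (bigD1 i)//= big1 ?addr0; last first.
    by move=> r /negPf ri; rewrite !mxE ri rmorph0 mulr0.
  by rewrite !mxE !eqxx rmorph1 mulr1.
by have := h (delta_mx i 0); rewrite !E.
Qed.

Lemma fc_zb k i j (x : 'cV[C]_k) : fc (zb i x) j = (i == j)%:R *: x.
Proof.
apply: ip_eq => w; rewrite -fc_ip; last exact: L2_zb.
by rewrite L2inner_zb (formZl (lin_closedT _) (@ip_hermitian R k)).
Qed.

Lemma vnorm_fc_le k (f : T -> 'cV[C]_k) j : L2 f -> vnorm (fc f j) <= L2norm f.
Proof.
move=> Lf; have [w0|w0] := eqVneq (vnorm (fc f j)) 0; first by rewrite w0 L2norm_ge0.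
have wp : 0 < vnorm (fc f j) by rewrite lt_def w0 vnorm_ge0.
have h := L2_Cauchy_Schwarz Lf (L2_zb j (fc f j)).
rewrite fc_ip// ip_self in h.
have E : L2norm (zb j (fc f j)) = vnorm (fc f j).
  rewrite L2norm_shift /L2norm (Rintegral_arc_cst (vnorm (fc f j) ^+ 2)).
  by rewrite sqrtr_sqr ger0_norm ?vnorm_ge0.
rewrite -(ler_pM2r wp) -{3}E; apply: le_trans h.
by rewrite /= expr0n/= addr0 sqrtr_sqr ger0_norm ?sqr_ge0// expr2.
Qed.

Lemma analytic_fcP k (f : T -> 'cV[C]_k) :
  analytic_mx f <-> forall j : int, j < 0 -> fc f j = 0.
Proof.
split => [h j j0|h r s j j0].
  by apply/matrixP => r s; rewrite !mxE; exact: h.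
by have := congr1 (fun A : 'cV[C]_k => A r 0) (h j j0); rewrite !mxE ord1.
Qed.

Lemma fc_ae k (f g : T -> 'cV[C]_k) j : measurable_mx f -> measurable_mx g ->
  {ae mu, forall z, f z = g z} -> fc f j = fc g j.
Proof.
move=> mf mg fg; apply/matrixP => i s; rewrite ord1 !fcE.
by apply: L2inner_ael => //; exact: L2_meas (L2_zb _ _).
Qed.

Lemma sqr_poly_zb k (p : {poly C}) (x : 'cV[C]_k) :
  (fun z : T => (normc p.[val z] ^+ 2)%:C *: x) =
  \sum_(a < size p) \sum_(b < size p) (p`_a * (p`_b)^*) *: zb (a%:Z - b%:Z) x.
Proof.
apply/funext => z; rewrite fct_sumE -mulcJ horner_coef rmorph_sum mulr_suml scaler_suml.
apply: eq_bigr => a _; rewrite fct_sumE mulr_sumr scaler_suml.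
apply: eq_bigr => b _.
transitivity ((p`_a * (p`_b)^* * val z ^ (a%:Z - b%:Z)) *: x); last by rewrite -scalerA.
congr (_ *: _).
by rewrite expfzDr ?val_neq0// rmorphM/= -(val_expzJ z b%:Z) -!exprnP; ring.
Qed.

Lemma L2_sqr_poly k (p : {poly C}) (x : 'cV[C]_k) :
  L2 (fun z : T => (normc p.[val z] ^+ 2)%:C *: x).
Proof.
rewrite sqr_poly_zb; apply: lin_closed_sum (L2_lin_closed k) _ => a.
apply: lin_closed_sum (L2_lin_closed k) _ => b.
by apply: lin_closedZ (L2_lin_closed k) _; exact: L2_zb.
Qed.

(** The frequencies of [|p|^2] are differences [a - b] of exponents of [p], all below [size p], so
    coefficients of [f] from [size p] on are invisible. This is what later allows a truncated series
    to replace the full one without error. *)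
Lemma L2inner_sqr_poly k (f : T -> 'cV[C]_k) (p : {poly C}) (x : 'cV[C]_k) : L2 f ->
  (forall j : int, j < (size p)%:Z -> fc f j = 0) ->
  L2inner f (fun z => (normc p.[val z] ^+ 2)%:C *: x) = 0.
Proof.
move=> Lf f0; rewrite sqr_poly_zb.
have Lz a b : L2 ((p`_a * (p`_b)^*) *: zb (a%:Z - b%:Z) x).
  by apply: lin_closedZ (L2_lin_closed k) _; exact: L2_zb.
rewrite (form_sumr (L2_lin_closed k) (@L2inner_hermitian R k) _ _ Lf); last first.
  by move=> a; apply: lin_closed_sum (L2_lin_closed k) _ => b; exact: Lz.
rewrite big1// => a _.
rewrite (form_sumr (L2_lin_closed k) (@L2inner_hermitian R k) _ (fun b : 'I_(size p) => Lz a b) Lf).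
rewrite big1// => b _.
rewrite (formZr (L2_lin_closed k) (@L2inner_hermitian R k) _ (L2_zb _ _) Lf).
rewrite (fc_ip _ _ Lf) f0 ?(form0l (lin_closedT _) (@ip_hermitian R k)) ?mulr0//.
by rewrite ltrBlDr ltr_wpDr// ltz_nat.
Qed.

(** Vanishing coefficients make every real and imaginary part orthogonal to all [|p|^2]; the
    polynomial test for nonnegativity applies to such a function and to its opposite. *)
Lemma L2_uniqueness k (f : T -> 'cV[C]_k) : L2 f -> (forall j, fc f j = 0) ->
  {ae mu, forall z, f z = 0}.
Proof.
move=> Lf f0.
have key (i : 'I_k) (p : {poly C}) :
    cintegral (fun z : T => (normc p.[val z] ^+ 2)%:C * f z i 0) = 0.
  rewrite -[RHS](@L2inner_sqr_poly _ f p (delta_mx i 0) Lf (fun j _ => f0 j)).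
  rewrite L2innerE; congr cintegral; apply/funext => z.
  rewrite ipE (bigD1 i)//= big1 ?addr0; last first.
    by move=> r /negPf ri; rewrite !mxE ri mulr0 rmorph0 mulr0.
  by rewrite !mxE !eqxx mulr1 conj_real mulrC.
have cf i : cint (fun z => f z i 0).
  rewrite (_ : (fun z => f z i 0) = (fun z => ip (f z) (delta_mx i 0))).
    by apply: cint_ip => //; exact: L2_cst.
  apply/funext => z; rewrite ipE (bigD1 i)//= big1 ?addr0; last first.
    by move=> r /negPf ri; rewrite !mxE ri rmorph0 mulr0.
  by rewrite !mxE !eqxx rmorph1 mulr1.
have zero (u : T -> R) : rint u ->
    (forall p : {poly C}, \int[mu]_z (normc p.[val z] ^+ 2 * u z) = 0) ->
    {ae mu, forall z, u z = 0}.
  move=> iu u0; have h1 : {ae mu, forall z, 0 <= u z} by apply: ae_ge0_of_poly => // p; rewrite u0.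
  have h2 : {ae mu, forall z, 0 <= - u z}.
    apply: ae_ge0_of_poly; first exact: rintN.
    move=> p; under eq_Rintegral do rewrite mulrN -mulN1r.
    rewrite RintegralZl//; first by rewrite u0 mulr0.
    have [M hM] : exists M, forall z : T, normc p.[val z] ^+ 2 <= M.
      exists ((\sum_(i < size p) normc p`_i) ^+ 2) => z.
      rewrite ler_sqr ?nnegrE ?normc_ge0 ?sumr_ge0//; last by move=> *; exact: normc_ge0.
      rewrite horner_coef; elim: (size p) => [|n IH]; first by rewrite !big_ord0 normc0.
      rewrite !big_ord_recr/= (le_trans (le_normcD _ _))// lerD// normcM.
      by rewrite (normc_expz z n) mulr1.
    apply: (@rint_le _ _ (fun z => M * `|u z|)).
    - apply: measurable_funM; last exact: measurable_rint.
      by apply: measurable_sqr_normc; exact: cmeas_poly.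
    - by apply: rintZ; exact: integrable_norm.
    - by move=> z; rewrite normrM ger0_norm ?sqr_ge0// ler_wpM2r.
  by apply: filterS2 h1 h2 => z h1 h2; apply/eqP; rewrite eq_le h1 andbT -oppr_ge0.
have fi0 (i : 'I_k) : {ae mu, forall z, f z i 0 = 0}.
  have [iR iI] := cf i.
  have hR : {ae mu, forall z, complex.Re (f z i 0) = 0}.
    apply: zero => // p; have [+ _] := key i p.
    by move=> <-; apply: eq_Rintegral => z _; exact/esym/Re_scale.
  have hI : {ae mu, forall z, complex.Im (f z i 0) = 0}.
    apply: zero => // p; have [_ +] := key i p.
    by move=> <-; apply: eq_Rintegral => z _; rewrite Im_mul/= mul0r addr0.
  by apply: filterS2 hR hI => z hR hI; exact: complex_eqP.
have : {ae mu, forall z, forall i, f z i 0 = 0} by exact: filter_forall.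
by apply: filterS => z h; apply/matrixP => i j; rewrite ord1 h mxE.
Qed.

Definition psum k (c : nat -> 'cV[C]_k) n : T -> 'cV[C]_k := \sum_(i < n) zb i%:Z (c i).

Lemma L2_psum k (c : nat -> 'cV[C]_k) n : L2 (psum c n).
Proof. by apply: lin_closed_sum (L2_lin_closed k) _ => i; exact: L2_zb. Qed.

Lemma L2inner_psum k (c : nat -> 'cV[C]_k) n (f : T -> 'cV[C]_k) : L2 f ->
  L2inner f (psum c n) = \sum_(i < n) ip (fc f i%:Z) (c i).
Proof.
move=> Lf; rewrite (form_sumr (L2_lin_closed k) (@L2inner_hermitian R k))//; last first.
  by move=> i; exact: L2_zb.
by apply: eq_bigr => i _; rewrite fc_ip.
Qed.

Lemma fc_psum k (c : nat -> 'cV[C]_k) n j :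
  fc (psum c n) j = \sum_(i < n) (i%:Z == j)%:R *: c i.
Proof.
rewrite /psum; elim: n => [|n IH].
  rewrite !big_ord0; apply: ip_eq => w.
  have L0 : L2 (0 : T -> 'cV[C]_k) by case: (@L2_lin_closed R k).
  rewrite -(fc_ip _ _ L0) (form0l (L2_lin_closed k) (@L2inner_hermitian R k)); last exact: L2_zb.
  by rewrite (form0l (lin_closedT _) (@ip_hermitian R k)).
rewrite !big_ord_recr/= fcD ?IH ?fc_zb//; last exact: L2_zb.
exact: (L2_psum c n).
Qed.

Lemma fc_psum_nat k (c : nat -> 'cV[C]_k) n (j : nat) :
  fc (psum c n) j%:Z = if (j < n)%N then c j else 0.
Proof.
rewrite fc_psum; case: ltnP => jn.
  rewrite (bigD1 (Ordinal jn))//= eqxx scale1r big1 ?addr0// => i ij.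
  rewrite eqz_nat; have /negPf -> : (i : nat) != j by apply: contra ij => /eqP ij; apply/eqP/val_inj.
  by rewrite scale0r.
rewrite big1// => i _; rewrite eqz_nat; have /negPf -> : (i : nat) != j.
  by rewrite neq_ltn (leq_trans (ltn_ord i) jn).
by rewrite scale0r.
Qed.

Lemma sqr_L2norm_psum k (c : nat -> 'cV[C]_k) n :
  L2norm (psum c n) ^+ 2 = \sum_(i < n) vnorm (c i) ^+ 2.
Proof.
rewrite -fsq_L2norm /fsq L2inner_psum; last exact: L2_psum.
rewrite Re_sum; apply: eq_bigr => i _; rewrite fc_psum_nat ltn_ord ip_self.
by [].
Qed.

Lemma Bessel k (f : T -> 'cV[C]_k) n : L2 f ->
  \sum_(i < n) vnorm (fc f i%:Z) ^+ 2 <= L2norm f ^+ 2.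
Proof.
move=> Lf; pose P := psum (fun i => fc f i%:Z) n; have LP : L2 P by exact: L2_psum.
have h : complex.Re (L2inner f P) = \sum_(i < n) vnorm (fc f i%:Z) ^+ 2.
  by rewrite L2inner_psum// Re_sum; apply: eq_bigr => i _; rewrite ip_self.
have := sqr_ge0 (L2norm (f - P)); have := sqr_L2normB Lf LP.
have : L2norm P ^+ 2 = \sum_(i < n) vnorm (fc f i%:Z) ^+ 2 by exact: sqr_L2norm_psum.
rewrite h; set a := L2norm (f - P) ^+ 2; set b := L2norm P ^+ 2.
by set d := L2norm f ^+ 2; set s := \sum_(i < n) _; lra.
Qed.

(** Convergence of the partial sums is stated along with the coefficients because pairings with the
    limit are computed through them. *)
Lemma Riesz_Fischer k (c : nat -> 'cV[C]_k) (B : R) :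
  (forall n, \sum_(i < n) vnorm (c i) ^+ 2 <= B) ->
  exists F : T -> 'cV[C]_k, [/\ L2 F,
    (forall e : R, 0 < e -> exists N, forall n, (N <= n)%N -> L2norm (psum c n - F) <= e),
    (forall j : nat, fc F j%:Z = c j) & (forall j : int, j < 0 -> fc F j = 0)].
Proof.
move=> cB.
have cvs : cvgn (fun n => \sum_(i < n) vnorm (c i) ^+ 2).
  apply: nondecreasing_is_cvgn; last by exists B => _ [n _ <-]; exact: cB.
  by apply/nondecreasing_seqP => n; rewrite big_ord_recr/= lerDl sqr_ge0.
have Cau (e : R) : 0 < e -> exists N, forall m n, (N <= m)%N -> (N <= n)%N ->
    L2norm (psum c m - psum c n) <= e.
  move=> e0.
  have dE m n : (n <= m)%N -> L2norm (psum c m - psum c n) ^+ 2 =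
      \sum_(i < m) vnorm (c i) ^+ 2 - \sum_(i < n) vnorm (c i) ^+ 2.
    move=> nm.
    rewrite sqr_L2normB ?sqr_L2norm_psum; [|exact: L2_psum..].
    rewrite L2inner_psum; last exact: L2_psum.
    rewrite Re_sum; set X := \sum_(i < n) complex.Re _.
    suff -> : X = \sum_(i < n) vnorm (c i) ^+ 2 by lra.
    apply: eq_bigr => i _.
    by rewrite fc_psum_nat (leq_trans (ltn_ord i) nm) ip_self.
  have e20 : 0 < e ^+ 2 by rewrite exprn_gt0.
  have /cvg_ex[l /cvgrPdist_lt] := cvs.
  move=> /(_ (e ^+ 2 / 2)) []; first by rewrite divr_gt0.
  move=> N _ hN; exists N => m n Nm Nn.
  have sub (p q : nat) : (N <= p)%N -> (N <= q)%N -> (q <= p)%N ->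
      L2norm (psum c p - psum c q) <= e.
    move=> Np Nq qp; rewrite -ler_sqr ?nnegrE ?L2norm_ge0 ?(ltW e0)// dE//.
    have := hN p Np; have := hN q Nq; rewrite /=.
    by rewrite !ltr_norml => /andP[? ?] /andP[? ?]; lra.
  have [nm|/ltnW mn] := leqP n m; first exact: sub.
  rewrite -opprB -scaleN1r L2normZ ?normcN ?normc1 ?mul1r; first exact: sub.
  by apply: lin_closedB (L2_lin_closed k) _ _; exact: L2_psum.
have [F LF hF] := L2_complete (L2_psum c) Cau.
have fcF j e : 0 < e -> exists N, forall n, (N <= n)%N ->
    vnorm (fc (psum c n) j - fc F j) <= e.
  move=> e0; have [N hN] := hF e e0; exists N => n Nn.
  rewrite -fcB//; last exact: L2_psum.
  apply: le_trans (hN n Nn); apply: vnorm_fc_le.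
  by apply: lin_closedB (L2_lin_closed k) _ _ => //; exact: L2_psum.
have eq0 (x : 'cV[C]_k) : (forall e : R, 0 < e -> vnorm x <= e) -> x = 0.
  move=> h; apply: vnorm_eq0; apply/eqP; rewrite eq_le vnorm_ge0 andbT.
  by apply/ler_addgt0Pr => e e0; rewrite add0r h.
exists F; split => // j => [|j0].
  apply/eqP; rewrite eq_sym -subr_eq0; apply/eqP/eq0 => e e0.
  have [N hN] := fcF j%:Z e e0.
  by have := hN (maxn N j.+1) (leq_maxl _ _); rewrite fc_psum_nat leq_maxr.
rewrite -[LHS]opprK -[RHS]oppr0; congr (- _); apply: eq0 => e e0.
have [N hN] := fcF j e e0.
have := hN N (leqnn _); rewrite fc_psum big1 ?sub0r// => i _.
by case: j j0 {fcF hN} => // n _; rewrite scale0r.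
Qed.

(** By [Riesz_Fischer] and uniqueness, [g] is almost everywhere the L2 limit of the partial sums
    over its nonnegative frequencies, and each of these is orthogonal to [u]. *)
Lemma analytic_orthogonal k (g u : T -> 'cV[C]_k) : L2 g -> L2 u ->
  (forall j : int, j < 0 -> fc g j = 0) -> (forall j : nat, fc u j%:Z = 0) ->
  L2inner g u = 0.
Proof.
move=> Lg Lu g0 u0.
have [F [LF hF Fn Fneg]] := @Riesz_Fischer _ (fun i => fc g i%:Z) _ (fun n => Bessel n Lg).
have FE : {ae mu, forall z, F z = g z}.
  have LFg : L2 (F - g) by exact: lin_closedB (L2_lin_closed k) LF Lg.
  have h : forall j, fc (F - g) j = 0.
    move=> j; rewrite fcB//; case: (lerP 0 j) => j0; last by rewrite g0// Fneg// subrr.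
    by case: j j0 => // n _; rewrite Fn subrr.
  by apply: filterS (L2_uniqueness LFg h) => z /eqP; rewrite subr_eq0 => /eqP.
rewrite -(L2inner_ael (L2_meas LF) (L2_meas Lg) (L2_meas Lu) FE).
apply: eq0_normc; apply/eqP; rewrite eq_le normc_ge0 andbT.
apply/ler_addgt0Pr => e e0; rewrite add0r.
have d0 : 0 < e / (L2norm u + 1) by rewrite divr_gt0// ltr_wpDl// L2norm_ge0.
have [N hN] := hF _ d0.
pose P := psum (fun i => fc g i%:Z) N; have LP : L2 P by exact: L2_psum.
have LFP : L2 (P - F) by exact: lin_closedB (L2_lin_closed k) LP LF.
have Pu : L2inner P u = 0.
  rewrite (@L2inner_hermitian R k).2// L2inner_psum// big1 ?rmorph0// => i _.
  by rewrite u0 (form0l (lin_closedT _) (@ip_hermitian R k)).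
have -> : normc (L2inner F u) = normc (L2inner (P - F) u).
  have -> : L2inner (P - F) u = - L2inner F u; last by rewrite normcN.
  rewrite addrC -scaleN1r (@L2inner_hermitian R k).1// Pu addr0 mulN1r//.
apply: (le_trans (L2_Cauchy_Schwarz LFP Lu)).
apply: (@le_trans _ _ (e / (L2norm u + 1) * L2norm u)).
  by rewrite ler_wpM2r ?L2norm_ge0// hN.
rewrite mulrAC ler_pdivrMr; last by rewrite ltr_wpDl// L2norm_ge0.
by rewrite ler_pM2l// lerDl.
Qed.

Lemma H2P k (f : T -> 'cV[C]_k) : H2 f <-> L2 f /\ forall j : int, j < 0 -> fc f j = 0.
Proof. by split => -[Lf /analytic_fcP]. Qed.

Lemma H2_zb k (j : nat) (x : 'cV[C]_k) : H2 (zb j%:Z x).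
Proof.
apply/H2P; split; first exact: L2_zb.
by move=> i i0; rewrite fc_zb; case: i i0 => // n _; rewrite scale0r.
Qed.

Lemma H2minusP k (f : T -> 'cV[C]_k) : H2minus f <-> L2 f /\ forall j : nat, fc f j%:Z = 0.
Proof.
split => [[Lf h]|[Lf h]]; split => //.
  move=> j; apply: ip_eq => w.
  by rewrite -fc_ip// h ?(form0l (lin_closedT _) (@ip_hermitian R k))//; exact: H2_zb.
move=> g /H2P[Lg g0]; rewrite (@L2inner_hermitian R k).2//.
by rewrite (analytic_orthogonal Lg Lf g0 h) rmorph0.
Qed.

Lemma H2_lin_closed k : lin_closed (@H2 R k).
Proof.
have L0 : L2 (0 : T -> 'cV[C]_k) by case: (@L2_lin_closed R k).
split.
  apply/H2P; split => // j j0.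
  have := fcB j L0 L0; rewrite subrr => E; move: (E); rewrite subrr; exact.
move=> a f g /H2P[Lf f0] /H2P[Lg g0]; apply/H2P; split.
  exact: lin_closedD (L2_lin_closed k) (lin_closedZ a (L2_lin_closed k) Lf) Lg.
by move=> j j0; rewrite fc_lin// f0// g0// scaler0 addr0.
Qed.

(** Analyticity is transferred from entries to the functions [F x] with [x] constant, which lie in
    L2 and so fall under the vector-valued Fourier calculus. *)
Lemma HinfP k l (F : T -> 'M[C]_(k, l)) : Hinf F <->
  [/\ measurable_mx F, exists2 M, 0 <= M & ae_bound F M &
      forall x j, j < 0 -> fc (fun z => F z *m x) j = 0].
Proof.
split => [[/LinfP[mF [M M0 FM]] an]|[mF FM h]].
  split => //; first by exists M.
  move=> x j j0; apply/matrixP => r s; rewrite ord1 [RHS]mxE mxE /fourier.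
  have E z : (F z *m x) r 0 * val z ^ (- j) = \sum_s x s 0 * (F z r s * val z ^ (- j)).
    by rewrite mxE mulr_suml; apply: eq_bigr => t _; ring.
  under [X in cintegral X]eq_fun do rewrite E.
  have ci t : cint (fun z : T => F z r t * val z ^ (- j)).
    have LF : L2 (fun z => F z *m delta_mx t 0).
      by apply: (L2_mulmx mF FM); exact: L2_cst.
    have := cint_ip LF (L2_zb j (delta_mx r 0)).
    congr cint; apply/funext => z; rewrite ipE (bigD1 r)//= big1 ?addr0; last first.
      by move=> u /negPf ri; rewrite !mxE ri mulr0 rmorph0 mulr0.
    rewrite !mxE !eqxx mulr1 val_expzJ; congr (_ * _).
    rewrite (bigD1 t)//= big1 ?addr0; last first.
      by move=> u /negPf ri; rewrite !mxE ri mulr0.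
    by rewrite !mxE !eqxx mulr1.
  have : cint (fun z : T => \sum_s x s 0 * (F z r s * val z ^ (- j))) /\
      cintegral (fun z : T => \sum_s x s 0 * (F z r s * val z ^ (- j))) = 0.
    elim: (index_enum _) => [|t q [IH1 IH2]].
      under [X in cint X]eq_fun do rewrite big_nil.
      under [X in cintegral X]eq_fun do rewrite big_nil.
      split; first by split; exact: rint_cst.
      by rewrite /cintegral !Rintegral_arc_cst.
    under [X in cint X]eq_fun do rewrite big_cons.
    under [X in cintegral X]eq_fun do rewrite big_cons.
    have c1 := cintZ (x t 0) (ci t).
    split; first exact: cintD.
    rewrite cintegralD// IH2 addr0 cintegralZ//.
    by have := an r t j j0; rewrite /fourier => ->; rewrite mulr0.
  by case.
split; first by apply/LinfP.
move=> r s j j0; have := congr1 (fun A : 'cV[C]_k => A r 0) (h (delta_mx s 0) j j0).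
rewrite !mxE => <-; congr cintegral; apply/funext => z; congr (_ * _).
rewrite mxE (bigD1 s)//= big1 ?addr0; last first.
  by move=> u /negPf ri; rewrite !mxE ri mulr0.
by rewrite !mxE !eqxx mulr1.
Qed.

(** By duality: a coefficient of [F f] at [j < 0] pairs [f] with the adjoint of [F] applied to
    [z^j x]. That vector has no nonnegative frequencies, because its pairing with [z^i y] is the
    conjugate of a coefficient of [F y] at [j - i < 0]. *)
Lemma Hinf_H2 k l (F : T -> 'M[C]_(k, l)) (f : T -> 'cV[C]_l) :
  Hinf F -> H2 f -> H2 (fun z => F z *m f z).
Proof.
move=> /HinfP[mF [M M0 FM] Fan] /H2P[Lf f0].
have LFf := L2_mulmx mF FM Lf; apply/H2P; split => // j j0.
apply/matrixP => r s; rewrite ord1 fcE mxE L2inner_mulmx.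
have FaM := ae_bound_adj M0 FM; have mFa := measurable_mx_adj mF.
have Lu := L2_mulmx mFa FaM (L2_zb j (delta_mx r 0)).
apply: analytic_orthogonal => // i; apply: ip_eq => x.
rewrite -fc_ip// (form0l (lin_closedT _) (@ip_hermitian R l))//.
rewrite (@L2inner_hermitian R l).2//; last exact: L2_zb.
rewrite -L2inner_mulmx (_ : (fun z => F z *m zb i%:Z x z) =
  (fun z => val z ^ i%:Z *: (F z *m x))); last first.
  by apply/funext => z; rewrite -scalemxAr.
have LFx : L2 (fun z => F z *m x) by apply: (L2_mulmx mF FM); exact: L2_cst.
rewrite fc_ip; last exact: L2_shift.
rewrite fc_shift Fan ?(form0l (lin_closedT _) (@ip_hermitian R k)) ?rmorph0//.
by rewrite subr_lt0 (lt_le_trans j0).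
Qed.

Lemma Hinf_mul k l m (F : T -> 'M[C]_(k, l)) (G : T -> 'M[C]_(l, m)) :
  Hinf F -> Hinf G -> Hinf (fun z => F z *m G z).
Proof.
move=> HF /HinfP[mG [N N0 GN] Gan]; have /HinfP[mF [M M0 FM] Fan] := HF.
apply/HinfP; split; first exact: measurable_mxM.
  by exists (M * N); [exact: mulr_ge0|exact: ae_bound_mul].
move=> x j j0.
have HGx : H2 (fun z => G z *m x).
  apply/H2P; split; last exact: Gan.
  by apply: (L2_mulmx mG GN); exact: L2_cst.
have /H2P[_ h] := Hinf_H2 HF HGx.
rewrite (_ : (fun z => F z *m G z *m x) = (fun z => F z *m (G z *m x))) ?h//.
by apply/funext => z; rewrite mulmxA.
Qed.

Lemma HinfD k l (F G : T -> 'M[C]_(k, l)) : Hinf F -> Hinf G -> Hinf (fun z => F z + G z).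
Proof.
move=> /HinfP[mF [M M0 FM] Fan] /HinfP[mG [N N0 GN] Gan].
apply/HinfP; split; first exact: measurable_mxD.
  by exists (M + N); [exact: addr_ge0|exact: ae_boundD].
move=> x j j0.
rewrite (_ : (fun z => (F z + G z) *m x) = (fun z => F z *m x) + (fun z => G z *m x)).
  by rewrite fcD ?Fan ?Gan ?addr0//; [apply: (L2_mulmx mF FM)|apply: (L2_mulmx mG GN)]; exact: L2_cst.
by apply/funext => z; rewrite mulmxDl.
Qed.

Lemma HinfT k l (F : T -> 'M[C]_(k, l)) : Hinf F -> Hinf (fun z => (F z)^T).
Proof.
move=> [/LinfP[mF [M M0 FM]] an]; split.
  apply/LinfP; split; first exact: measurable_mxT.
  by exists M => //; exact: ae_boundT.
move=> r s j j0; rewrite -[RHS](an s r j j0); congr cintegral.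
by apply/funext => z; rewrite mxE.
Qed.

Lemma Hinf_ae k l (F G : T -> 'M[C]_(k, l)) : measurable_mx G ->
  {ae mu, forall z, F z = G z} -> Hinf F -> Hinf G.
Proof.
move=> mG FG HF; have /HinfP[mF [M M0 FM] Fan] := HF.
apply/HinfP; split; [exact: mG|exists M; [exact: M0|exact: ae_bound_eq FG FM]|].
move=> x j j0; rewrite -[RHS](Fan x j j0).
apply/esym/fc_ae; [apply: measurable_mxM => //; exact: measurable_mx_cst..|].
by apply: filterS FG => z ->.
Qed.

End Fourier.

(** * The four block operator *)

Section four_block_operator.
Context {R : realType}.
Local Notation C := R[i].
Local Notation T := (circle R).
Local Notation mu := (@arc_length R).

Lemma L20 k : L2 (0 : T -> 'cV[C]_k).
Proof. by case: (@L2_lin_closed R k). Qed.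

Lemma L2Z k a (f : T -> 'cV[C]_k) : L2 f -> L2 (a *: f).
Proof. exact: lin_closedZ (L2_lin_closed k). Qed.

Lemma L2D k (f g : T -> 'cV[C]_k) : L2 f -> L2 g -> L2 (f + g).
Proof. exact: lin_closedD (L2_lin_closed k). Qed.

Lemma L2B k (f g : T -> 'cV[C]_k) : L2 f -> L2 g -> L2 (f - g).
Proof. exact: lin_closedB (L2_lin_closed k). Qed.

Lemma L2innerC k (f g : T -> 'cV[C]_k) : L2 f -> L2 g -> L2inner g f = (L2inner f g)^*.
Proof. by move=> Lf Lg; have [_ h] := @L2inner_hermitian R k; exact: h. Qed.

Lemma L2innerDl k (f g h : T -> 'cV[C]_k) : L2 f -> L2 g -> L2 h ->
  L2inner (f + g) h = L2inner f h + L2inner g h.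
Proof. exact: formDl (@L2inner_hermitian R k) _ _ _. Qed.

Lemma L2innerZl k a (f g : T -> 'cV[C]_k) : L2 f -> L2 g ->
  L2inner (a *: f) g = a * L2inner f g.
Proof. exact: formZl (L2_lin_closed k) (@L2inner_hermitian R k) _ _ _. Qed.

Lemma L2innerBl k (f g h : T -> 'cV[C]_k) : L2 f -> L2 g -> L2 h ->
  L2inner (f - g) h = L2inner f h - L2inner g h.
Proof.
move=> Lf Lg Lh; rewrite -scaleN1r (L2innerDl Lf (L2Z _ Lg) Lh) (L2innerZl _ Lg Lh).
by rewrite mulN1r.
Qed.

Lemma L2inner0l k (f : T -> 'cV[C]_k) : L2 f -> L2inner 0 f = 0.
Proof. exact: form0l (L2_lin_closed k) (@L2inner_hermitian R k) _. Qed.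

Lemma L2inner_self k (f : T -> 'cV[C]_k) : complex.Re (L2inner f f) = L2norm f ^+ 2.
Proof. exact: fsq_L2norm. Qed.

Lemma ip_col k l (a c : 'cV[C]_k) (b d : 'cV[C]_l) :
  ip (col_mx a b) (col_mx c d) = ip a c + ip b d.
Proof. by rewrite /ip tr_col_mx map_row_mx mul_row_col mxE. Qed.

Lemma sqr_vnorm_col k l (a : 'cV[C]_k) (b : 'cV[C]_l) :
  vnorm (col_mx a b) ^+ 2 = vnorm a ^+ 2 + vnorm b ^+ 2.
Proof.
by have := congr1 (@complex.Re R) (ip_self (col_mx a b)); rewrite ip_col !ip_self /= => ->.
Qed.

Lemma vnorm_usubmx_le k l (x : 'cV[C]_(k + l)) : vnorm (usubmx x) <= vnorm x.
Proof.
by rewrite -ler_sqr ?nnegrE ?vnorm_ge0// -{2}[x]vsubmxK sqr_vnorm_col lerDl sqr_ge0.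
Qed.

Lemma measurable_usubmx k l m (F : T -> 'M[C]_(k + l, m)) :
  measurable_mx F -> measurable_mx (fun z => usubmx (F z)).
Proof.
move=> mF; apply/measurable_mxP => i j; have /measurable_mxP h := mF.
by under [X in cmeas X]eq_fun do rewrite mxE; exact: h.
Qed.

Lemma measurable_dsubmx k l m (F : T -> 'M[C]_(k + l, m)) :
  measurable_mx F -> measurable_mx (fun z => dsubmx (F z)).
Proof.
move=> mF; apply/measurable_mxP => i j; have /measurable_mxP h := mF.
by under [X in cmeas X]eq_fun do rewrite mxE; exact: h.
Qed.

Lemma measurable_col_mx k l m (F : T -> 'M[C]_(k, m)) (G : T -> 'M[C]_(l, m)) :
  measurable_mx F -> measurable_mx G -> measurable_mx (fun z => col_mx (F z) (G z)).
Proof.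
move=> mF mG; apply/measurable_mxP => i j; rewrite -(splitK i); case: (fintype.split i) => r /=.
  by under [X in cmeas X]eq_fun do rewrite col_mxEu; exact: mF.
by under [X in cmeas X]eq_fun do rewrite col_mxEd; exact: mG.
Qed.

Lemma measurable_row_mx k l m (F : T -> 'M[C]_(m, k)) (G : T -> 'M[C]_(m, l)) :
  measurable_mx F -> measurable_mx G -> measurable_mx (fun z => row_mx (F z) (G z)).
Proof.
move=> mF mG; apply/measurable_mxP => i j; rewrite -(splitK j); case: (fintype.split j) => r /=.
  by under [X in cmeas X]eq_fun do rewrite row_mxEl; exact: mF.
by under [X in cmeas X]eq_fun do rewrite row_mxEr; exact: mG.
Qed.

Lemma L2_col k l (f : T -> 'cV[C]_k) (g : T -> 'cV[C]_l) :
  L2 f -> L2 g -> L2 (fun z => col_mx (f z) (g z)).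
Proof.
move=> /L2P[mf fi] /L2P[mg gi]; apply/L2P; split; first exact: measurable_col_mx.
by under [X in rint X]eq_fun do rewrite sqr_vnorm_col; exact: rintD.
Qed.

Lemma L2_usubmx k l (f : T -> 'cV[C]_(k + l)) : L2 f -> L2 (fun z => usubmx (f z)).
Proof.
move=> /L2P[mf fi]; have mu := measurable_usubmx mf; apply/L2P; split => //.
apply: rint_le fi _; first exact: measurable_sqr_vnorm.
move=> z; rewrite ger0_norm ?sqr_ge0// ler_sqr ?nnegrE ?vnorm_ge0//.
exact: vnorm_usubmx_le.
Qed.

Lemma L2inner_col k l (f : T -> 'cV[C]_(k + l)) (g : T -> 'cV[C]_(k + l)) :
  L2 (fun z => usubmx (f z)) -> L2 (fun z => dsubmx (f z)) ->
  L2 (fun z => usubmx (g z)) -> L2 (fun z => dsubmx (g z)) ->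
  L2inner f g = L2inner (fun z => usubmx (f z)) (fun z => usubmx (g z))
              + L2inner (fun z => dsubmx (f z)) (fun z => dsubmx (g z)).
Proof.
move=> Luf Ldf Lug Ldg; rewrite !L2innerE -cintegralD; [|exact: cint_ip..].
by congr cintegral; apply/funext => z; rewrite -ip_col !vsubmxK.
Qed.

Lemma fb_dom_L2 n1 n2 (f : T -> 'cV[C]_(n1 + n2)) : fb_dom f -> L2 f.
Proof.
move=> [[Lu _] Ld]; rewrite (_ : f = fun z => col_mx (usubmx (f z)) (dsubmx (f z))).
  exact: L2_col.
by apply/funext => z; rewrite vsubmxK.
Qed.

Lemma fb_cod_L2 n1 n2 (f : T -> 'cV[C]_(n1 + n2)) : fb_cod f -> L2 f.
Proof.
move=> [[Lu _] Ld]; rewrite (_ : f = fun z => col_mx (usubmx (f z)) (dsubmx (f z))).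
  exact: L2_col.
by apply/funext => z; rewrite vsubmxK.
Qed.

(** [orth_proj] is a choice, so a witness must be exhibited: remove from the upper block its
    analytic part, rebuilt from the nonnegative coefficients by Riesz-Fischer. *)
Lemma orth_proj_fb_cod m1 m2 (u : T -> 'cV[C]_(m1 + m2)) :
  L2 (fun z => usubmx (u z)) -> L2 (fun z => dsubmx (u z)) ->
  fb_cod (orth_proj (@fb_cod R m1 m2) u) /\
  forall s, fb_cod s -> L2inner (u - orth_proj (@fb_cod R m1 m2) u) s = 0.
Proof.
move=> Luu Ldu; rewrite /orth_proj; case: xgetP => [y _ [hy1 hy2]//|].
have [F [LF _ Fn Fneg]] := @Riesz_Fischer _ _ (fun i => fc (fun z => usubmx (u z)) i%:Z) _
  (fun n => Bessel n Luu).
pose G z := col_mx (usubmx (u z) - F z) (dsubmx (u z)).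
move=> /(_ G) []; split.
  split; last by under [X in L2 X]eq_fun do rewrite col_mxKd.
  under [X in H2minus X]eq_fun do rewrite col_mxKu.
  apply/H2minusP; split; first exact: L2B.
  by move=> j; rewrite (fcB _ Luu LF) Fn subrr.
have FH : H2 F by apply/H2P.
have E1 : (fun z => usubmx (u z - G z)) = F.
  by apply/funext => z; rewrite linearB/= col_mxKu opprB addrC subrK.
have E2 : (fun z => dsubmx (u z - G z)) = 0.
  by apply/funext => z; rewrite linearB/= col_mxKd subrr.
move=> s [[Lus hs] Lds].
rewrite L2inner_col ?E1 ?E2; [|exact: LF|exact: L20|exact: Lus|exact: Lds].
by rewrite (L2innerC Lus LF) (hs _ FH) rmorph0 add0r (L2inner0l Lds).
Qed.

Definition embed_block m1 m2 n1 n2 (Q : T -> 'M[C]_(m1, n1)) : T -> 'M[C]_(m1 + m2, n1 + n2) :=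
  fun z => block_mx (Q z) 0 0 0.

Lemma mul_embed_block m1 m2 n1 n2 (Q : T -> 'M[C]_(m1, n1)) z (x : 'cV[C]_(n1 + n2)) :
  embed_block m2 n2 Q z *m x = col_mx (Q z *m usubmx x) 0.
Proof. by rewrite -{1}[x]vsubmxK mul_block_col !mul0mx !addr0. Qed.

Lemma measurable_embed_block m1 m2 n1 n2 (Q : T -> 'M[C]_(m1, n1)) :
  measurable_mx Q -> measurable_mx (embed_block m2 n2 Q).
Proof.
move=> mQ; rewrite /embed_block /block_mx.
apply: measurable_col_mx; apply: measurable_row_mx => //; exact: measurable_mx_cst.
Qed.

Lemma ae_bound_embed_block m1 m2 n1 n2 (Q : T -> 'M[C]_(m1, n1)) M : 0 <= M ->
  ae_bound Q M -> ae_bound (embed_block m2 n2 Q) M.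
Proof.
move=> M0; apply: filterS => z h x; rewrite mul_embed_block.
rewrite -ler_sqr ?nnegrE ?vnorm_ge0 ?mulr_ge0 ?vnorm_ge0// sqr_vnorm_col vnorm0 expr0n addr0.
rewrite ler_sqr ?nnegrE ?vnorm_ge0 ?mulr_ge0 ?vnorm_ge0//.
by apply: (le_trans (h _)); rewrite ler_wpM2l// vnorm_usubmx_le.
Qed.

Lemma embed_block_orthogonal m1 m2 n1 n2 (Q : T -> 'M[C]_(m1, n1))
    (f : T -> 'cV[C]_(n1 + n2)) (g : T -> 'cV[C]_(m1 + m2)) :
  Hinf Q -> fb_dom f -> fb_cod g -> L2inner (fun z => embed_block m2 n2 Q z *m f z) g = 0.
Proof.
move=> HQ [Hf Lf] [[Lug hg] Ldg]; have HQf := Hinf_H2 HQ Hf.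
under [X in L2inner X]eq_fun do rewrite mul_embed_block.
have E1 : (fun z => usubmx (col_mx (Q z *m usubmx (f z)) (0 : 'cV[C]_m2))) =
  (fun z => Q z *m usubmx (f z)) by apply/funext => z; rewrite col_mxKu.
have E2 : (fun z => dsubmx (col_mx (Q z *m usubmx (f z)) (0 : 'cV[C]_m2))) = 0.
  by apply/funext => z; rewrite col_mxKd.
have [LQf _] := HQf.
rewrite L2inner_col ?E1 ?E2; [|exact: LQf|exact: L20|exact: Lug|exact: Ldg].
by rewrite (L2innerC Lug LQf) (hg _ HQf) rmorph0 add0r (L2inner0l Ldg).
Qed.

Section operator.
Variables (m1 m2 n1 n2 : nat) (Phi : T -> 'M[C]_(m1 + m2, n1 + n2)) (B : R).
Hypotheses (mPhi : measurable_mx Phi) (PhiB : ae_bound Phi B) (B0 : 0 <= B).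

Lemma Gamma_spec (f : T -> 'cV[C]_(n1 + n2)) : fb_dom f ->
  fb_cod (Gamma Phi f) /\
  forall s, fb_cod s -> L2inner (fun z => Phi z *m f z) s = L2inner (Gamma Phi f) s.
Proof.
move=> /fb_dom_L2 Lf; have LPf := L2_mulmx mPhi PhiB Lf.
have LPu := L2_usubmx LPf.
have LPd : L2 (fun z => dsubmx (Phi z *m f z)).
  apply: (@L2_ae _ _ (fun z => dsubmx (Phi z) *m f z)).
  - by apply: measurable_dsubmx; exact: L2_meas LPf.
  - by apply: aeW => z; rewrite mul_dsub_mx.
  - apply: (L2_mulmx _ _ Lf); first exact: measurable_dsubmx.
    apply: filterS PhiB => z h x; apply: le_trans (h x).
    rewrite mul_dsub_mx -ler_sqr ?nnegrE ?vnorm_ge0//.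
    by rewrite -{2}[Phi z *m x]vsubmxK sqr_vnorm_col lerDr sqr_ge0.
have [h1 h2] := orth_proj_fb_cod LPu LPd; split; first exact: h1.
move=> s cs; have := h2 s cs.
have LG := fb_cod_L2 h1.
by rewrite (L2innerBl LPf LG (fb_cod_L2 cs)) => /eqP; rewrite subr_eq0 => /eqP.
Qed.

(** With [y = Gamma Phi f], the square of its norm is the pairing of [Phi f] with [y], and [Phi] may
    be replaced there by the error function since [Q f_1] is analytic and hence orthogonal to
    [y]. *)
Lemma Gamma_le_bound (Q : T -> 'M[C]_(m1, n1)) M f : 0 <= M -> Hinf Q ->
  ae_bound (fun z => Phi z - embed_block m2 n2 Q z) M -> fb_dom f ->
  L2norm (Gamma Phi f) <= M * L2norm f.
Proof.
move=> M0 HQ AM df; have [cy hy] := Gamma_spec df; set y := Gamma Phi f in cy hy *.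
have Ly := fb_cod_L2 cy; have Lf := fb_dom_L2 df.
have [y0|y0] := eqVneq (L2norm y) 0; first by rewrite y0 mulr_ge0// L2norm_ge0.
have yp : 0 < L2norm y by rewrite lt_def y0 L2norm_ge0.
rewrite -(ler_pM2r yp) -expr2 -L2inner_self -(hy _ cy).
have /HinfP[mQ [N N0 QN] _] := HQ.
have mE := @measurable_embed_block m1 m2 n1 n2 _ mQ.
have EN := @ae_bound_embed_block m1 m2 n1 n2 _ _ N0 QN.
have mA := measurable_mxB mPhi mE.
have LA := L2_mulmx mA AM Lf; have LE := L2_mulmx mE EN Lf.
rewrite (_ : (fun z => Phi z *m f z) = (fun z => (Phi z - embed_block m2 n2 Q z) *m f z)
  + (fun z => embed_block m2 n2 Q z *m f z)); last first.
  apply/funext => z; transitivity ((Phi z - embed_block m2 n2 Q z + embed_block m2 n2 Q z) *m f z).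
    by rewrite subrK.
  by rewrite mulmxDl.
rewrite (L2innerDl LA LE Ly) (embed_block_orthogonal HQ df cy) addr0.
apply: (le_trans (ler_norm _)); apply: (le_trans (normr_Re_le _)).
apply: (le_trans (L2_Cauchy_Schwarz LA Ly)).
by rewrite (ler_pM2r yp) (L2norm_mulmx_le M0 mA AM Lf).
Qed.

Lemma Gamma_norm_le (Q : T -> 'M[C]_(m1, n1)) M : 0 <= M -> Hinf Q ->
  ae_bound (fun z => Phi z - embed_block m2 n2 Q z) M -> (Gamma_norm Phi <= M%:E)%E.
Proof.
move=> M0 HQ AM; apply: ge_ereal_sup => _ [f [df f1] <-]; rewrite lee_fin.
by rewrite (le_trans (Gamma_le_bound M0 HQ AM df))// ler_piMr.
Qed.

Lemma Gamma_form_le t (f : T -> 'cV[C]_(n1 + n2)) (g : T -> 'cV[C]_(m1 + m2)) :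
  Gamma_norm Phi = t%:E -> fb_dom f -> fb_cod g ->
  normc (L2inner (fun z => Phi z *m f z) g) <= t * L2norm f * L2norm g.
Proof.
move=> Gt df cg; have Lf := fb_dom_L2 df; have Lg := fb_cod_L2 cg.
have LPf := L2_mulmx mPhi PhiB Lf.
(* A vector of norm zero cannot be normalized; here the boundedness of [Phi] already forces the
   pairing to vanish. *)
have [f0|f0] := eqVneq (L2norm f) 0.
  rewrite f0 mulr0 mul0r; apply: (le_trans (L2_Cauchy_Schwarz LPf Lg)).
  rewrite -(mul0r (L2norm g)) ler_wpM2r ?L2norm_ge0//.
  by apply: (le_trans (L2norm_mulmx_le B0 mPhi PhiB Lf)); rewrite f0 mulr0.
have fp : 0 < L2norm f by rewrite lt_def f0 L2norm_ge0.
pose a : C := ((L2norm f)^-1)%:C.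
have na : normc a = (L2norm f)^-1.
  by rewrite /a /= expr0n/= addr0 sqrtr_sqr ger0_norm// invr_ge0 ltW.
have daf : fb_dom (a *: f).
  have [Hu Ld] := df; split.
    rewrite (_ : (fun z => _) = a *: (fun z => usubmx (f z))).
      exact: lin_closedZ (@H2_lin_closed R n1) Hu.
    by apply/funext => z; rewrite [LHS]linearZ.
  rewrite (_ : (fun z => _) = a *: (fun z => dsubmx (f z))); first exact: L2Z.
  by apply/funext => z; rewrite [LHS]linearZ.
have [cy hy] := Gamma_spec daf.
have Le : L2norm (Gamma Phi (a *: f)) <= t.
  rewrite -lee_fin -Gt; apply: ereal_sup_ubound; exists (a *: f) => //; split => //.
  by rewrite (L2normZ _ Lf) na mulVf.
have E : L2inner (fun z => Phi z *m (a *: f) z) g = a * L2inner (fun z => Phi z *m f z) g.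
  rewrite -(L2innerZl _ LPf Lg); congr (L2inner _ g); apply/funext => z.
  by rewrite -scalemxAr.
have : normc a * normc (L2inner (fun z => Phi z *m f z) g) <= t * L2norm g.
  rewrite -normcM -E (hy _ cg); apply: (le_trans (L2_Cauchy_Schwarz (fb_cod_L2 cy) Lg)).
  by rewrite ler_wpM2r ?L2norm_ge0.
by rewrite na mulrC ler_pdivrMr// mulrAC.
Qed.

(** The supremum defining each operator norm includes the vector 0. The strict inequality between
    the essential norm and the norm then yields [t0 > 0]. *)
Lemma ess_norm_ge0 : (0 <= Gamma_ess_norm Phi)%E.
Proof.
apply: le_ereal_inf_tmp => _ [K _ <-]; apply: (@le_trans _ _ (L2norm (fun z => Gamma Phi 0 z - K 0 z))%:E).
  by rewrite lee_fin L2norm_ge0.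
apply: ereal_sup_ubound; exists 0 => //; split; last by rewrite L2norm0.
have E1 : (fun z : T => usubmx (0 : 'cV[C]_(n1 + n2))) = 0.
  by apply/funext => z; rewrite linear0.
have E2 : (fun z : T => dsubmx (0 : 'cV[C]_(n1 + n2))) = 0.
  by apply/funext => z; rewrite linear0.
split; last by rewrite [X in L2 X]E2; exact: L20.
by rewrite [X in H2 X]E1; case: (@H2_lin_closed R n1).
Qed.

End operator.

End four_block_operator.

(** * Analytic completion of nonnegative Hermitian functions *)

Section hermitian_extension.
Context {R : realType}.
Local Notation C := R[i].
Local Notation T := (circle R).
Local Notation mu := (@arc_length R).

Lemma Linf_cst k l (A : 'M[C]_(k, l)) : Linf (fun _ : T => A).
Proof.
apply/LinfP; split; first exact: measurable_mx_cst.
have [M hM] := mx_bounded A; exists `|M| => //; apply: aeW => z x.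
by rewrite (le_trans (hM x))// ler_wpM2r ?vnorm_ge0// ler_norm.
Qed.

Lemma LinfD k l (F G : T -> 'M[C]_(k, l)) : Linf F -> Linf G -> Linf (fun z => F z + G z).
Proof.
move=> /LinfP[mF [M M0 FM]] /LinfP[mG [N N0 GN]]; apply/LinfP.
split; first exact: measurable_mxD.
by exists (M + N); [exact: addr_ge0|exact: ae_boundD].
Qed.

Lemma LinfM k l m (F : T -> 'M[C]_(k, l)) (G : T -> 'M[C]_(l, m)) :
  Linf F -> Linf G -> Linf (fun z => F z *m G z).
Proof.
move=> /LinfP[mF [M M0 FM]] /LinfP[mG [N N0 GN]]; apply/LinfP.
split; first exact: measurable_mxM.
by exists (M * N); [exact: mulr_ge0|exact: ae_bound_mul].
Qed.

Lemma Linf_adj k l (F : T -> 'M[C]_(k, l)) : Linf F -> Linf (fun z => (F z)^t*).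
Proof.
move=> /LinfP[mF [M M0 FM]]; apply/LinfP; split; first exact: measurable_mx_adj.
by exists M => //; exact: ae_bound_adj.
Qed.

Lemma Linf_expz k l (j : int) (A : 'M[C]_(k, l)) : Linf (fun z : T => val z ^ j *: A).
Proof.
have /LinfP[mA [M M0 AM]] := Linf_cst A; apply/LinfP; split.
  exact: measurable_mxZ (cmeas_expz j) mA.
exists M; [exact: M0|apply: filterS AM => z h x].
by rewrite -scalemxAl vnormZ normc_expz mul1r.
Qed.

Lemma Linf_L2 k l (F : T -> 'M[C]_(k, l)) (f : T -> 'cV[C]_l) :
  Linf F -> L2 f -> L2 (fun z => F z *m f z).
Proof. by move=> /LinfP[mF [M M0 FM]] Lf; exact: L2_mulmx mF FM Lf. Qed.

Lemma fc_mulmx k l (A : 'M[C]_(k, l)) (f : T -> 'cV[C]_l) j : L2 f ->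
  fc (fun z => A *m f z) j = A *m fc f j.
Proof.
move=> Lf; apply: ip_eq => w; have LAf := Linf_L2 (Linf_cst A) Lf.
rewrite ip_mulmx -(fc_ip _ _ LAf) -(fc_ip _ _ Lf) L2inner_mulmx; congr L2inner.
by apply/funext => z; rewrite /zb -scalemxAr.
Qed.

Lemma L2inner_shift k (j : int) (f g : T -> 'cV[C]_k) :
  L2inner (fun z => val z ^ j *: f z) (fun z => val z ^ j *: g z) = L2inner f g.
Proof. by rewrite !L2innerE; congr cintegral; apply/funext => z; rewrite ip_shift. Qed.

Lemma orthogonal_spectra k (m : int) (g u : T -> 'cV[C]_k) : L2 g -> L2 u ->
  (forall j, j < m -> fc g j = 0) -> (forall j, m <= j -> fc u j = 0) -> L2inner g u = 0.
Proof.
move=> Lg Lu g0 u0; rewrite -(L2inner_shift (- m)); apply: analytic_orthogonal.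
- exact: L2_shift.
- exact: L2_shift.
- by move=> j j0; rewrite fc_shift g0// opprK gtrDr.
- by move=> j; rewrite fc_shift u0// opprK lerDr.
Qed.

Definition qform N (G : T -> 'M[C]_N) (x y : T -> 'cV[C]_N) : C :=
  L2inner (fun z => G z *m x z) y.

Lemma qform_hermitian N (G : T -> 'M[C]_N) : Linf G -> (forall z, (G z)^t* = G z) ->
  hermitian_on (@L2 R N) (qform G).
Proof.
move=> LG Ga; rewrite /qform; split => [a x y w Lx Ly Lw|x y Lx Ly].
  have LGx := Linf_L2 LG Lx; have LGy := Linf_L2 LG Ly.
  rewrite -(L2innerZl _ LGx Lw) -(L2innerDl (L2Z _ LGx) LGy Lw).
  rewrite (_ : (fun z => G z *m (a *: x + y) z) =
    a *: (fun z => G z *m x z) + (fun z => G z *m y z))//.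
  apply/funext => z; transitivity (G z *m (a *: x z + y z)) => //.
  by rewrite mulmxDr -scalemxAr.
have LGx := Linf_L2 LG Lx.
rewrite -(L2innerC LGx Ly) L2inner_mulmx; congr L2inner.
by apply/funext => z; rewrite Ga.
Qed.

Section extension.
Variables (N n m : nat) (E : 'M[C]_(n, N)) (F : 'M[C]_(m, N)).
Hypotheses (EE : E *m E^t* = 1%:M) (FF : F *m F^t* = 1%:M) (EF : E *m F^t* = 0).

Lemma vnorm_coisometry_adj k (P : 'M[C]_(k, N)) y : P *m P^t* = 1%:M ->
  vnorm (P^t* *m y) = vnorm y.
Proof.
move=> PP; have := ip_mulmx (P^t*) y (P^t* *m y).
rewrite adjmxK mulmxA PP mul1mx !ip_self; case=> h.
by rewrite -[LHS]ger0_norm ?vnorm_ge0// -sqrtr_sqr h sqrtr_sqr ger0_norm ?vnorm_ge0.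
Qed.

Lemma coisometry_le k (P : 'M[C]_(k, N)) (x : 'cV[C]_N) : P *m P^t* = 1%:M ->
  vnorm (P *m x) <= vnorm x.
Proof.
move=> PP; rewrite -[leRHS]mul1r -{1}[P]adjmxK; apply: adj_bound => // y.
by rewrite mul1r vnorm_coisometry_adj.
Qed.

Lemma FE0 : F *m E^t* = 0.
Proof. by rewrite -[F]adjmxK -adjmxM EF; apply/matrixP => i j; rewrite !mxE conjC0. Qed.

(** [E] and [F] are coisometries picking mutually orthogonal groups of coordinates: the first has
    frequencies from [a] on, the second below [b]. The other coordinates are unrestricted, which is
    where the L^2 summands will live. *)
Definition spectral (a b : int) : set (T -> 'cV[C]_N) :=
  [set x | [/\ L2 x, forall j, j < a -> E *m fc x j = 0 &
                     forall j, b <= j -> F *m fc x j = 0]].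

Lemma spectral_lin_closed a b : lin_closed (spectral a b).
Proof.
split.
  have h (j : int) : fc (0 : T -> 'cV[C]_N) j = 0.
    by have := fcB j (@L20 R N) (@L20 R N); rewrite !subrr.
  by split; [exact: L20|move=> j _; rewrite h mulmx0..].
move=> c x y [Lx x1 x2] [Ly y1 y2]; split.
- exact: L2D (L2Z _ Lx) Ly.
- by move=> j ja; rewrite fc_lin// mulmxDr -scalemxAr x1// y1// scaler0 addr0.
- by move=> j ja; rewrite fc_lin// mulmxDr -scalemxAr x2// y2// scaler0 addr0.
Qed.

Lemma spectral_sub a b a' b' : a <= a' -> b' <= b -> spectral a' b' `<=` spectral a b.
Proof.
move=> aa bb x [Lx x1 x2]; split => // j h; first by rewrite x1// (lt_le_trans h).
by rewrite x2// (le_trans bb).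
Qed.

Lemma spectral_shift (i a b : int) x : spectral a b x ->
  spectral (a + i) (b + i) (fun z => val z ^ i *: x z).
Proof.
move=> [Lx x1 x2]; split; first exact: L2_shift.
- by move=> j h; rewrite fc_shift x1// ltrBlDr.
- by move=> j h; rewrite fc_shift x2// lerBrDr.
Qed.

Lemma spectral_zbE (a b j : int) (u : 'cV[C]_n) : a <= j -> spectral a b (zb j (E^t* *m u)).
Proof.
move=> aj; split; first exact: L2_zb.
  move=> i ia; rewrite fc_zb (_ : (j == i) = false) ?scale0r ?mulmx0//.
  by rewrite gt_eqF// (lt_le_trans ia).
by move=> i _; rewrite fc_zb -scalemxAr mulmxA FE0 mul0mx scaler0.
Qed.

Lemma spectral_zbF (a b j : int) (u : 'cV[C]_m) : j < b -> spectral a b (zb j (F^t* *m u)).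
Proof.
move=> jb; split; first exact: L2_zb.
  by move=> i _; rewrite fc_zb -scalemxAr mulmxA EF mul0mx scaler0.
move=> i bi; rewrite fc_zb (_ : (j == i) = false) ?scale0r ?mulmx0//.
by rewrite lt_eqF// (lt_le_trans jb).
Qed.

Definition corner (Q : T -> 'M[C]_(m, n)) : T -> 'M[C]_N := fun z => F^t* *m Q z *m E.

Lemma ip_corner Q z (x : 'cV[C]_N) : ip (corner Q z *m x) x = ip (Q z *m (E *m x)) (F *m x).
Proof. by rewrite /corner -!mulmxA -{1}[F^t*]mulmx1 -mulmxA ip_mulmx adjmxK mul1mx. Qed.

Lemma Linf_corner Q : Linf Q -> Linf (corner Q).
Proof. by move=> LQ; apply: LinfM (LinfM _ LQ) _; exact: Linf_cst. Qed.

(** The factor [z^k Y E x] has frequencies at least [k], while [F x] has frequencies at most [k].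
    Only frequency [k] is common, so the new coefficient sees nothing but [E x] at 0 and [F x] at
    [k]. *)
Lemma corner_term (Y : 'M[C]_(m, n)) (k : int) x : spectral 0 (k + 1) x ->
  L2inner (fun z => corner (fun z => val z ^ k *: Y) z *m x z) x =
  ip (Y *m (E *m fc x 0)) (F *m fc x k).
Proof.
move=> [Lx x1 x2].
have LEx := Linf_L2 (Linf_cst E) Lx; have LFx := Linf_L2 (Linf_cst F) Lx.
have LYE := Linf_L2 (Linf_cst Y) LEx.
have Lu := L2_shift k LYE.
set u := (fun z : T => val z ^ k *: (Y *m (E *m x z))) in Lu.
have -> : L2inner (fun z => corner (fun z => val z ^ k *: Y) z *m x z) x =
    L2inner u (fun z => F *m x z).
  rewrite !L2innerE; congr cintegral; apply/funext => z.
  by rewrite ip_corner -scalemxAl.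
have fcu j : fc u j = Y *m (E *m fc x (j - k)).
  by rewrite /u fc_shift (fc_mulmx _ _ LEx) (fc_mulmx _ _ Lx).
set b := F *m fc x k.
have Lb : L2 (zb k b) := L2_zb k b.
have Lr := L2B LFx Lb.
have uE : L2inner u (fun z => F *m x z) = L2inner u (zb k b) +
    L2inner u ((fun z => F *m x z) - zb k b).
  rewrite -(formDr (L2_lin_closed m) (@L2inner_hermitian R m) Lb Lr Lu).
  by rewrite addrC subrK.
rewrite uE (fc_ip _ _ Lu) fcu subrr (orthogonal_spectra (m := k) Lu Lr) ?addr0//.
  by move=> j jk; rewrite fcu x1 ?mulmx0// subr_lt0.
move=> j kj; rewrite (fcB _ LFx Lb) (fc_mulmx _ _ Lx) fc_zb.
have [<-|jk] := eqVneq k j; first by rewrite scale1r subrr.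
by rewrite x2 ?scale0r ?subr0// lezD1 lt_neqAle jk.
Qed.

Variables (A : T -> 'M[C]_N).
Hypotheses (LA : Linf A) (Aa : forall z, (A z)^t* = A z).

Definition mpsum (s : seq 'M[C]_(m, n)) : T -> 'M[C]_(m, n) :=
  fun z => \sum_(i < size s) val z ^ i%:Z *: s`_i.

(** Hermitian by construction, so that a norm bound on [Q] becomes a positivity statement; the
    scalar [r] pays for the accumulated approximation errors. *)
Definition pert (r : R) (Q : T -> 'M[C]_(m, n)) : T -> 'M[C]_N :=
  fun z => A z + (r%:C)%:M + (corner Q z + (corner Q z)^t*).

Lemma Linf_mpsum s : Linf (mpsum s).
Proof.
rewrite /mpsum; elim: (index_enum _) => [|i r IH].
  by under [X in Linf X]eq_fun do rewrite big_nil; exact: Linf_cst.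
under [X in Linf X]eq_fun do rewrite big_cons.
exact: LinfD (Linf_expz _ _) IH.
Qed.

Lemma Linf_pert r Q : Linf Q -> Linf (pert r Q).
Proof.
move=> LQ; have LK := Linf_corner LQ.
by apply: LinfD (LinfD LA (Linf_cst _)) (LinfD LK (Linf_adj LK)).
Qed.

Lemma pert_adj r Q z : (pert r Q z)^t* = pert r Q z.
Proof.
rewrite /pert !linearD/= !map_mxD Aa adjmxK [X in _ + X]addrC; congr (_ + _ + _).
by rewrite tr_scalar_mx map_scalar_mx /= conj_real.
Qed.

Lemma ip_pertE r Q z x : complex.Re (ip (pert r Q z *m x) x) =
  complex.Re (ip (A z *m x) x) + r * vnorm x ^+ 2
  + 2 * complex.Re (ip (Q z *m (E *m x)) (F *m x)).
Proof.
have D (u v : 'cV[C]_N) : ip (u + v) x = ip u x + ip v x.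
  by rewrite /ip mulmxDr mxE.
rewrite /pert mulmxDl (mulmxDl (A z)) (mulmxDl (corner Q z)) !D !Re_add -ip_corner.
congr (_ + _ + _).
  rewrite mul_scalar_mx (formZl (lin_closedT _) (@ip_hermitian R N))// ip_self.
  by rewrite Re_scale.
have -> : ip ((corner Q z)^t* *m x) x = (ip (corner Q z *m x) x)^*.
  have [_ h] := @ip_hermitian R N; rewrite -h// ip_mulmx adjmxK//.
by rewrite Re_conjC; ring.
Qed.

Lemma fsq_pertE r Q x : Linf Q -> L2 x -> fsq (qform (pert r Q)) x =
  fsq (qform A) x + r * L2norm x ^+ 2
  + 2 * complex.Re (L2inner (fun z => corner Q z *m x z) x).
Proof.
move=> LQ Lx; have LKx := Linf_L2 (Linf_corner LQ) Lx; have LAx := Linf_L2 LA Lx.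
have LPx := Linf_L2 (Linf_pert r LQ) Lx.
have [iP _] := cint_ip LPx Lx; have [iK _] := cint_ip LKx Lx; have [iA _] := cint_ip LAx Lx.
rewrite /fsq /qform !L2innerE sqr_L2norm /cintegral /=.
have ix := L2_rint Lx.
rewrite -(RintegralZl _ measurableT ix) -(RintegralZl _ measurableT iK).
rewrite -(RintegralD measurableT iA (rintZ _ ix)).
rewrite -(RintegralD measurableT (rintD iA (rintZ _ ix)) (rintZ _ iK)).
by apply: eq_Rintegral => z _; rewrite ip_pertE ip_corner.
Qed.

(** The space with frequencies from 0 and up to [k] is [spectral 1 k] together with the constants in
    the range of the adjoint of [E] and the multiples of [z^k] in that of [F]. The one-step
    extension with these two finite families provides the matrix [Y]. *)
Lemma extension_step (s : seq 'M[C]_(m, n)) (r del : R) : 0 < del ->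
  (forall x, spectral 0 (size s)%:Z x -> 0 <= fsq (qform (pert r (mpsum s))) x) ->
  exists Y, forall x, spectral 0 (size s).+1%:Z x ->
    0 <= fsq (qform (pert (r + del) (mpsum (rcons s Y)))) x.
Proof.
move=> del0 h; set k := size s in h *; set G := pert r (mpsum s) in h.
have LG : Linf G := Linf_pert _ (Linf_mpsum s).
have HG := qform_hermitian LG (fun z => pert_adj r (mpsum s) z).
pose e (i : 'I_n) : T -> 'cV[C]_N := zb 0 (E^t* *m delta_mx i 0).
pose d (j : 'I_m) : T -> 'cV[C]_N := zb k%:Z (F^t* *m delta_mx j 0).
have SL a b : spectral a b `<=` @L2 R N by move=> x [].
have h1 (a : 'I_n -> C) x : spectral 1 k x -> 0 <= fsq (qform G) (\sum_i a i *: e i + x).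
  move=> Sx; apply: h; apply: lin_closedD (spectral_lin_closed _ _) _ _.
    apply: lin_closed_sum (spectral_lin_closed _ _) _ => i.
    by apply: lin_closedZ (spectral_lin_closed _ _) _; exact: spectral_zbE.
  exact: spectral_sub Sx.
(* Vectors with frequencies from 1 and up to [k] are z times vectors covered by the hypothesis, and
   the form is invariant under multiplication by z. *)
have h2 (b : 'I_m -> C) x : spectral 1 k x -> 0 <= fsq (qform G) (\sum_j b j *: d j + x).
  move=> Sx; set y := _ + x.
  have Sy : spectral 1 (k%:Z + 1) y.
    apply: lin_closedD (spectral_lin_closed _ _) _ _; last first.
      by apply: spectral_sub Sx => //; rewrite lerDl.
    apply: lin_closed_sum (spectral_lin_closed _ _) _ => i.
    apply: lin_closedZ (spectral_lin_closed _ _) _; apply: spectral_zbF.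
    by rewrite ltrDl.
  have := spectral_shift (- 1) Sy; rewrite subrr addrK => /h.
  rewrite /fsq /qform (_ : (fun z => G z *m _) = fun z => val z ^ (- 1) *: (G z *m y z)).
    by rewrite L2inner_shift.
  by apply/funext => z; rewrite -scalemxAr.
(* Half of [del] is enough: the two coefficient vectors of [x] entering the error are each bounded
   by the norm of [x]. *)
have [X hX] := one_step_extension (L2_lin_closed N) HG (spectral_lin_closed 1 k)
  (SL 1 k) (fun i => L2_zb _ _ : L2 (e i)) (fun j => L2_zb _ _ : L2 (d j)) h1 h2 (divr_gt0 del0 (@ltr0Sn R 1)).
pose Y : 'M[C]_(m, n) := \matrix_(j, i) X i j.
exists Y => x Sx; have [Lx x1 x2] := Sx.
pose a := E *m fc x 0; pose b := F *m fc x k.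
have sumE : \sum_i a i 0 *: e i = zb 0 (E^t* *m a).
  apply/funext => z; rewrite fct_sumE /zb {2}(cV_sum_delta a) mulmx_sumr scaler_sumr.
  by apply: eq_bigr => i _; rewrite -scalemxAr scalerA mulrC -scalerA.
have sumF : \sum_j b j 0 *: d j = zb k (F^t* *m b).
  apply/funext => z; rewrite fct_sumE /zb {2}(cV_sum_delta b) mulmx_sumr scaler_sumr.
  by apply: eq_bigr => i _; rewrite -scalemxAr scalerA mulrC -scalerA.
(* Removing the two boundary coefficients leaves a vector of [spectral 1 k], the part on which the
   one-step extension is uniform. *)
pose y := x - (zb 0 (E^t* *m a) + zb k (F^t* *m b)).
have Lzz := L2D (L2_zb 0 (E^t* *m a)) (L2_zb k (F^t* *m b)).
have fcy j : fc y j = fc x j - ((0 == j)%:R *: (E^t* *m a) + (k%:Z == j)%:R *: (F^t* *m b)).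
  by rewrite (fcB _ Lx Lzz) (fcD _ (L2_zb _ _) (L2_zb _ _)) !fc_zb.
have Ey j : E *m fc y j = E *m fc x j - (0 == j)%:R *: a.
  rewrite fcy mulmxBr mulmxDr -!scalemxAr (mulmxA E) EE mul1mx (mulmxA E) EF mul0mx.
  by rewrite scaler0 addr0.
have Fy j : F *m fc y j = F *m fc x j - (k%:Z == j)%:R *: b.
  rewrite fcy mulmxBr mulmxDr -!scalemxAr (mulmxA F) FE0 mul0mx (mulmxA F) FF mul1mx.
  by rewrite scaler0 add0r.
have Sy : spectral 1 k y.
  split; first exact: L2B.
    move=> j j1; rewrite Ey; have [<-|j0] := eqVneq 0 j; first by rewrite scale1r subrr.
    rewrite scale0r subr0 x1// lt_neqAle eq_sym j0/=.
    by rewrite -ltzD1 add0r.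
  move=> j kj; rewrite Fy; have [<-|jk] := eqVneq k%:Z j; first by rewrite scale1r subrr.
  by rewrite scale0r subr0 x2// -addn1 PoszD lezD1 lt_neqAle jk.
have xE : zb 0 (E^t* *m a) + zb k (F^t* *m b) + y = x by rewrite addrC subrK.
have H := hX (fun i => a i 0) (fun j => b j 0) y Sy.
rewrite sumE sumF xE -!sqr_vnorm in H.
have XE : \sum_i \sum_j a i 0 * (b j 0)^* * X i j =
    L2inner (fun z => corner (fun z => val z ^ k%:Z *: Y) z *m x z) x.
  rewrite corner_term; last by rewrite -PoszD addn1.
  rewrite -/a -/b ipE exchange_big; apply: eq_bigr => j _.
  rewrite [(Y *m a) j 0]mxE mulr_suml; apply: eq_bigr => i _.
  by rewrite [Y j i]mxE; ring.
rewrite XE (fsq_pertE r (Linf_mpsum s) Lx) in H.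
rewrite (fsq_pertE (r + del) (Linf_mpsum (rcons s Y)) Lx).
have -> : L2inner (fun z => corner (mpsum (rcons s Y)) z *m x z) x =
    L2inner (fun z => corner (mpsum s) z *m x z) x +
    L2inner (fun z => corner (fun z => val z ^ k%:Z *: Y) z *m x z) x.
  have L1 := Linf_L2 (Linf_corner (Linf_mpsum s)) Lx.
  have L2' := Linf_L2 (Linf_corner (Linf_expz k Y)) Lx.
  rewrite -(L2innerDl L1 L2' Lx); congr (L2inner _ x); apply/funext => z.
  transitivity (corner (mpsum s) z *m x z + corner (fun z => val z ^ k%:Z *: Y) z *m x z) => //.
  rewrite -mulmxDl /corner -mulmxDl -mulmxDr; congr (F^t* *m _ *m E *m x z).
  rewrite /mpsum size_rcons big_ord_recr/= nth_rcons ltnn eqxx; congr (_ + _).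
  by apply: eq_bigr => i _; rewrite nth_rcons ltn_ord.
rewrite Re_add.
have bound l (P : 'M[C]_(l, N)) j : P *m P^t* = 1%:M -> vnorm (P *m fc x j) ^+ 2 <= L2norm x ^+ 2.
  move=> PP; rewrite -(fc_mulmx _ _ Lx) ler_sqr ?nnegrE ?vnorm_ge0 ?L2norm_ge0//.
  apply: (le_trans (vnorm_fc_le _ (Linf_L2 (Linf_cst P) Lx))).
  have b1 : ae_bound (fun _ : T => P) 1 by apply: aeW => z w; rewrite mul1r coisometry_le.
  by have := L2norm_mulmx_le ler01 (measurable_mx_cst P) b1 Lx; rewrite mul1r.
have arith (va vb lx f p1 p2 : R) : va <= lx -> vb <= lx ->
    - (del / 2) * (va + vb) <= f + r * lx + 2 * p1 + 2 * p2 ->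
    0 <= f + (r + del) * lx + 2 * (p1 + p2).
  clear - del0 => ha hb.
  have : del / 2 * (va + vb) <= del / 2 * (lx + lx).
    by rewrite ler_pM2l ?divr_gt0// lerD.
  lra.
exact: arith (bound _ E 0 EE) (bound _ F k FF) H.
Qed.

End extension.

End hermitian_extension.

(** * Exchanging quantifiers over points and vectors *)

Section countable_test.
Context {R : realType}.
Local Notation C := R[i].
Local Notation T := (circle R).
Local Notation mu := (@arc_length R).

Lemma ipZl k (a : C) (x y : 'cV[C]_k) : ip (a *: x) y = a * ip x y.
Proof. by rewrite (formZl (lin_closedT _) (@ip_hermitian R k)). Qed.

Lemma ipZr k (a : C) (x y : 'cV[C]_k) : ip x (a *: y) = a^* * ip x y.
Proof. by rewrite (formZr (lin_closedT _) (@ip_hermitian R k)). Qed.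

Lemma normc_le_ReIm (x : C) : normc x <= `|complex.Re x| + `|complex.Im x|.
Proof.
rewrite -ler_sqr ?nnegrE ?normc_ge0 ?addr_ge0// sqr_normcE sqrrD !real_normK ?num_real//.
by rewrite -addrA lerD2l lerDr mulrn_wge0// mulr_ge0.
Qed.

Lemma rat_approx (x e : R) : 0 < e -> exists q : rat, `|ratr q - x| <= e.
Proof.
move=> e0; have [|q] := @rat_in_itvoo R (x - e) (x + e); first by rewrite ltrD2l gt0_cp.
rewrite in_itv/= => /andP[h1 h2]; exists q.
by rewrite ler_norml; apply/andP; split; lra.
Qed.

Definition ratv k (w : 'cV[rat]_k * 'cV[rat]_k) : 'cV[C]_k :=
  \col_i Complex (ratr (w.1 i 0)) (ratr (w.2 i 0)).

Lemma ratv_dense k (x : 'cV[C]_k) (e : R) : 0 < e -> exists w, vnorm (ratv w - x) <= e.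
Proof.
move=> e0; pose d := e / (2 * (k%:R + 1)).
have k0 : 0 < 2 * (k%:R + 1) :> R by rewrite mulr_gt0// ltr_wpDl.
have d0 : 0 < d by rewrite divr_gt0.
have /choice[f hf] : forall i : 'I_k, exists q, `|ratr q - complex.Re (x i 0)| <= d.
  by move=> i; exact: rat_approx.
have /choice[g hg] : forall i : 'I_k, exists q, `|ratr q - complex.Im (x i 0)| <= d.
  by move=> i; exact: rat_approx.
exists (\col_i f i, \col_i g i); set y := _ - x.
rewrite (cV_sum_delta y) (le_trans (vnorm_sum _ _))//.
apply: (@le_trans _ _ (\sum_(i < k) 2 * d)).
  apply: ler_sum => i _; rewrite vnormZ vnorm_delta mulr1 (le_trans (normc_le_ReIm _))//.
  have -> : y i 0 = Complex (ratr (f i)) (ratr (g i)) - x i 0 by rewrite !mxE.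
  rewrite Re_add Im_add Re_opp Im_opp [complex.Re (Complex _ _)]/= [complex.Im (Complex _ _)]/=.
  by rewrite mulr_natl mulr2n lerD.
rewrite sumr_const card_ord -[_ *+ k]mulr_natr /d.
have -> : 2 * (e / (2 * (k%:R + 1))) * k%:R = e * (k%:R / (k%:R + 1)).
  by field; rewrite gt_eqF// ltr_wpDl.
by rewrite ler_piMr ?(ltW e0)// ler_pdivrMr ?ltr_wpDl// mul1r lerDl.
Qed.

(** The exceptional null set depends on [w]. Vectors with rational coordinates are countable, so one
    null set serves them all, and continuity of the form at a fixed point extends the inequality to
    every vector. *)
Lemma ae_form_ge0 k (G : T -> 'M[C]_k) :
  (forall w, {ae mu, forall z, 0 <= complex.Re (ip (G z *m w) w)}) ->
  {ae mu, forall z, forall w, 0 <= complex.Re (ip (G z *m w) w)}.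
Proof.
move=> h.
have {}h : {ae mu, forall z, forall n, if unpickle n is Some w then
    0 <= complex.Re (ip (G z *m ratv w) (ratv w)) else true}.
  by apply: ae_foralln => n; case: (unpickle n) => [w|]; [exact: h|exact: aeW].
apply: filterS h => z h w.
have {}h v : 0 <= complex.Re (ip (G z *m ratv v) (ratv v)).
  by have := h (pickle v); rewrite pickleK.
have [M hM] := mx_bounded (G z).
(* For a perturbation of size [d <= 1] the form changes by at most [(K - 1) * d]; the summand 1
   keeps [K] positive. *)
pose K := `|M| * (2 * vnorm w + 1) + 1.
have K0 : 0 < K by rewrite ltr_wpDl// mulr_ge0// addr_ge0// mulr_ge0// vnorm_ge0.
apply/ler_addgt0Pr => e e0.
pose d := Num.min 1 (e / K).
have d0 : 0 < d by rewrite lt_min ltr01 divr_gt0.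
have [d1 d2] : d <= 1 /\ d <= e / K by split; rewrite ge_min lexx ?orbT.
have [v hv] := ratv_dense w d0; set x := ratv v in hv *.
apply: le_trans (h v) _; rewrite -/x.
set y := x - w in hv; have xE : x = w + y by rewrite addrC subrK.
have nG u : vnorm (G z *m u) <= `|M| * vnorm u.
  by rewrite (le_trans (hM u))// ler_wpM2r ?vnorm_ge0// ler_norm.
have Re_le a b : complex.Re (ip (G z *m a) b) <= `|M| * vnorm a * vnorm b.
  apply: le_trans (ler_norm _) _; apply: le_trans (normr_Re_le _) _.
  by apply: le_trans (normc_ip_le _ _) _; rewrite ler_wpM2r ?vnorm_ge0.
have E : complex.Re (ip (G z *m x) x) = complex.Re (ip (G z *m w) w) +
    (complex.Re (ip (G z *m w) y) + complex.Re (ip (G z *m y) x)).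
  rewrite {1}xE mulmxDr (formDl (@ip_hermitian R k))// Re_add {1}xE.
  by rewrite (formDr (lin_closedT _) (@ip_hermitian R k))// Re_add addrA.
rewrite E lerD2l.
have xn : vnorm x <= vnorm w + 1.
  by rewrite xE (le_trans (vnormD _ _))// lerD2l (le_trans hv).
apply: (@le_trans _ _ (`|M| * vnorm w * d + `|M| * d * (vnorm w + 1))).
  apply: lerD; first by rewrite (le_trans (Re_le _ _))// ler_wpM2l// mulr_ge0// vnorm_ge0.
  apply: (le_trans (Re_le _ _)); apply: ler_pM; rewrite ?vnorm_ge0 ?mulr_ge0 ?vnorm_ge0//.
  by rewrite ler_wpM2l.
rewrite ler_pdivlMr in d2; last exact: K0.
apply: le_trans d2; rewrite -subr_ge0.
suff -> : d * K - (`|M| * vnorm w * d + `|M| * d * (vnorm w + 1)) = d by exact: ltW.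
by rewrite /K; ring.
Qed.

End countable_test.

(** * The limit of the coefficientwise extensions *)

Section extension_limit.
Context {R : realType}.
Local Notation C := R[i].
Local Notation T := (circle R).
Local Notation mu := (@arc_length R).

Lemma fc0 k j : fc (0 : T -> 'cV[C]_k) j = 0.
Proof. by have := fcB j (@L20 R k) (@L20 R k); rewrite !subrr. Qed.

Lemma fcZ k a (f : T -> 'cV[C]_k) j : L2 f -> fc (a *: f) j = a *: fc f j.
Proof. by move=> Lf; have := fc_lin a j Lf (@L20 R k); rewrite fc0 !addr0. Qed.

Lemma fc_sum (I : Type) (r : seq I) k (f : I -> T -> 'cV[C]_k) j : (forall i, L2 (f i)) ->
  fc (\sum_(i <- r) f i) j = \sum_(i <- r) fc (f i) j.
Proof.
move=> Lf; elim: r => [|i r IH].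
  by rewrite !big_nil fc0.
have Ls : L2 (\sum_(i <- r) f i) by exact: lin_closed_sum (L2_lin_closed k) _.
by rewrite !big_cons (fcD _ (Lf i) Ls) IH.
Qed.

Variables (N n m : nat) (E : 'M[C]_(n, N)) (F : 'M[C]_(m, N)).
Hypotheses (EE : E *m E^t* = 1%:M) (FF : F *m F^t* = 1%:M) (EF : E *m F^t* = 0).
Variables (A : T -> 'M[C]_N).
Hypotheses (LA : Linf A) (Aa : forall z, (A z)^t* = A z).
Hypothesis A0 : forall x, spectral E F 0 0 x -> 0 <= fsq (qform A) x.
Variable e : R.
Hypothesis e0 : 0 < e.

(** The closed form of [e] times the sum of [2^-(i+1)] over [i < k]: it starts at 0, so the initial
    form is unperturbed, and it never exceeds [e]. *)
Let rad k := e * (1 - (2 ^+ k)^-1).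
Let good s := forall x, spectral E F 0 (size s)%:Z x ->
  0 <= fsq (qform (pert E F A (rad (size s)) (mpsum s))) x.

Lemma pert0 z : pert E F A 0 (mpsum [::]) z = A z.
Proof.
rewrite /pert /mpsum /corner big_ord0 mulmx0 mul0mx trmx0 map_mx0 !addr0.
by rewrite rmorph0 addr0.
Qed.

Lemma extension_coefs : exists c : nat -> 'M[C]_(m, n), forall k, good (mkseq c k).
Proof.
(* The next coefficient is chosen for every list at once, with the default 0 for lists that are not
   [good], so that plain iteration produces the sequence. *)
have /choice[Y hY] : forall s, exists Y, good s -> good (rcons s Y).
  move=> s; have [gs|ngs] := pselect (good s); last by exists 0.
  have d0 : 0 < e * (2 ^+ (size s).+1)^-1 by rewrite mulr_gt0// invr_gt0 exprn_gt0.
  have [Y hY] := extension_step EE FF EF LA Aa d0 gs; exists Y => _.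
  rewrite /good size_rcons (_ : rad (size s).+1 = rad (size s) + e * (2 ^+ (size s).+1)^-1)//.
  rewrite /rad exprS; field.
  by rewrite expf_neq0.
pose L k := iter k (fun s => rcons s (Y s)) [::].
exists (fun i => Y (L i)) => k.
have -> : mkseq (fun i => Y (L i)) k = L k.
  elim: k => [//|k IH]; rewrite /mkseq -addn1 iotaD map_cat -/(mkseq _ _) IH /= cats1 add0n.
  by rewrite addn1.
elim: k => [|k]; last exact: hY.
have E0 : pert E F A (rad 0) (mpsum [::]) = A.
  by apply/funext => z; rewrite /rad expr0 invr1 subrr mulr0 pert0.
by move=> x /= /A0; rewrite E0.
Qed.

Lemma mpsum_mkseq (c : nat -> 'M[C]_(m, n)) k z (u : 'cV[C]_n) :
  mpsum (mkseq c k) z *m u = psum (fun i => c i *m u) k z.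
Proof.
rewrite /mpsum size_mkseq mulmx_suml /psum fct_sumE; apply: eq_bigr => i _.
by rewrite nth_mkseq// -scalemxAl.
Qed.

Lemma rad_le k : rad k <= e.
Proof.
rewrite /rad -[leRHS]mulr1 ler_pM2l// lerBlDr lerDl invr_ge0 exprn_ge0.
Qed.

Lemma good_le c k x : good (mkseq c k) -> spectral E F 0 k%:Z x ->
  0 <= fsq (qform A) x + e * L2norm x ^+ 2 +
    2 * complex.Re (L2inner (fun z => corner E F (mpsum (mkseq c k)) z *m x z) x).
Proof.
move=> gs Sx; have [Lx _ _] := Sx; have h := gs x; rewrite size_mkseq in h.
have {}h := h Sx; rewrite (fsq_pertE E F LA (rad k) (Linf_mpsum (mkseq c k)) Lx) in h.
apply: (le_trans h).
by rewrite lerD2r lerD2l ler_wpM2r ?sqr_ge0// rad_le.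
Qed.

Lemma vnorm_EF (u : 'cV[C]_n) (v : 'cV[C]_m) :
  vnorm (E^t* *m u + F^t* *m v) ^+ 2 = vnorm u ^+ 2 + vnorm v ^+ 2.
Proof.
have S (x : 'cV[C]_N) : vnorm x ^+ 2 = fsq (@ip R N) x by rewrite /fsq ip_self.
rewrite S (fsqD (lin_closedT _) (@ip_hermitian R N))// -!S.
rewrite (vnorm_coisometry_adj _ EE) (vnorm_coisometry_adj _ FF).
by rewrite ip_mulmx adjmxK mulmxA EF mul0mx /ip trmx0 map_mx0 mul0mx mxE/= mulr0 addr0.
Qed.

Lemma EEF (u : 'cV[C]_n) (v : 'cV[C]_m) : E *m (E^t* *m u + F^t* *m v) = u.
Proof. by rewrite mulmxDr (mulmxA E) EE mul1mx (mulmxA E) EF mul0mx addr0. Qed.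

Lemma FEF (u : 'cV[C]_n) (v : 'cV[C]_m) : F *m (E^t* *m u + F^t* *m v) = v.
Proof. by rewrite mulmxDr (mulmxA F) (FE0 EF) mul0mx (mulmxA F) FF mul1mx add0r. Qed.

Lemma corner_bound_arith (M a b : R) : 0 < M -> 0 <= M * (a + M^-1 ^+ 2 * b) - 2 * (M^-1 * b) ->
  b <= M ^+ 2 * a.
Proof.
move=> M0; have -> : M * (a + M^-1 ^+ 2 * b) - 2 * (M^-1 * b) = M^-1 * (M ^+ 2 * a - b).
  by field; rewrite gt_eqF.
by rewrite pmulr_rge0 ?invr_gt0// subr_ge0.
Qed.

Lemma normc_inv_real (M : R) : 0 < M -> normc ((- M^-1)%:C : C) = M^-1.
Proof. by move=> M0; rewrite /= expr0n/= addr0 sqrtr_sqr normrN gtr0_norm// invr_gt0. Qed.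

(** With [M = B + e], positivity is tested on the vector with [E]-part [u] and [F]-part
    [- M^-1 * Q u]: the cross term contributes [- 2 * M^-1 * |Q u|^2], the diagonal at most
    [M * (|u|^2 + M^-2 * |Q u|^2)]. *)
Lemma psd_bound B (Az : 'M[C]_N) (Qz : 'M[C]_(m, n)) : 0 <= B ->
  (forall x, vnorm (Az *m x) <= B * vnorm x) ->
  (forall w, 0 <= complex.Re (ip (Az *m w) w) + e * vnorm w ^+ 2
     + 2 * complex.Re (ip (Qz *m (E *m w)) (F *m w))) ->
  forall u, vnorm (Qz *m u) <= (B + e) * vnorm u.
Proof.
move=> B0 AB h u; have M0 : 0 < B + e by rewrite ltr_wpDl.
rewrite -ler_sqr ?nnegrE ?vnorm_ge0 ?mulr_ge0 ?vnorm_ge0 ?(ltW M0)// exprMn.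
apply: corner_bound_arith => //; set M := B + e in M0 *.
pose v := (- M^-1)%:C *: (Qz *m u).
pose w := E^t* *m u + F^t* *m v; have h1 := h w.
have QE : ip (Qz *m (E *m w)) (F *m w) = (- (M^-1 * vnorm (Qz *m u) ^+ 2))%:C.
  rewrite EEF FEF /v ipZr conj_real ip_self.
  by rewrite -rmorphM mulNr.
have wE : vnorm w ^+ 2 = vnorm u ^+ 2 + M^-1 ^+ 2 * vnorm (Qz *m u) ^+ 2.
  by rewrite vnorm_EF vnormZ normc_inv_real// exprMn.
have hA : complex.Re (ip (Az *m w) w) <= B * vnorm w ^+ 2.
  apply: le_trans (ler_norm _) _; apply: le_trans (normr_Re_le _) _.
  apply: le_trans (normc_ip_le _ _) _.
  by rewrite expr2 mulrA ler_wpM2r ?vnorm_ge0.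
rewrite QE [complex.Re _%:C]/= mulrN in h1; apply: le_trans h1 _.
by rewrite -wE lerD2r /M mulrDl lerD2r.
Qed.

(** The test of [psd_bound] in integrated form, with the truncated series [q] in place of [Q u]; its
    frequencies are below [k], so the test vector is admissible at stage [k]. The square-summability
    obtained is what makes the columns of the limit exist before any pointwise bound on them is
    known. *)
Lemma coefs_bound c : (forall k, good (mkseq c k)) ->
  exists M, forall k u, \sum_(i < k) vnorm (c i *m u) ^+ 2 <= M ^+ 2 * vnorm u ^+ 2.
Proof.
move=> gc; have /LinfP[mA [B B0 AB]] := LA.
have M0 : 0 < B + e by rewrite ltr_wpDl.
exists (B + e) => k u; apply: corner_bound_arith => //; set M := B + e in M0 *.
pose q := psum (fun i => c i *m u) k; have Lq : L2 q := L2_psum _ _.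
have qE : L2norm q ^+ 2 = \sum_(i < k) vnorm (c i *m u) ^+ 2 by exact: sqr_L2norm_psum.
pose x : T -> 'cV[C]_N := fun z => E^t* *m u + F^t* *m ((- M^-1)%:C *: q z).
have xE : x = zb 0 (E^t* *m u) +
    (- M^-1)%:C *: \sum_(i < k) zb i%:Z (F^t* *m (c i *m u)).
  apply/funext => z; rewrite /x.
  transitivity (zb 0 (E^t* *m u) z +
    (- M^-1)%:C *: (\sum_(i < k) zb i%:Z (F^t* *m (c i *m u))) z) => //.
  rewrite /zb expr0z scale1r -scalemxAr /q /psum !fct_sumE mulmx_sumr; congr (_ + _ *: _).
  by apply: eq_bigr => i _; rewrite /zb -scalemxAr.
have Sx : spectral E F 0 k%:Z x.
  rewrite xE; apply: lin_closedD (spectral_lin_closed _ _ _ _) _ _.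
    exact: spectral_zbE.
  apply: lin_closedZ (spectral_lin_closed _ _ _ _) _.
  apply: lin_closed_sum (spectral_lin_closed _ _ _ _) _ => i.
  by apply: spectral_zbF => //; rewrite ltz_nat.
have [Lx _ _] := Sx.
have := good_le (gc k) Sx.
have -> : complex.Re (L2inner (fun z => corner E F (mpsum (mkseq c k)) z *m x z) x) =
    - (M^-1 * L2norm q ^+ 2).
  rewrite sqr_L2norm L2innerE /cintegral [LHS]/= -mulNr -(RintegralZl _ measurableT (L2_rint Lq)).
  apply: eq_Rintegral => z _; rewrite ip_corner EEF FEF mpsum_mkseq -/q.
  by rewrite ipZr conj_real ip_self Re_scale.
have xn : L2norm x ^+ 2 = vnorm u ^+ 2 + M^-1 ^+ 2 * L2norm q ^+ 2.
  rewrite !sqr_L2norm -(RintegralZl _ measurableT (L2_rint Lq)).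
  rewrite -{1}[vnorm u ^+ 2]Rintegral_arc_cst.
  rewrite -(RintegralD measurableT (rint_cst _) (rintZ _ (L2_rint Lq))).
  by apply: eq_Rintegral => z _; rewrite vnorm_EF vnormZ normc_inv_real// exprMn.
have hA : fsq (qform A) x <= B * L2norm x ^+ 2.
  apply: le_trans (ler_norm _) _; apply: le_trans (normr_Re_le _) _.
  apply: le_trans (L2_Cauchy_Schwarz (Linf_L2 LA Lx) Lx) _.
  by rewrite expr2 mulrA ler_wpM2r ?L2norm_ge0// (L2norm_mulmx_le B0 mA AB Lx).
move=> h1; apply: le_trans h1 _; rewrite -qE -xn mulrN lerD2r /M mulrDl lerD2r.
exact: hA.
Qed.

Lemma hermitian_extension : exists2 Q : T -> 'M[C]_(m, n), Hinf Q &
  {ae mu, forall z, forall w, 0 <= complex.Re (ip (pert E F A e Q z *m w) w)}.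
Proof.
have [c gc] := extension_coefs; have [M cM] := coefs_bound gc.
have /choice[q hq] : forall j : 'I_n, exists q : T -> 'cV[C]_m, [/\ L2 q,
    (forall i : nat, fc q i%:Z = c i *m delta_mx j 0) & (forall i : int, i < 0 -> fc q i = 0)].
  move=> j; have [q [Lq _ q1 q2]] := @Riesz_Fischer _ _ (fun i => c i *m delta_mx j 0) _
    (fun k => cM k (delta_mx j 0)).
  by exists q.
pose Q (z : T) : 'M[C]_(m, n) := \matrix_(i, j) q j z i 0.
have QE u : (fun z => Q z *m u) = \sum_j u j 0 *: q j.
  apply/funext => z; rewrite fct_sumE; apply/matrixP => i r; rewrite ord1 mxE summxE.
  by apply: eq_bigr => j _; rewrite mxE [RHS]mxE mulrC.
have Lq j : L2 (q j) by have [] := hq j.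
have LuQ u j : L2 (u *: q j) by exact: L2Z.
have LQ u : L2 (fun z => Q z *m u).
  by rewrite QE; apply: lin_closed_sum (L2_lin_closed m) _ => j.
have fcQ u j : fc (fun z => Q z *m u) j = \sum_i u i 0 *: fc (q i) j.
  rewrite QE fc_sum//; apply: eq_bigr => i _.
  exact: fcZ.
have fcQn u (i : nat) : fc (fun z => Q z *m u) i%:Z = c i *m u.
  rewrite fcQ {2}(cV_sum_delta u) mulmx_sumr; apply: eq_bigr => j _.
  by have [_ -> _] := hq j; rewrite -scalemxAr.
have fcQneg u (i : int) : i < 0 -> fc (fun z => Q z *m u) i = 0.
  by move=> i0; rewrite fcQ big1// => j _; have [_ _ ->//] := hq j; rewrite scaler0.
have mQ : measurable_mx Q.
  apply/measurable_mxP => i j; have /L2_meas/measurable_mxP h := Lq j.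
  by under [X in cmeas X]eq_fun do rewrite mxE; exact: h.
have pos : {ae mu, forall z, forall w, 0 <= complex.Re (ip (pert E F A e Q z *m w) w)}.
  apply: ae_form_ge0 => w.
  have LAw := Linf_L2 LA (L2_cst w).
  have LQE := LQ (E *m w).
  have [iA _] := cint_ip LAw (L2_cst w); have [iQ _] := cint_ip LQE (L2_cst (F *m w)).
  pose kap (z : T) := complex.Re (ip (A z *m w) w) + e * vnorm w ^+ 2
     + 2 * complex.Re (ip (Q z *m (E *m w)) (F *m w)).
  have ik : rint kap by apply: rintD; [apply: rintD iA (rint_cst _)|exact: rintZ].
  suff : {ae mu, forall z, 0 <= kap z} by apply: filterS => z; rewrite ip_pertE.
  apply: ae_ge0_of_poly => // p.
  pose x : T -> 'cV[C]_N := fun z => p.[val z] *: w.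
  set k := size p.
  have xE : x = \sum_(a < k) p`_a *: zb a%:Z w.
    apply/funext => z; rewrite /x horner_coef fct_sumE scaler_suml.
    by apply: eq_bigr => a _; rewrite -scalerA.
  (* A polynomial times a constant vector has its frequencies in [[0, size p[], which meets both
     spectral conditions of stage [size p]. *)
  have Sx : spectral E F 0 k%:Z x.
    rewrite xE; apply: lin_closed_sum (spectral_lin_closed _ _ _ _) _ => a.
    apply: lin_closedZ (spectral_lin_closed _ _ _ _) _; split; first exact: L2_zb.
      move=> j j0; rewrite fc_zb (_ : (a%:Z == j) = false) ?scale0r ?mulmx0//.
      by rewrite gt_eqF// (lt_le_trans j0).
    move=> j kj; rewrite fc_zb (_ : (a%:Z == j) = false) ?scale0r ?mulmx0//.
    by rewrite lt_eqF// (lt_le_trans _ kj)// ltz_nat.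
  have [Lx _ _] := Sx.
  have hx := good_le (gc k) Sx.
  pose u (z : T) := (normc p.[val z] ^+ 2)%:C *: (F *m w).
  have Lu : L2 u := L2_sqr_poly p (F *m w).
  pose Qk (z : T) := mpsum (mkseq c k) z *m (E *m w).
  have QkE : Qk = psum (fun i => c i *m (E *m w)) k.
    by apply/funext => z; rewrite /Qk mpsum_mkseq.
  have LQk : L2 Qk by rewrite QkE; exact: L2_psum.
  (* No limit is taken: [Q] and its truncation agree on frequencies below [k = size p], and [|p|^2]
     does not see the others. *)
  have QkQ : L2inner Qk u = L2inner (fun z => Q z *m (E *m w)) u.
    apply/eqP; rewrite -subr_eq0 -(L2innerBl LQk LQE Lu).
    apply/eqP; apply: (@L2inner_sqr_poly _ _ _ p (F *m w) (L2B LQk LQE)) => j jk.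
    rewrite (fcB _ LQk LQE) QkE; case: (lerP 0 j) => j0; last first.
      rewrite fcQneg// subr0 fc_psum big1// => i _.
      by rewrite (_ : (i%:Z == j) = false) ?scale0r// gt_eqF// (lt_le_trans j0).
    case: j j0 jk => // j _; rewrite ltz_nat => jk.
    by rewrite fc_psum_nat jk fcQn subrr.
  move: hx; have -> : L2inner (fun z => corner E F (mpsum (mkseq c k)) z *m x z) x = L2inner Qk u.
    rewrite !L2innerE; congr cintegral; apply/funext => z.
    rewrite ip_corner /x /u /Qk -!scalemxAr.
    by rewrite ipZl !ipZr mulrA mulcJ conj_real.
  rewrite QkQ /fsq /qform sqr_L2norm !L2innerE /cintegral [complex.Re (Complex _ _)]/=.
  rewrite [complex.Re (Complex _ _)]/=.
  have [iAx _] := cint_ip (Linf_L2 LA Lx) Lx; have [iQu _] := cint_ip LQE Lu.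
  rewrite -(RintegralZl _ measurableT (L2_rint Lx)) -(RintegralZl _ measurableT iQu).
  rewrite -(RintegralD measurableT iAx (rintZ _ (L2_rint Lx))).
  rewrite -(RintegralD measurableT (rintD iAx (rintZ _ (L2_rint Lx))) (rintZ _ iQu)).
  congr (0 <= _); apply: eq_Rintegral => z _.
  rewrite /x /u /kap -scalemxAr ipZl !ipZr mulrA mulcJ conj_real !Re_scale.
  rewrite vnormZ exprMn; ring.
(* So far the columns of [Q] are only in L2; essential boundedness now follows from the pointwise
   positivity. *)
exists Q => //; apply/HinfP; split => //; have /LinfP[mA [B B0 AB]] := LA.
exists (B + e); first by rewrite addr_ge0// ltW.
apply: filterS2 AB pos => z AB h u; apply: (psd_bound B0 AB) => w.
by rewrite -ip_pertE.
Qed.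

End extension_limit.

(** * The four block Nehari theorem *)

Section four_block_extension.
Context {R : realType}.
Local Notation C := R[i].
Local Notation T := (circle R).
Local Notation mu := (@arc_length R).

Definition upper_mx k l : 'M[C]_(k, k + l) := row_mx 1%:M 0.
Definition lower_mx k l : 'M[C]_(l, k + l) := row_mx 0 1%:M.

Lemma adj_row_mx k l m (A : 'M[C]_(m, k)) (B : 'M[C]_(m, l)) :
  (row_mx A B)^t* = col_mx (A^t*) (B^t*).
Proof. by rewrite tr_row_mx map_col_mx. Qed.

Lemma adj1 k : (1%:M : 'M[C]_k)^t* = 1%:M.
Proof. by rewrite trmx1 map_mx1. Qed.

Lemma adj0 k l : (0 : 'M[C]_(k, l))^t* = 0.
Proof. by rewrite trmx0 map_mx0. Qed.

Lemma upper_mul k l m (A : 'M[C]_(k + l, m)) : upper_mx k l *m A = usubmx A.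
Proof. by rewrite -{1}[A]vsubmxK mul_row_col mul1mx mul0mx addr0. Qed.

Lemma lower_mul k l m (A : 'M[C]_(k + l, m)) : lower_mx k l *m A = dsubmx A.
Proof. by rewrite -{1}[A]vsubmxK mul_row_col mul1mx mul0mx add0r. Qed.

Lemma upper_coisometry k l : upper_mx k l *m (upper_mx k l)^t* = 1%:M.
Proof. by rewrite upper_mul adj_row_mx adj1 col_mxKu. Qed.

Lemma lower_coisometry k l : lower_mx k l *m (lower_mx k l)^t* = 1%:M.
Proof. by rewrite lower_mul adj_row_mx adj1 col_mxKd. Qed.

Lemma upper_lower k l : upper_mx k l *m (lower_mx k l)^t* = 0.
Proof. by rewrite upper_mul adj_row_mx adj0 col_mxKu. Qed.

(** Applied on [C^n (+) C^m] to the Hermitian function with diagonal [t] and off-diagonal blocks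
    given by [- Phi] and its adjoint. Here [E] and [F] select the first [n1] and the first [m1]
    coordinates of the two summands, so that [spectral E F 0 0] consists of the pairs formed from
    [fb_dom] and [fb_cod]. *)
Lemma four_block_Nehari m1 m2 n1 n2 (Phi : T -> 'M[C]_(m1 + m2, n1 + n2)) t : Linf Phi ->
  0 <= t ->
  (forall f g, fb_dom f -> fb_cod g ->
    normc (L2inner (fun z => Phi z *m f z) g) <= t * L2norm f * L2norm g) ->
  forall e, 0 < e -> exists2 Q : T -> 'M[C]_(m1, n1), Hinf Q &
    ae_bound (fun z => Phi z - embed_block m2 n2 Q z) (t + e).
Proof.
move=> LPhi t0 Phit e e0.
pose n := (n1 + n2)%N; pose m := (m1 + m2)%N.
pose S := upper_mx n m; pose P := lower_mx n m.
pose E : 'M[C]_(n1, n + m) := upper_mx n1 n2 *m S.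
pose F : 'M[C]_(m1, n + m) := upper_mx m1 m2 *m P.
have adjE : E^t* = S^t* *m (upper_mx n1 n2)^t* by rewrite adjmxM.
have adjF : F^t* = P^t* *m (upper_mx m1 m2)^t* by rewrite adjmxM.
have EE : E *m E^t* = 1%:M.
  by rewrite adjE /E mulmxA -(mulmxA _ S) upper_coisometry mulmx1 upper_coisometry.
have FF : F *m F^t* = 1%:M.
  by rewrite adjF /F mulmxA -(mulmxA _ P) lower_coisometry mulmx1 upper_coisometry.
have EF : E *m F^t* = 0.
  by rewrite adjF /E mulmxA -(mulmxA _ S) upper_lower mulmx0 mul0mx.
have L0 : Linf (fun _ : T => (0 : 'M[C]_(n + m))) by exact: Linf_cst.
have LNPhi : Linf (fun z => - Phi z).
  rewrite (_ : (fun z => - Phi z) = fun z => (- 1)%:M *m Phi z).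
    exact: LinfM (Linf_cst _) LPhi.
  by apply/funext => z; rewrite mul_scalar_mx scaleN1r.
(* The base form is itself an instance of [pert], with the full projections [S] and [P], so its
   expansion is already available. *)
pose A := pert S P (fun _ => 0) t (fun z => - Phi z).
have LA : Linf A by exact: Linf_pert.
have Aa z : (A z)^t* = A z by apply: pert_adj => y; rewrite adj0.
have base x : spectral E F 0 0 x -> 0 <= fsq (qform A) x.
  move=> [Lx x1 x2]; rewrite /A (fsq_pertE S P L0 t LNPhi Lx).
  pose f z := S *m x z; pose g z := P *m x z.
  have Lf : L2 f := Linf_L2 (Linf_cst S) Lx; have Lg : L2 g := Linf_L2 (Linf_cst P) Lx.
  have uf : (fun z => usubmx (f z)) = fun z => E *m x z.
    by apply/funext => z; rewrite /E -mulmxA upper_mul.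
  have ug : (fun z => usubmx (g z)) = fun z => F *m x z.
    by apply/funext => z; rewrite /F -mulmxA upper_mul.
  have df : fb_dom f.
    split; last first.
      have := Linf_L2 (Linf_cst (lower_mx n1 n2)) Lf.
      by under [X in L2 X -> _]eq_fun do rewrite lower_mul.
    rewrite uf; apply/H2P; split; first exact: Linf_L2 (Linf_cst E) Lx.
    by move=> j j0; rewrite (fc_mulmx _ _ Lx) x1.
  have cg : fb_cod g.
    split; last first.
      have := Linf_L2 (Linf_cst (lower_mx m1 m2)) Lg.
      by under [X in L2 X -> _]eq_fun do rewrite lower_mul.
    rewrite ug; apply/H2minusP; split; first exact: Linf_L2 (Linf_cst F) Lx.
    by move=> j; rewrite (fc_mulmx _ _ Lx) x2.
  have -> : fsq (qform (fun _ : T => (0 : 'M[C]_(n + m)))) x = 0.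
    rewrite /fsq /qform; under [X in L2inner X]eq_fun do rewrite mul0mx.
    by rewrite (L2inner0l Lx).
  have LPf := Linf_L2 LPhi Lf.
  have -> : complex.Re (L2inner (fun z => corner S P (fun z => - Phi z) z *m x z) x) =
      - complex.Re (L2inner (fun z => Phi z *m f z) g).
    have [iP _] := cint_ip LPf Lg.
    rewrite !L2innerE /cintegral [LHS]/= [X in - X]/= -mulN1r -(RintegralZl _ measurableT iP).
    apply: eq_Rintegral => z _; rewrite ip_corner -/(f z) -/(g z) mulNmx.
    by rewrite -[- (_ *m _)]scaleN1r ipZl -(rmorphN1 (real_complex R)) Re_scale.
  have xn : L2norm x ^+ 2 = L2norm f ^+ 2 + L2norm g ^+ 2.
    rewrite !sqr_L2norm -(RintegralD measurableT (L2_rint Lf) (L2_rint Lg)).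
    apply: eq_Rintegral => z _.
    by rewrite /f /g upper_mul lower_mul -sqr_vnorm_col vsubmxK.
  have h1 := le_trans (ler_norm _) (le_trans (normr_Re_le _) (Phit f g df cg)).
  have := mulr_ge0 t0 (sqr_ge0 (L2norm f - L2norm g)).
  rewrite add0r xn; move: h1; set X := complex.Re _; set a := L2norm f; set b := L2norm g.
  by clear; nra.
have [Q HQ hQ] := hermitian_extension EE FF EF LA Aa base e0.
exists Q => //; apply: filterS hQ => z hz u.
have te : 0 < t + e by rewrite ltr_wpDl.
pose D := - (Phi z - embed_block m2 n2 Q z).
suff : vnorm (D *m u) <= (0 + (t + e)) * vnorm u.
  by rewrite add0r /D mulNmx -scaleN1r vnormZ normcN normc1 mul1r.
(* The whole diagonal is put into the scalar: zero base matrix, [B = 0], and [t + e] in the role of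
   [e]. The corner is now the entire error matrix [D]. *)
apply: (psd_bound (upper_coisometry n m) (lower_coisometry n m) (upper_lower n m) te (lexx 0)
  (Az := 0)) => [x|w]; first by rewrite mul0mx vnorm0 mul0r.
have := hz w; rewrite /A !ip_pertE.
have -> : ip (D *m (S *m w)) (P *m w) = ip (- Phi z *m (S *m w)) (P *m w) +
    ip (Q z *m (E *m w)) (F *m w).
  have DE : D *m (S *m w) = - Phi z *m (S *m w) + col_mx (Q z *m (E *m w)) 0.
    have -> : E *m w = usubmx (S *m w) by rewrite /E -mulmxA upper_mul.
    by rewrite /D opprB addrC mulmxDl mul_embed_block.
  rewrite DE [LHS]/ip mulmxDr mxE; congr (_ + _).
  transitivity (ip (col_mx (Q z *m (E *m w)) 0) (P *m w)) => //.
  have -> : F *m w = usubmx (P *m w) by rewrite /F -mulmxA upper_mul.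
  rewrite -{1}(@vsubmxK _ m1 m2 _ (P *m w)) ip_col.
  by rewrite [X in _ + X]/ip mulmx0 mxE addr0.
rewrite Re_add mulrDr; set p1 := complex.Re _; set p2 := complex.Re _; set v := vnorm w ^+ 2.
by set r := complex.Re _ ; clear; move=> h; lra.
Qed.

(** Outerness approximates a constant [x] by [B f] with [f] in H^2. Then [K x] is close to [K B f],
    which is in H^2, so a coefficient of [K x] at a negative frequency is smaller than any positive
    number. *)
Lemma outer_cancel k l r (K : T -> 'M[C]_(k, l)) (B : T -> 'M[C]_(l, r)) :
  outer B -> Linf K -> Hinf (fun z => K z *m B z) -> Hinf K.
Proof.
move=> [HB dense] LK HKB; have /LinfP[mK [M M0 KM]] := LK.
apply/HinfP; split => //; first by exists M.
move=> x j j0; apply: vnorm_eq0; apply/eqP; rewrite eq_le vnorm_ge0 andbT.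
apply/ler_addgt0Pr => e e0; rewrite add0r.
have d0 : 0 < e / (M + 1) by rewrite divr_gt0// ltr_wpDl.
have [f Hf fe] := dense _ (H2_zb 0 x) _ d0.
have HBf := Hinf_H2 HB Hf; have [LBf _] := HBf.
have xE : zb 0%:Z x = fun _ => x by apply/funext => z; rewrite /zb expr0z scale1r.
rewrite xE in fe.
have Lx : L2 (fun _ : T => x) := L2_cst x.
have LKBf := Linf_L2 LK LBf; have LKx := Linf_L2 LK Lx.
have LBx := L2B LBf Lx.
have f0 : fc (fun z => K z *m (B z *m f z)) j = 0.
  have /H2P[_ h] := Hinf_H2 HKB Hf.
  rewrite -[RHS](h j j0); congr (fc _ j); apply/funext => z; exact: mulmxA.
have -> : vnorm (fc (fun z => K z *m x) j) =
    vnorm (fc ((fun z => K z *m (B z *m f z)) - (fun z => K z *m x)) j).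
  by rewrite (fcB _ LKBf LKx) f0 sub0r -scaleN1r vnormZ normcN normc1 mul1r.
apply: (le_trans (vnorm_fc_le _ (L2B LKBf LKx))).
have := L2norm_mulmx_le M0 mK KM LBx.
rewrite (_ : (fun z => K z *m _) = (fun z => K z *m (B z *m f z)) - (fun z => K z *m x)); last first.
  apply/funext => z; transitivity (K z *m (B z *m f z - x)) => //.
  by rewrite mulmxBr.
move=> h; apply: (le_trans h).
apply: (@le_trans _ _ (M * (e / (M + 1)))); first by rewrite ler_wpM2l// ltW.
rewrite mulrCA ler_piMr ?(ltW e0)// ler_pdivrMr ?ltr_wpDl// mul1r lerDl//.
Qed.

(** Let [u] be the indicator of the zero set. Every [phi f] vanishes there, so its distance to the
    constant 1 is at least the norm of [u]; density makes that norm zero. *)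
Lemma outer_neq0 (phi : T -> C) : outer (scal phi) -> {ae mu, forall z, phi z != 0}.
Proof.
move=> [[Lphi _] dense]; have /LinfP[mphi _] := Lphi.
have mp : cmeas phi.
  have /measurable_mxP h := mphi; have := h 0 0.
  by rewrite (_ : (fun z => scal phi z 0 0) = phi)//; apply/funext => z; rewrite mxE eqxx mulr1n.
pose u (z : T) : 'cV[C]_1 := (phi z == 0)%:R%:M.
have mu : measurable_mx u.
  apply/measurable_mxP => i j.
  rewrite (_ : (fun z => u z i j) = fun z => (\1_(phi @^-1` [set 0]) z : R)%:C).
    split; last by [].
    apply: measurable_indic; have [mR mI] := mp.
    rewrite (_ : _ @^-1` _ = ((fun z => complex.Re (phi z)) @^-1` [set 0]) `&`
       ((fun z => complex.Im (phi z)) @^-1` [set 0])).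
      by apply: measurableI; [rewrite -[X in measurable X]setTI; apply: mR|
        rewrite -[X in measurable X]setTI; apply: mI].
    apply/seteqP; split => z /=; first by move=> ->.
    by move=> [h1 h2]; exact: complex_eqP.
  apply/funext => z; rewrite !ord1 mxE eqxx mulr1n indicE.
  by case: eqVneq => [h|/eqP h]; [rewrite mem_set|rewrite memNset].
have Lu : L2 u.
  apply: (@L2_bounded _ _ _ 1) => // z; rewrite /u /vnorm big_ord1 mxE eqxx mulr1n.
  by case: eqP => _; rewrite ?normc1 ?normc0 ?expr1n ?expr0n ?sqrtr1 ?sqrtr0.
have Lo : L2 (fun _ : T => (1%:M : 'cV[C]_1)) by exact: L2_cst.
have o1 : (fun _ : T => (1%:M : 'cV[C]_1)) = zb 0%:Z 1%:M.
  by apply/funext => z; rewrite /zb expr0z scale1r.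
have uu : L2inner (fun _ => 1%:M) u = L2inner u u.
  rewrite !L2innerE; congr cintegral; apply/funext => z; rewrite /u !ipE !big_ord1 !mxE eqxx !mulr1n.
  by case: eqP => _; rewrite ?mul1r// rmorph0 !mulr0.
have u0 : L2norm u = 0.
  apply/eqP; rewrite eq_le L2norm_ge0 andbT; apply/ler_addgt0Pr => e e0; rewrite add0r.
  have H1 : H2 (fun _ : T => (1%:M : 'cV[C]_1)) by rewrite o1; exact: H2_zb.
  have [f [Lf _] fe] := dense _ H1 _ e0.
  have [->|un0] := eqVneq (L2norm u) 0; first exact: ltW.
  have up : 0 < L2norm u by rewrite lt_def un0 L2norm_ge0.
  have Lpf : L2 (fun z => scal phi z *m f z).
    exact: Linf_L2 Lphi Lf.
  have Lr := L2B Lpf Lo.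
  have z0 : L2inner (fun z => scal phi z *m f z) u = 0.
    rewrite L2innerE (_ : (fun z => _) = fun=> 0).
      by rewrite /cintegral !Rintegral_arc_cst.
    apply/funext => z; rewrite ipE big_ord1 /u /scal mul_scalar_mx !mxE eqxx mulr1n.
    by case: eqP => [->|_]; rewrite ?mul0r ?rmorph0 ?mulr0.
  have E : L2inner ((fun z => scal phi z *m f z) - (fun _ => 1%:M)) u = - L2inner u u.
    by rewrite (L2innerBl Lpf Lo Lu) uu z0 sub0r.
  have h := L2_Cauchy_Schwarz Lr Lu; rewrite E normcN in h.
  rewrite -(ler_pM2r up) -expr2 -L2inner_self.
  apply: le_trans (ler_norm _) _; apply: le_trans (normr_Re_le _) _.
  by apply: le_trans h _; rewrite (ler_pM2r up); exact: ltW fe.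
apply: filterS (L2norm_eq0 Lu u0) => z uz; apply/eqP => pz.
have := congr1 (fun A : 'cV[C]_1 => A 0 0) uz.
by rewrite /u pz eqxx mxE [RHS]mxE eqxx mulr1n => /eqP; rewrite oner_eq0.
Qed.

End four_block_extension.

(** * Maximizing vectors and the parametrization *)

Section superoptimal_step.
Context {R : realType}.
Local Notation C := R[i].
Local Notation T := (circle R).
Local Notation mu := (@arc_length R).

Lemma fb_blockB m1 m2 n1 n2 (F11 Q : T -> 'M[C]_(m1, n1)) (F12 : T -> 'M[C]_(m1, n2))
    (F21 : T -> 'M[C]_(m2, n1)) (F22 : T -> 'M[C]_(m2, n2)) :
  fb_block (fun z => F11 z - Q z) F12 F21 F22 =
  fun z => fb_block F11 F12 F21 F22 z - embed_block m2 n2 Q z.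
Proof.
by apply/funext => z; rewrite /fb_block /embed_block opp_block_mx add_block_mx !oppr0 !addr0.
Qed.

Lemma Linf_conj k l (F : T -> 'M[C]_(k, l)) : Linf F -> Linf (fun z => map_mx Num.conj (F z)).
Proof.
move=> /LinfP[mF [M M0 FM]]; apply/LinfP; split; first exact: measurable_mxJ.
by exists M; [exact: M0|exact: ae_bound_conj].
Qed.

Lemma Linf_embed_block m1 m2 n1 n2 (Q : T -> 'M[C]_(m1, n1)) :
  Linf Q -> Linf (@embed_block R m1 m2 n1 n2 Q).
Proof.
move=> /LinfP[mQ [M M0 QM]]; apply/LinfP; split; first exact: measurable_embed_block.
by exists M; [exact: M0|exact: ae_bound_embed_block].
Qed.

Lemma LinfB k l (F G : T -> 'M[C]_(k, l)) : Linf F -> Linf G -> Linf (fun z => F z - G z).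
Proof.
move=> LF LG; rewrite (_ : (fun z => _) = fun z => F z + (- 1)%:M *m G z).
  exact: LinfD LF (LinfM (Linf_cst _) LG).
by apply/funext => z; rewrite mul_scalar_mx scaleN1r.
Qed.

Lemma Hinf_cst k l (A : 'M[C]_(k, l)) : Hinf (fun _ : T => A).
Proof.
have /LinfP[mA bA] := Linf_cst A; apply/HinfP; split => // x j j0.
have -> : (fun _ : T => A *m x) = zb 0 (A *m x).
  by apply/funext => z; rewrite /zb expr0z scale1r.
by rewrite fc_zb gt_eqF// scale0r.
Qed.

Lemma HinfB k l (F G : T -> 'M[C]_(k, l)) : Hinf F -> Hinf G -> Hinf (fun z => F z - G z).
Proof.
move=> HF HG; rewrite (_ : (fun z => _) = fun z => F z + (- 1)%:M *m G z).
  exact: HinfD HF (Hinf_mul (Hinf_cst _) HG).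
by apply/funext => z; rewrite mul_scalar_mx scaleN1r.
Qed.

(** Let [A] be the error and [y = Gamma Phi f]. The pairing of [A f] with [y] is exactly [|y|^2],
    while [|A f| <= t |f| = |y|]; expanding the square of the distance gives [A f = y]. The same
    expansion, with the adjoint and [t^2 f], gives the second identity. *)
Lemma extremal_identities m1 m2 n1 n2 (Phi : T -> 'M[C]_(m1 + m2, n1 + n2)) t
    (Q : T -> 'M[C]_(m1, n1)) f : Linf Phi -> 0 <= t -> Hinf Q ->
  ae_bound (fun z => Phi z - embed_block m2 n2 Q z) t -> fb_dom f ->
  L2norm (Gamma Phi f) = t * L2norm f ->
  {ae mu, forall z, (Phi z - embed_block m2 n2 Q z) *m f z = Gamma Phi f z} /\
  {ae mu, forall z, (Phi z - embed_block m2 n2 Q z)^t* *m Gamma Phi f z = (t ^+ 2)%:C *: f z}.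
Proof.
move=> LPhi t0 HQ At df; have /LinfP[mPhi [B B0 PB]] := LPhi; move=> yn.
have [cy hy] := Gamma_spec mPhi PB df; set y := Gamma Phi f in cy hy yn *.
have Ly := fb_cod_L2 cy; have Lf := fb_dom_L2 df; have [LQ _] := HQ.
have LE : Linf (@embed_block R m1 m2 n1 n2 Q) by exact: Linf_embed_block.
set A := fun z => Phi z - embed_block m2 n2 Q z in At *.
have LA : Linf A by exact: LinfB.
have LAf := Linf_L2 LA Lf; have LAy := Linf_L2 (Linf_adj LA) Ly.
have LPf := Linf_L2 LPhi Lf; have LEf := Linf_L2 LE Lf.
have mA : measurable_mx A by case/LinfP: LA.
have Afy : L2inner (fun z => A z *m f z) y = L2inner y y.
  transitivity (L2inner (fun z => Phi z *m f z) y -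
    L2inner (fun z => embed_block m2 n2 Q z *m f z) y); last first.
    by rewrite (embed_block_orthogonal HQ df cy) subr0 (hy y cy).
  rewrite -(L2innerBl LPf LEf Ly).
  congr (L2inner _ y); apply/funext => z.
  transitivity (Phi z *m f z - embed_block m2 n2 Q z *m f z) => //.
  by rewrite -mulmxBl.
have nAf : L2norm (fun z => A z *m f z) <= t * L2norm f by exact: L2norm_mulmx_le.
have nAy : L2norm (fun z => (A z)^t* *m y z) <= t * L2norm y.
  by apply: L2norm_mulmx_le => //; [exact: measurable_mx_adj|exact: ae_bound_adj].
have zero k (u : T -> 'cV[C]_k) : L2 u -> L2norm u ^+ 2 <= 0 -> {ae mu, forall z, u z = 0}.
  move=> Lu u0; apply: L2norm_eq0 => //; apply/eqP.
  by rewrite -sqrf_eq0 eq_le u0 sqr_ge0.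
have sqle a b : 0 <= a -> a <= b -> a ^+ 2 <= b ^+ 2 :> R.
  by move=> a0 ab; rewrite ler_sqr ?nnegrE// (le_trans a0).
split.
  have /(zero _ _ (L2B LAf Ly)) : L2norm ((fun z => A z *m f z) - y) ^+ 2 <= 0.
    rewrite (sqr_L2normB LAf Ly) Afy L2inner_self yn.
    move: (sqle _ _ (L2norm_ge0 _) nAf); set u := _ ^+ 2; set v := (t * _) ^+ 2.
    by clear; lra.
  by apply: filterS => z /eqP; rewrite subr_eq0 => /eqP.
have Ltf := L2Z (t ^+ 2)%:C Lf.
have /(zero _ _ (L2B LAy Ltf)) : L2norm ((fun z => (A z)^t* *m y z) - (t ^+ 2)%:C *: f) ^+ 2 <= 0.
  rewrite (sqr_L2normB LAy Ltf) (L2normZ _ Lf).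
  have -> : normc ((t ^+ 2)%:C : C) = t ^+ 2.
    by rewrite /= expr0n/= addr0 sqrtr_sqr ger0_norm// sqr_ge0.
  have -> : L2inner (fun z => (A z)^t* *m y z) ((t ^+ 2)%:C *: f) = (t ^+ 2)%:C * L2inner y y.
    rewrite (L2innerC Ltf LAy) (L2innerZl _ Lf LAy) rmorphM/= conj_real; congr (_ * _).
    by rewrite -L2inner_mulmx Afy -(L2innerC Ly Ly).
  rewrite Re_scale L2inner_self yn.
  move: (sqle _ _ (L2norm_ge0 _) nAy); rewrite yn.
  by set u := _ ^+ 2; set v := L2norm f; clear; move=> h; nra.
by apply: filterS => z /eqP; rewrite subr_eq0 => /eqP.
Qed.

Lemma embed_blockB m1 m2 n1 n2 (Phi : T -> 'M[C]_(m1 + m2, n1 + n2)) (Q Q0 : T -> 'M[C]_(m1, n1)) z :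
  (Phi z - embed_block m2 n2 Q0 z) - (Phi z - embed_block m2 n2 Q z) =
  embed_block m2 n2 (fun z => Q z - Q0 z) z.
Proof.
rewrite opprB addrC addrA subrK /embed_block opp_block_mx add_block_mx !oppr0 !addr0.
by [].
Qed.

Lemma extremal_annihilation m1 m2 n1 n2 (Phi : T -> 'M[C]_(m1 + m2, n1 + n2)) t
    (Q Q0 : T -> 'M[C]_(m1, n1)) f : Linf Phi -> 0 <= t -> Hinf Q -> Hinf Q0 ->
  ae_bound (fun z => Phi z - embed_block m2 n2 Q z) t ->
  ae_bound (fun z => Phi z - embed_block m2 n2 Q0 z) t -> fb_dom f ->
  L2norm (Gamma Phi f) = t * L2norm f ->
  {ae mu, forall z, (Q z - Q0 z) *m usubmx (f z) = 0} /\
  {ae mu, forall z, (Q z - Q0 z)^t* *m usubmx (Gamma Phi f z) = 0}.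
Proof.
move=> LPhi t0 HQ HQ0 At At0 df yn.
have [h1 h2] := extremal_identities LPhi t0 HQ At df yn.
have [k1 k2] := extremal_identities LPhi t0 HQ0 At0 df yn.
split.
  apply: filterS2 h1 k1 => z h1 k1.
  have : embed_block m2 n2 (fun z => Q z - Q0 z) z *m f z = 0.
    by rewrite -(embed_blockB Phi) mulmxBl k1 h1 subrr.
  by rewrite mul_embed_block => /(congr1 usubmx); rewrite col_mxKu linear0.
apply: filterS2 h2 k2 => z h2 k2.
have : (embed_block m2 n2 (fun z => Q z - Q0 z) z)^t* *m Gamma Phi f z = 0.
  by rewrite -(embed_blockB Phi) linearB/= map_mxB mulmxBl k2 h2 subrr.
rewrite /embed_block tr_block_mx map_block_mx !trmx0 !map_mx0.
rewrite -{1}[Gamma Phi f z]vsubmxK mul_block_col !mul0mx !addr0.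
by move/(congr1 usubmx); rewrite col_mxKu linear0.
Qed.

Lemma inner_scal_mod (theta : T -> C) : inner (scal theta) ->
  {ae mu, forall z, normc (theta z) = 1}.
Proof.
move=> [_]; apply: filterS => z /(_ 1%:M); rewrite mulmx1 /scal.
rewrite -[(theta z)%:M]mulmx1 mul_scalar_mx vnormZ.
have -> : vnorm (1%:M : 'cV[C]_1) = 1.
  by rewrite /vnorm big_ord1 mxE eqxx normc1 expr1n sqrtr1.
by rewrite mulr1.
Qed.

(** It selects the block of size [k] of [1 + (k + l)], where the columns of [Vc] and [Wc] sit. It
    mediates between the grouping [(1 + k) + l] in which [V] and [W] are described and the grouping
    [1 + (k + l)] of the diagonal factor. *)
Definition mid_mx k l : 'M[C]_(k, 1 + (k + l)) := row_mx 0 (upper_mx k l).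

Lemma mid_cols k q n2 (X : 'M[C]_(k, q.+1 + n2)) (a : 'cV[C]_k) (B : 'M[C]_(k, q)) :
  (lsubmx X = row_mx a B :> 'M[C]_(k, 1 + q)) -> X *m (mid_mx q n2)^t* = B.
Proof.
move=> XB.
have -> : X *m (mid_mx q n2)^t* = lsubmx (rsubmx (X : 'M[C]_(k, 1 + (q + n2)))).
  rewrite adj_row_mx adj_row_mx adj1 !adj0 -{1}[X](@hsubmxK _ k 1 (q + n2)).
  rewrite (mul_row_col (lsubmx (X : 'M[C]_(k, 1 + (q + n2))))) mulmx0 add0r.
  by rewrite -{1}[rsubmx _]hsubmxK mul_row_col mulmx0 mulmx1 addr0.
(* The two groupings name the same column by different ordinals; only their values are compared. *)
apply/matrixP => i j; have := congr1 (fun A : 'M[C]_(k, 1 + q) => A i (rshift 1 j)) XB.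
rewrite row_mxEr => <-; rewrite !mxE; congr (X i _); exact: val_inj.
Qed.

Lemma block_sub_mid p m2 q n2 (a : 'M[C]_1) (X : 'M[C]_(p + m2, q + n2)) (Y : 'M[C]_(p, q)) :
  block_mx a 0 0 (X - block_mx Y 0 0 0) =
  block_mx a 0 0 X - (mid_mx p m2)^t* *m Y *m mid_mx q n2.
Proof.
have -> : (mid_mx p m2)^t* *m Y *m mid_mx q n2 = block_mx 0 0 0 (block_mx Y 0 0 0).
  rewrite adj_row_mx adj_row_mx adj1 !adj0 !mul_col_mx mul0mx mul1mx mul0mx.
  rewrite !mul_mx_row !mulmx0 mulmx1 !mul0mx.
  have -> : col_mx (row_mx 0 (row_mx Y 0)) (row_mx 0 (row_mx 0 0)) =
      row_mx 0 (block_mx Y 0 0 0) :> 'M[C]_(p + m2, 1 + (q + n2)).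
    by rewrite -[LHS]/(block_mx 0 (row_mx Y 0) 0 (row_mx 0 0)) block_mxEh col_mx0.
  by rewrite [RHS]/block_mx row_mx0.
by rewrite [X in _ = _ + X]opp_block_mx [RHS]add_block_mx !oppr0 !addr0.
Qed.

End superoptimal_step.

(** * Unitary factors and recovery of the middle block *)

Section unitary_dilation.
Context {R : realType}.
Local Notation C := R[i].
Local Notation T := (circle R).
Local Notation mu := (@arc_length R).

Lemma vnorm_unitary_adj k (U : 'M[C]_k) (x : 'cV[C]_k) : U \is unitarymx ->
  vnorm (U^t* *m x) = vnorm x.
Proof. by move=> /unitarymxP UU; exact: vnorm_coisometry_adj. Qed.

Lemma unitary_adjK k (U : 'M[C]_k) : U \is unitarymx -> U^t* *m U = 1%:M.
Proof. by move=> /unitarymxP /mulmx1C. Qed.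

Lemma vnorm_unitary k (U : 'M[C]_k) (x : 'cV[C]_k) : U \is unitarymx ->
  vnorm (U *m x) = vnorm x.
Proof.
move=> UU; have h : U^t* *m (U^t*)^t* = 1%:M by rewrite adjmxK unitary_adjK.
by have := vnorm_coisometry_adj x h; rewrite adjmxK.
Qed.

(** Unitary factors preserve the bound, and the bound for a block diagonal matrix splits into those
    of its blocks; for the converse part it is tested on [V] applied to a vector with vanishing
    first coordinate. *)
Lemma diag_bound k l (W : 'M[C]_(1 + k)) (V : 'M[C]_(1 + l)) (a : C) (X : 'M[C]_(k, l)) t :
  W \is unitarymx -> V \is unitarymx -> 0 <= t -> normc a <= t ->
  (forall x, vnorm (W^t* *m block_mx a%:M 0 0 X *m V^t* *m x) <= t * vnorm x) <->
  (forall y, vnorm (X *m y) <= t * vnorm y).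
Proof.
move=> UW UV t0 at0; split => [h y|h x].
  have := h (V *m col_mx 0 y).
  rewrite -(mulmxA _ (V^t*)) (mulmxA (V^t*)) (unitary_adjK UV) mul1mx -mulmxA.
  rewrite (vnorm_unitary_adj _ UW) (vnorm_unitary _ UV) mul_block_col !mul0mx mulmx0 !add0r.
  have E m (z : 'cV[C]_m) : vnorm (col_mx (0 : 'cV[C]_1) z) = vnorm z.
    apply/eqP; rewrite -(@eqrXn2 _ 2) ?vnorm_ge0// sqr_vnorm_col vnorm0 expr0n/= add0r.
    by [].
  by rewrite !E.
rewrite -mulmxA -mulmxA (vnorm_unitary_adj _ UW) -(vnorm_unitary_adj x UV).
set y := V^t* *m x; rewrite -ler_sqr ?nnegrE ?vnorm_ge0 ?mulr_ge0 ?vnorm_ge0//.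
rewrite -[y]vsubmxK mul_block_col !mul0mx addr0 add0r exprMn !sqr_vnorm_col mulrDr.
rewrite -!exprMn mul_scalar_mx vnormZ; apply: lerD.
  rewrite ler_sqr ?nnegrE ?mulr_ge0 ?vnorm_ge0 ?normc_ge0//.
  by rewrite ler_wpM2r ?vnorm_ge0.
by rewrite ler_sqr ?nnegrE ?mulr_ge0 ?vnorm_ge0.
Qed.

Lemma unitary_row_decomp k l (v : 'M[C]_(k, l)) m (B : 'M[C]_(k, m)) :
  row_mx v (map_mx Num.conj B) \is unitarymx -> v *m v^t* + map_mx Num.conj B *m B^T = 1%:M.
Proof.
move=> /unitarymxP; rewrite adj_row_mx mul_row_col => <-; congr (_ + _ *m _).
by apply/matrixP => i j; rewrite !mxE conjCK.
Qed.

Lemma normc_conj (x : C) : normc x^* = normc x.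
Proof.
by apply/eqP; rewrite -(@eqrXn2 _ 2) ?normc_ge0// !sqr_normcE Re_conjC Im_conjC sqrrN.
Qed.

Lemma conj_mid_mx k l : map_mx Num.conj ((mid_mx k l)^t*) = (mid_mx k l)^t* :> 'M[C]_(1 + (k + l), k).
Proof.
by rewrite adj_row_mx adj_row_mx adj1 !adj0 !map_col_mx !map_mx0 map_mx1.
Qed.

(** The unitary rows resolve the identity, and the annihilation hypotheses remove the terms with
    [vi] and [wi], leaving [D = Wc Q1 Vc^t]. The formula for [Q1] contains conjugates, so its
    analyticity is not visible there; it is obtained by cancelling the outer factors of the
    product. *)
Lemma corner_completion p q (vi : T -> 'cV[C]_q.+1) (Vc : T -> 'M[C]_(q.+1, q))
    (wi : T -> 'cV[C]_p.+1) (Wc : T -> 'M[C]_(p.+1, p)) (D : T -> 'M[C]_(p.+1, q.+1)) :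
  Hinf Vc -> Hinf Wc -> co_outer Vc -> co_outer Wc ->
  {ae mu, forall z, row_mx (vi z) (map_mx Num.conj (Vc z)) \is unitarymx} ->
  {ae mu, forall z, row_mx (wi z) (map_mx Num.conj (Wc z)) \is unitarymx} ->
  Hinf D -> {ae mu, forall z, D z *m vi z = 0} -> {ae mu, forall z, (wi z)^T *m D z = 0} ->
  exists2 Q1, Hinf Q1 & {ae mu, forall z, D z = Wc z *m Q1 z *m (Vc z)^T}.
Proof.
move=> [LV _] [LW _] oV oW uV uW HD Dv wD; have [LD _] := HD.
pose Q1 z := (Wc z)^t* *m D z *m map_mx Num.conj (Vc z).
have DE : {ae mu, forall z, Wc z *m Q1 z *m (Vc z)^T = D z}.
  apply: filterS2 (filterI uV uW) (filterI Dv wD) => z [hV hW] [hv hw].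
  have dV := unitary_row_decomp hV.
  have dW : map_mx Num.conj (wi z) *m (wi z)^T + Wc z *m (Wc z)^t* = 1%:M.
    have := congr1 (map_mx Num.conj) (unitary_row_decomp hW).
    by rewrite map_mxD !map_mxM !conjmxK map_mx1.
  have e1 : D z *m (map_mx Num.conj (Vc z) *m (Vc z)^T) = D z.
    by rewrite -[RHS]mulmx1 -dV mulmxDr (mulmxA _ (vi z)) hv mul0mx add0r.
  have e2 : Wc z *m (Wc z)^t* *m D z = D z.
    by rewrite -[RHS]mul1mx -dW mulmxDl -(mulmxA (map_mx Num.conj (wi z))) hw mulmx0 add0r.
  by rewrite /Q1 !mulmxA e2 -mulmxA e1.
have LQ1 : Linf Q1 by exact: LinfM (LinfM (Linf_adj LW) LD) (Linf_conj LV).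
have LWQ : Linf (fun z => Wc z *m Q1 z) by exact: LinfM.
have HVt : Hinf (fun z => (Vc z)^T) by case: oV.
have HWt : Hinf (fun z => (Wc z)^T) by case: oW.
have LK := LinfM LWQ (proj1 HVt).
have HK : Hinf (fun z => Wc z *m Q1 z *m (Vc z)^T).
  apply: Hinf_ae HD; first by case: LK.
  by apply: filterS DE => z ->.
(* [outer_cancel] removes right factors only: first the transpose of [Vc], then, after transposing
   the remaining product, the transpose of [Wc]. *)
have HWQ := HinfT (outer_cancel oV LWQ HK).
have LQt : Linf (fun z => (Q1 z)^T).
  rewrite (_ : (fun z => _) = fun z => map_mx Num.conj ((Q1 z)^t*)).
    exact: Linf_conj (Linf_adj LQ1).
  by apply/funext => z; rewrite conjmxK.
have HQt : Hinf (fun z => (Q1 z)^T *m (Wc z)^T).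
  by under [X in Hinf X]eq_fun do rewrite -trmx_mul.
have := HinfT (outer_cancel oW LQt HQt).
under [X in Hinf X -> _]eq_fun do rewrite trmxK.
by move=> HQ1; exists Q1 => //; apply: filterS DE => z ->.
Qed.

Section construction.
Variables (p m2 q n2 : nat) (Phi : T -> 'M[C]_(p.+1 + m2, q.+1 + n2)) (t0 : R).
Variable c : fb_construction Phi t0.

(** An inequality rather than equality: where [fb_h] vanishes the quotient is 0 by convention, and
    the upper bound is what the norm comparison requires. *)
Lemma fb_u0_le1 : {ae mu, forall z, normc (fb_u0 c z) <= 1}.
Proof.
have [th _ _] := fb_theta_gcd c; have [ta _ _] := fb_tau_gcd c.
apply: filterS2 (inner_scal_mod th) (inner_scal_mod ta) => z ht hu.
rewrite /fb_u0 !normcM normcV !normc_conj ht hu normc_val !mul1r.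
have [->|h0] := eqVneq (normc (fb_h c z)) 0; first by rewrite mul0r.
by rewrite mulfV.
Qed.

Lemma fb_V_mid : {ae mu, forall z, fb_V c z *m (mid_mx q n2)^t* =
  col_mx (map_mx Num.conj (fb_Vc c z)) 0}.
Proof.
apply: filterS (fb_VE c) => z h; apply: (mid_cols (a := col_mx (usubmx (fb_v c z)) (dsubmx (fb_v c z)))).
by rewrite h block_mxEh.
Qed.

Lemma fb_W_mid : {ae mu, forall z, (fb_W c z)^t* *m (mid_mx p m2)^t* = col_mx (fb_Wc c z) 0}.
Proof.
apply: filterS (fb_WE c) => z h.
have E : lsubmx ((fb_W c z)^T) = row_mx (col_mx (usubmx (fb_w c z)) (dsubmx (fb_w c z)))
    (col_mx (map_mx Num.conj (fb_Wc c z)) 0) :> 'M[C]_(p.+1 + m2, 1 + p).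
  by rewrite h block_mxEh.
have := congr1 (map_mx Num.conj) (mid_cols E).
rewrite map_mxM conj_mid_mx map_col_mx map_mx0 conjmxK.
exact.
Qed.

Lemma fb_factoredB (Psi : T -> 'M[C]_(p + m2, q + n2)) (Q1 : T -> 'M[C]_(p, q)) :
  {ae mu, forall z, fb_factored c (fun z => Psi z - embed_block m2 n2 Q1 z) z =
    fb_factored c Psi z - embed_block m2 n2 (fun z => fb_Wc c z *m Q1 z *m (fb_Vc c z)^T) z}.
Proof.
apply: filterS2 fb_V_mid fb_W_mid => z hV hW.
have hV' : mid_mx q n2 *m (fb_V c z)^t* = row_mx (fb_Vc c z)^T 0.
  rewrite -[mid_mx q n2]adjmxK -adjmxM hV tr_col_mx map_row_mx trmx0 map_mx0.
  by congr row_mx; rewrite -map_trmx conjmxK.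
rewrite /fb_factored {1}/embed_block block_sub_mid.
rewrite mulmxBr mulmxBl; congr (_ - _).
transitivity ((fb_W c z)^t* *m (mid_mx p m2)^t* *m Q1 z *m (mid_mx q n2 *m (fb_V c z)^t*)).
  by rewrite !mulmxA.
rewrite hV' hW mul_col_mx mul0mx mul_col_mx mul0mx mul_mx_row mulmx0.
by rewrite /embed_block /block_mx row_mx0.
Qed.

Lemma fb_factored_bound (Psi : T -> 'M[C]_(p + m2, q + n2)) : 0 <= t0 ->
  ae_bound (fb_factored c Psi) t0 <-> ae_bound Psi t0.
Proof.
move=> t00; have H : {ae mu, forall z,
    (forall x, vnorm (fb_factored c Psi z *m x) <= t0 * vnorm x) <->
    (forall y, vnorm (Psi z *m y) <= t0 * vnorm y)}.
  apply: filterS2 (filterI (fb_W_unitary c) (fb_V_unitary c)) fb_u0_le1 => z [hW hV] hu.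
  apply: (diag_bound _ hW hV t00).
  rewrite normcM [normc _%:C]/= expr0n/= addr0 sqrtr_sqr ger0_norm//.
  by rewrite ler_piMr.
by split => h; apply: filterS2 H h => z [h1 h2]; [exact: h1|exact: h2].
Qed.

End construction.

End unitary_dilation.

(** * Optimality as a norm bound *)

Section optimal_solutions.
Context {R : realType}.
Local Notation C := R[i].
Local Notation T := (circle R).
Local Notation mu := (@arc_length R).
Variables (p m2 q n2 : nat).
Variables (Phi11 : T -> 'M[C]_(p.+1, q.+1)) (Phi12 : T -> 'M[C]_(p.+1, n2)).
Variables (Phi21 : T -> 'M[C]_(m2, q.+1)) (Phi22 : T -> 'M[C]_(m2, n2)).
Let Phi := fb_block Phi11 Phi12 Phi21 Phi22.
Variable t0 : R.
Hypotheses (LPhi : Linf Phi) (Gt : Gamma_norm Phi = t0%:E) (t0_gt0 : 0 < t0).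

(** An optimal [Q] competes with the almost optimal functions of [four_block_Nehari], for each [e].
    Conversely, a competitor with error below [t0] would make the norm of the four block operator
    smaller than [t0]. *)
Lemma fb_optimalP (Q : T -> 'M[C]_(p.+1, q.+1)) :
  fb_optimal Phi11 Phi12 Phi21 Phi22 Q <->
  Hinf Q /\ ae_bound (fun z => Phi z - embed_block m2 n2 Q z) t0.
Proof.
have t00 : 0 <= t0 by exact: ltW.
have /LinfP[mPhi [B B0 PB]] := LPhi.
split => [[HQ opt]|[HQ Qt]]; (split; first exact: HQ).
  apply/(Linf_norm_leP _ t00); apply/lee_addgt0Pr => e e0.
  have [Q' HQ' Q't] := four_block_Nehari LPhi t00
    (fun f g => Gamma_form_le mPhi PB B0 Gt) e0.
  have := opt _ HQ'; rewrite !fb_blockB => h; apply: (le_trans h).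
  by apply/(Linf_norm_leP _ (addr_ge0 t00 (ltW e0))).
move=> Q' HQ'; rewrite !fb_blockB.
apply: (@le_trans _ _ t0%:E); first exact/(Linf_norm_leP _ t00).
rewrite leNgt; apply/negP => lt.
(* The essential supremum is an extended real and [Gamma_norm_le] asks for a nonnegative real bound;
   truncation at 0 stays below [t0] because [t0 > 0]. *)
have [M M0 MQ] : exists2 M : R, 0 <= M < t0 &
    (Linf_norm (fun z => (Phi z - embed_block m2 n2 Q' z)%R) <= M%:E)%E.
  move: lt; case: (Linf_norm _) => [r| |] //; last first.
    by exists 0; rewrite ?lexx ?t0_gt0// leNye.
  rewrite lte_fin => rt; exists (Num.max 0 r); last by rewrite lee_fin le_max lexx orbT.
  by rewrite le_max lexx /= gt_max t0_gt0.
have /andP[M00 Mt] := M0.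
have /(Linf_norm_leP _ M00) h := MQ.
have := Gamma_norm_le mPhi PB M00 HQ' h.
by rewrite Gt lee_fin leNgt Mt.
Qed.

End optimal_solutions.

Local Open Scope complex_scope.

Theorem theorem4p2 (R : realType) (p m2 q n2 : nat)
  (Phi11 : circle R -> 'M[R[i]]_(p.+1, q.+1))
  (Phi12 : circle R -> 'M[R[i]]_(p.+1, n2))
  (Phi21 : circle R -> 'M[R[i]]_(m2, q.+1))
  (Phi22 : circle R -> 'M[R[i]]_(m2, n2))
  (t0 : R)
  (c : fb_construction (fb_block Phi11 Phi12 Phi21 Phi22) t0)
  (Q0 : circle R -> 'M[R[i]]_(p.+1, q.+1))
  (Psi11 : circle R -> 'M[R[i]]_(p, q))
  (Psi12 : circle R -> 'M[R[i]]_(p, n2))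
  (Psi21 : circle R -> 'M[R[i]]_(m2, q))
  (Psi22 : circle R -> 'M[R[i]]_(m2, n2))
  (Q : circle R -> 'M[R[i]]_(p.+1, q.+1)) :
  Linf (fb_block Phi11 Phi12 Phi21 Phi22) ->
  (Gamma_ess_norm (fb_block Phi11 Phi12 Phi21 Phi22) <
   Gamma_norm (fb_block Phi11 Phi12 Phi21 Phi22))%E ->
  Gamma_norm (fb_block Phi11 Phi12 Phi21 Phi22) = t0%:E ->
  fb_optimal Phi11 Phi12 Phi21 Phi22 Q0 ->
  measurable_mx Psi11 -> measurable_mx Psi12 ->
  measurable_mx Psi21 -> measurable_mx Psi22 ->
  (\forall z \ae @arc_length R,
     fb_block (fun w => Phi11 w - Q0 w) Phi12 Phi21 Phi22 z =
     fb_factored c (fb_block Psi11 Psi12 Psi21 Psi22) z) ->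
  measurable_mx Q ->
  fb_optimal Phi11 Phi12 Phi21 Phi22 Q <->
  exists Q1 : circle R -> 'M[R[i]]_(p, q),
    [/\ Hinf Q1,
        (\forall z \ae @arc_length R,
           fb_block (fun w => Phi11 w - Q w) Phi12 Phi21 Phi22 z =
           fb_factored c
             (fb_block (fun w => Psi11 w - Q1 w) Psi12 Psi21 Psi22) z) &
        (Linf_norm (fb_block (fun w => Psi11 w - Q1 w)%R Psi12 Psi21 Psi22)
           <= t0%:E)%E].
Proof.
set Phi := fb_block Phi11 Phi12 Phi21 Phi22 in c *.
set Psi := fb_block Psi11 Psi12 Psi21 Psi22.
move=> LPhi eG Gt opt0 _ _ _ _ fact0 mQ.
have t0_gt0 : 0 < t0 by rewrite -lte_fin -Gt; apply: le_lt_trans eG; exact: ess_norm_ge0.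
have t00 := ltW t0_gt0.
have [HQ0 bQ0] := (fb_optimalP LPhi Gt t0_gt0 Q0).1 opt0.
rewrite fb_blockB in fact0.
split.
  move=> /(fb_optimalP LPhi Gt t0_gt0)[HQ bQ].
  have [df fn fE] := fb_f_max c.
  have yn : L2norm (Gamma Phi (fb_f c)) = t0 * L2norm (fb_f c).
    by move: fE; rewrite Gt => -[].
  have [h1 h2] := extremal_annihilation LPhi t00 HQ HQ0 bQ bQ0 df yn.
  pose D z := Q z - Q0 z.
  have HD : Hinf D by exact: HinfB.
  (* The column [v_1] is a scalar multiple of [f_1], hence killed by [D]; its outer factor is
     nonzero almost everywhere and can be divided out. *)
  have Dvi : {ae @arc_length R, forall z, D z *m fb_vi c z = 0}.
    apply: filterS2 (filterI h1 (outer_neq0 (fb_vo_outer c))) (fb_v1E c) => z [hz vo0] vE.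
    have : D z *m usubmx (fb_v c z) = 0.
      by rewrite /fb_v linearZ/= -scalemxAr /D hz scaler0.
    rewrite vE -scalemxAr => /eqP; rewrite scaler_eq0 (negPf vo0)/= => /eqP.
    exact.
  have wiD : {ae @arc_length R, forall z, (fb_wi c z)^T *m D z = 0}.
    apply: filterS2 (filterI h2 (outer_neq0 (fb_wo_outer c))) (fb_w1E c) => z [hz wo0] wE.
    have : (usubmx (fb_w c z))^T *m D z = 0.
      (* [w_1] is a scalar multiple of the entrywise conjugate of the first block of [Gamma Phi f];
         annihilation by the adjoint of [D] thus becomes annihilation by the transpose of [w_1] on
         the left. *)
      have [a ->] : exists a, usubmx (fb_w c z) =
          a *: map_mx Num.conj (usubmx (Gamma Phi (fb_f c) z)).
        exists ((val z)^* * (fb_tau c z)^* / fb_h c z * ((t0^-1)%:C)^*).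
        by apply/matrixP => i j; rewrite !mxE rmorphM/= mulrA.
      rewrite linearZ/= -scalemxAl map_trmx.
      by rewrite -[D z]adjmxK -adjmxM /D hz adj0 scaler0.
    rewrite wE linearZ/= -scalemxAl => /eqP; rewrite scaler_eq0 (negPf wo0)/= => /eqP.
    exact.
  have [Q1 HQ1 DE] := corner_completion (proj1 (fb_Vc_inner c)) (proj1 (fb_Wc_inner c))
    (fb_Vc_co_outer c) (fb_Wc_co_outer c) (fb_Vc_unitary c) (fb_Wc_unitary c) HD Dvi wiD.
  have E : {ae @arc_length R, forall z, Phi z - embed_block m2 n2 Q z =
      fb_factored c (fun z => Psi z - embed_block m2 n2 Q1 z) z}.
    apply: filterS2 (filterI fact0 DE) (fb_factoredB c Psi Q1) => z [f0 dE] ->.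
    have -> : embed_block m2 n2 (fun z => fb_Wc c z *m Q1 z *m (fb_Vc c z)^T) z =
        embed_block m2 n2 D z by rewrite /embed_block dE.
    by rewrite -f0 -(embed_blockB Phi) subKr.
  exists Q1; split; [exact: HQ1|by rewrite !fb_blockB; exact: E|].
  rewrite fb_blockB; apply/(Linf_norm_leP _ t00)/(fb_factored_bound c _ t00).
  exact: ae_bound_eq E bQ.
move=> [Q1 [HQ1 E bQ1]].
rewrite !fb_blockB in E bQ1.
apply/(fb_optimalP LPhi Gt t0_gt0); split; last first.
  move/(Linf_norm_leP _ t00)/(fb_factored_bound c _ t00) : bQ1.
  by apply: ae_bound_eq; apply: filterS E => z ->.
pose D z := fb_Wc c z *m Q1 z *m (fb_Vc c z)^T.
have HD : Hinf D.
  apply: Hinf_mul (Hinf_mul (proj1 (fb_Wc_inner c)) HQ1) _.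
  exact: HinfT (proj1 (fb_Vc_inner c)).
(* The equation determines [Q] as [Q0 + D] only almost everywhere, read off from the upper left
   blocks; membership in [Hinf] passes to this representative because it is measurable. *)
apply: Hinf_ae mQ _ (HinfD HQ0 HD).
apply: filterS2 (filterI fact0 E) (fb_factoredB c Psi Q1) => z [f0 eQ] e1.
have : embed_block m2 n2 (fun z => Q z - Q0 z) z = embed_block m2 n2 D z.
  by rewrite -(embed_blockB Phi) f0 eQ e1 subKr.
move=> /(congr1 ulsubmx); rewrite !block_mxKul => <-.
by rewrite addrC subrK.
Qed.
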